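(* Let $-\Delta$ denote the negative Laplacian on $L^2[0,\pi]$ with Dirichlet boundary conditions, and let $n\in\mathbb N$. Then there exist exponentially bounded kernels $K_n$ and $K_{n+1}$ on $[0,\infty)$ such that the polyharmonic operator $\Delta^{2^n}=(-\Delta)^{2^n}$ (with its natural domain as a power of $-\Delta$) acting on $L^2[0,\pi]$ generates an exponentially bounded $K_n$-convoluted cosine function and an exponentially bounded analytic $K_{n+1}$-convoluted semigroup of angle $\frac\pi2$.
   Context: $E=L^2[0,\pi]$. A function $K\in L^1_{loc}([0,\infty))$ is a kernel if for $\phi\in C([0,\infty))$, $\int_0^tK(t-s)\phi(s)ds=0$ for all $t\ge0$ implies $\phi\equiv0$. It is exponentially bounded if $|K(t)|\le Me^{\beta t}$ for some $M>0$, $\beta\in\mathbb R$ and all $t\geq 0$. Put $\Theta(t)=\int_0^tK(s)ds$. A closed operator $B$ on $E$ generates an exponentially bounded $K$-convoluted cosine function $(C_K(t))_{t\ge0}\subset L(E)$ if the family is strongly continuous, $\|C_K(t)\|\le Me^{\omega t}$ for some $M>0$, $\omega\in\mathbb R$, $C_K(t)B\subset BC_K(t)$, and for all $x\in E$, $t\ge0$: $\int_0^t(t-s)C_K(s)x\,ds\in D(B)$ and $B\int_0^t(t-s)C_K(s)x\,ds=C_K(t)x-\Theta(t)x$. $B$ generates a $K$-convoluted semigroup $(S_K(t))_{t\ge0}\subset L(E)$ if the family is strongly continuous, $S_K(t)B\subset BS_K(t)$, and for all $x\in E$, $t\ge0$: $\int_0^tS_K(s)x\,ds\in D(B)$ and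 $B\int_0^tS_K(s)x\,ds=S_K(t)x-\Theta(t)x$. With $\Sigma_\alpha=\{re^{i\theta}:r>0,|\theta|<\alpha\}$, it is exponentially bounded analytic of angle $\alpha\in(0,\frac\pi2]$ if there is an analytic $\mathbf S_K:\Sigma_\alpha\to L(E)$ with $\mathbf S_K(t)=S_K(t)$ for $t>0$, $\lim_{z\to0,z\in\Sigma_\gamma}\mathbf S_K(z)x=0$ for all $\gamma\in(0,\alpha)$, $x\in E$, and for every $\gamma\in(0,\alpha)$ there are $M_\gamma,\omega_\gamma>0$ with $\|\mathbf S_K(z)\|\le M_\gamma e^{\omega_\gamma\operatorname{Re}z}$, $z\in\Sigma_\gamma$. *)

(* Defs.v *)
From HB Require Import structures.
From mathcomp Require Import all_boot all_order all_algebra complex.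
From mathcomp Require Import all_classical all_reals all_analysis.
From mathcomp Require Import measurable_realfun ring_quotient.

Set Implicit Arguments.
Unset Strict Implicit.
Unset Printing Implicit Defensive.
Import Order.TTheory GRing.Theory Num.Theory numFieldNormedType.Exports.
Import Normc.

Local Open Scope classical_set_scope.
Local Open Scope complex_scope.
Local Open Scope quotient_scope.
Local Open Scope ring_scope.

(* Lspace is restricted to real-valued functions and has no vector space
   structure on classes, so the complex space L^2(mu) is built here as the
   quotient of the square-integrable T -> R[i] by the a.e. null functions, with
   the norm (\int |f|^2)^(1/2); as for any normedModType R[i], norms are
   elements of R[i] lying on the real axis. *)
Section complex_L2.
Context {d} {T : measurableType d} {R : realType}.
Variable mu : {measure set T -> \bar R}.

Definition square_integrable (f : T -> R[i]) : Prop :=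
  [/\ measurable_fun setT (fun x => complex.Re (f x)),
      measurable_fun setT (fun x => complex.Im (f x)) &
      finite_norm mu 2%:E (fun x => normc (f x))].

Definition cLfun2 : {pred T -> R[i]} := mem [set f | square_integrable f].

Lemma cLfun2P f : reflect (square_integrable f) (f \in cLfun2).
Proof. by apply: (iffP idP); rewrite inE. Qed.

Lemma normcEsqrt (z : R[i]) :
  normc z = Num.sqrt (complex.Re z ^+ 2 + complex.Im z ^+ 2).
Proof. by case: z. Qed.

Lemma normc_ge0 (z : R[i]) : 0 <= normc z.
Proof. by rewrite normcEsqrt sqrtr_ge0. Qed.

Lemma normCE (z : R[i]) : `|z| = (normc z)%:C.
Proof. by rewrite normc_def normcEsqrt. Qed.

Lemma normc_triangle (x y : R[i]) : normc (x + y) <= normc x + normc y.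
Proof. by have := ler_normD x y; rewrite !normCE -rmorphD lecR. Qed.

Lemma measurable_normc (f : T -> R[i]) :
  measurable_fun setT (fun x => complex.Re (f x)) ->
  measurable_fun setT (fun x => complex.Im (f x)) ->
  measurable_fun setT (fun x => normc (f x)).
Proof.
move=> mr mi; rewrite (_ : (fun _ => _) = (fun x =>
    (complex.Re (f x) ^+ 2 + complex.Im (f x) ^+ 2) `^ 2^-1)); last first.
  apply/funext => x.
  by rewrite normcEsqrt powR12_sqrt// addr_ge0 ?sqr_ge0.
apply: (@measurableT_comp _ _ _ _ _ _ (fun y : R => y `^ 2^-1)).
  exact: measurable_powR.
by apply: measurable_funD; exact: measurable_funX.
Qed.

Lemma Lnorm2_le (f g : T -> R) :
  measurable_fun setT f -> measurable_fun setT g ->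
  (forall x, 0 <= f x <= g x) ->
  ('N[mu]_2%:E [EFin \o f] <= 'N[mu]_2%:E [EFin \o g])%E.
Proof.
move=> mf mg fg; rewrite unlock /Lnorm.
have m2 (h : T -> R) : measurable_fun setT h ->
    measurable_fun setT (fun x => (`|(EFin \o h) x| `^ 2)%E).
  move=> mh.
  apply: (@measurableT_comp _ _ _ _ _ _ (fun x : \bar R => (x `^ 2)%E)).
    exact: measurable_poweR.
  by apply: measurableT_comp => //; exact/measurable_EFinP.
rewrite gt0_ler_poweR//.
- by rewrite in_itv/= leey integral_ge0// => x _; rewrite poweR_ge0.
- by rewrite in_itv/= leey integral_ge0// => x _; rewrite poweR_ge0.
- apply: ge0_le_integral => //; try exact: m2.
  + by move=> x _; rewrite poweR_ge0.
  + move=> x _; have /andP[f0 fgx] := fg x.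
    rewrite lee_fin ge0_ler_powR// ?nnegrE//.
    by rewrite !ger0_norm// (le_trans f0).
Qed.

Lemma normc_Lfun f : square_integrable f -> (fun x => normc (f x)) \in Lfun mu 2%:E.
Proof.
case=> mr mi ff; rewrite inE; apply/andP; split; rewrite inE//.
exact: measurable_normc.
Qed.

Lemma Lnorm2Z f (a : R[i]) : square_integrable f ->
  ('N[mu]_2%:E [EFin \o (fun x => normc (a * f x)%R)] =
   (normc a)%:E * 'N[mu]_2%:E [EFin \o (fun x => normc (f x))])%E.
Proof.
move=> /normc_Lfun nf.
have p1 : (1 <= 2%:E :> \bar R)%E by rewrite lee_fin ler1n.
have := LnormZ (Lfun_Sub p1 nf) (normc a).
rewrite ger0_norm ?normc_ge0// => <-; apply: eq_Lnorm => x /=.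
by rewrite normcM.
Qed.

Lemma cLfun2_submod_closed : submod_closed cLfun2.
Proof.
split.
  apply/cLfun2P; split => //.
  rewrite (_ : (fun _ => _) = cst 0); last by apply/funext => x; exact: normc0.
  by apply: finite_norm_cst0; rewrite lee_fin ler1n.
have reE (a b c : R[i]) : complex.Re (a * b + c) =
    complex.Re a * complex.Re b - complex.Im a * complex.Im b + complex.Re c.
  by case: a b c => [? ?] [? ?] [? ?].
have imE (a b c : R[i]) : complex.Im (a * b + c) =
    complex.Re a * complex.Im b + complex.Im a * complex.Re b + complex.Im c.
  by case: a b c => [? ?] [? ?] [? ?].
move=> a f g /cLfun2P ff /cLfun2P gg; apply/cLfun2P.
have [fr fi fn] := ff; have [gr gi gn] := gg.
have mre : measurable_fun setT (fun x => complex.Re ((a *: f + g) x)).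
  have -> : (fun x => complex.Re ((a *: f + g) x)) = (fun x =>
      complex.Re a * complex.Re (f x) - complex.Im a * complex.Im (f x)
      + complex.Re (g x)) by apply/funext => x; exact: reE.
  apply: measurable_funD => //; apply: measurable_funB;
    exact: measurable_funM.
have mim : measurable_fun setT (fun x => complex.Im ((a *: f + g) x)).
  have -> : (fun x => complex.Im ((a *: f + g) x)) = (fun x =>
      complex.Re a * complex.Im (f x) + complex.Im a * complex.Re (f x)
      + complex.Im (g x)) by apply/funext => x; exact: imE.
  apply: measurable_funD => //; apply: measurable_funD;
    exact: measurable_funM.
split => //.
have maf : measurable_fun setT (fun x => normc (a * f x)).
  under eq_fun do rewrite normcM.
  by apply: measurable_funM => //; exact: measurable_normc.
have mg : measurable_fun setT (fun x => normc (g x)) by exact: measurable_normc.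
rewrite /finite_norm.
apply: (@le_lt_trans _ _
  ('N[mu]_2%:E [EFin \o ((fun x => normc (a * f x)%R) \+ (fun x => normc (g x)))%R])%E).
  apply: Lnorm2_le; [exact: measurable_normc|exact: measurable_funD|].
  by move=> x; rewrite normc_ge0 normc_triangle.
apply: (le_lt_trans (eminkowski _ maf mg _)); first by rewrite lee_fin ler1n.
rewrite Lnorm2Z// lte_add_pinfty//.
by rewrite lte_mul_pinfty// lee_fin normc_ge0.
Qed.

HB.instance Definition _ :=
  GRing.isSubmodClosed.Build _ _ cLfun2 cLfun2_submod_closed.

Record cLfunType2 := CLfun2 {
  cLfun2_fun :> T -> R[i];
  cLfun2_mem : cLfun2_fun \in cLfun2 }.

HB.instance Definition _ := [isSub for cLfun2_fun].
HB.instance Definition _ := [Choice of cLfunType2 by <:].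
HB.instance Definition _ := [SubChoice_isSubLmodule of cLfunType2 by <:].

Lemma cLfunType2P (f : cLfunType2) : square_integrable f.
Proof. exact/cLfun2P/cLfun2_mem. Qed.

Definition ae_null : {pred cLfunType2} :=
  mem [set f : cLfunType2 | \forall x \ae mu, f x = 0].

Lemma ae_nullP (f : cLfunType2) :
  reflect (\forall x \ae mu, f x = 0) (f \in ae_null).
Proof. by apply: (iffP idP); rewrite inE. Qed.

Lemma ae_null_submod_closed : submod_closed ae_null.
Proof.
split; first by apply/ae_nullP/aeW.
move=> a f g /ae_nullP f0 /ae_nullP g0; apply/ae_nullP.
move: f0 g0; apply: filterS2 => x /= f0 g0.
rewrite -[LHS]/(a * f x + g x).
by rewrite f0 g0 mulr0 addr0.
Qed.

HB.instance Definition _ :=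
  GRing.isSubmodClosed.Build _ _ ae_null ae_null_submod_closed.

Definition cL2 : Type := Quotient.quot ae_null.
HB.instance Definition _ := GRing.Zmodule.on cL2.
HB.instance Definition _ := EqQuotient.on cL2.

Definition cL2_fun (f : cL2) : T -> R[i] := repr f.

Lemma cL2_eqP (f g : cLfunType2) :
  reflect (\forall x \ae mu, f x = g x) (\pi_cL2 f == \pi_cL2 g).
Proof.
rewrite -Quotient.idealrBE; apply: (iffP (ae_nullP _)); apply: filterS => x.
  by move/eqP; rewrite subr_eq0 => /eqP.
by move=> fg; apply/eqP; rewrite subr_eq0; exact/eqP.
Qed.

Lemma cL2_reprE (f : cLfunType2) : \forall x \ae mu, repr (\pi_cL2 f) x = f x.
Proof. by apply/cL2_eqP; rewrite reprK. Qed.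

Definition cL2_scale (a : R[i]) (f : cL2) : cL2 := \pi_cL2 (a *: repr f).

Lemma cL2_pi_scale a (f : cLfunType2) :
  cL2_scale a (\pi_cL2 f) = \pi_cL2 (a *: f).
Proof.
apply/eqP/cL2_eqP; have := cL2_reprE f; apply: filterS => x fx.
by rewrite -[LHS]/(a * (repr (\pi_cL2 f)) x) -[RHS]/(a * f x) fx.
Qed.

Lemma cL2_scalerA a b (f : cL2) :
  cL2_scale a (cL2_scale b f) = cL2_scale (a * b) f.
Proof. by rewrite -[f]reprK (cL2_pi_scale b) !cL2_pi_scale scalerA. Qed.

Lemma cL2_scale1r (f : cL2) : cL2_scale 1 f = f.
Proof. by rewrite -[f]reprK cL2_pi_scale scale1r. Qed.

Lemma cL2_scalerDr : right_distributive cL2_scale +%R.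
Proof.
move=> a f g; rewrite -[f]reprK -[g]reprK.
by rewrite -[_ + _]pi_addr !cL2_pi_scale scalerDr pi_addr.
Qed.

Lemma cL2_scalerDl (f : cL2) : {morph cL2_scale^~ f : a b / a + b}.
Proof.
by move=> a b; rewrite -[f]reprK !cL2_pi_scale scalerDl pi_addr.
Qed.

HB.instance Definition _ := GRing.Zmodule_isLmodule.Build R[i] cL2
  cL2_scalerA cL2_scale1r cL2_scalerDr cL2_scalerDl.

Definition L2norm (f : cLfunType2) : R :=
  fine ('N[mu]_2%:E [EFin \o (fun x => normc (f x))])%E.

Lemma L2norm_fin (f : cLfunType2) :
  ((L2norm f)%:E = 'N[mu]_2%:E [EFin \o (fun x => normc (f x))])%E.
Proof.
have [_ _ fn] := cLfunType2P f.
by rewrite /L2norm fineK// ge0_fin_numE ?Lnorm_ge0.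
Qed.

Lemma eq_L2norm (f g : cLfunType2) :
  (\forall x \ae mu, f x = g x) -> L2norm f = L2norm g.
Proof.
move=> fg; rewrite /L2norm unlock /Lnorm; congr (fine (_ `^ _)%E).
have m2 (h : cLfunType2) : measurable_fun setT
    (fun x => (`|(EFin \o (fun x => normc (h x))) x| `^ 2)%E).
  have [hr hi _] := cLfunType2P h.
  apply: (@measurableT_comp _ _ _ _ _ _ (fun x : \bar R => (x `^ 2)%E)).
    exact: measurable_poweR.
  apply: measurableT_comp => //; apply/measurable_EFinP.
  exact: measurable_normc.
apply: ge0_ae_eq_integral => //; do ?[by move=> x _; rewrite poweR_ge0].
by apply: filterS fg => x fgx _ /=; rewrite fgx.
Qed.

Definition cL2_norm (f : cL2) : R[i] := (L2norm (repr f))%:C.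

Lemma cL2_pi_norm (f : cLfunType2) : cL2_norm (\pi_cL2 f) = (L2norm f)%:C.
Proof. by congr (_%:C); apply: eq_L2norm; exact: cL2_reprE. Qed.

Lemma cL2_ler_normD (f g : cL2) : cL2_norm (f + g) <= cL2_norm f + cL2_norm g.
Proof.
rewrite -[f]reprK -[g]reprK -[_ + _]pi_addr !cL2_pi_norm -rmorphD lecR.
move: (repr f) (repr g) => {}f {}g.
have [fr fi _] := cLfunType2P f; have [gr gi _] := cLfunType2P g.
have [sr si _] := cLfunType2P (f + g).
rewrite -lee_fin EFinD !L2norm_fin.
have mf := measurable_normc fr fi; have mg := measurable_normc gr gi.
apply: (le_trans _ (eminkowski _ mf mg _)); last by rewrite lee_fin ler1n.
apply: Lnorm2_le; [exact: measurable_normc|exact: measurable_funD|].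
by move=> x; rewrite normc_ge0 normc_triangle.
Qed.

Lemma cL2_normrZ a (f : cL2) : cL2_norm (a *: f) = `|a| * cL2_norm f.
Proof.
rewrite -[f]reprK -[_ *: _]/(cL2_scale _ _) cL2_pi_scale !cL2_pi_norm.
rewrite normCE -rmorphM; congr (_%:C); apply: EFin_inj.
by rewrite EFinM !L2norm_fin -Lnorm2Z//; exact: cLfunType2P.
Qed.

Lemma cL2_normr0_eq0 (f : cL2) : cL2_norm f = 0 -> f = 0.
Proof.
have [fr fi _] := cLfunType2P (repr f).
have mf : measurable_fun setT (EFin \o (fun x => normc (repr f x))).
  by apply/measurable_EFinP; exact: measurable_normc.
move=> n0; have {}n0 : L2norm (repr f) = 0 by case: n0.
have f0 : \forall x \ae mu, setT x -> (normc (repr f x))%:E = 0%E.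
  by apply: (Lnorm_eq0_eq0 mf (p := 2%:E)); rewrite ?lte_fin ?ltr0n -?L2norm_fin ?n0.
rewrite -[LHS]reprK -[RHS]pi_zeror; apply/eqP/cL2_eqP.
by move: f0; apply: filterS => x /(_ I) [] /eq0_normc.
Qed.

HB.instance Definition _ := Lmodule_isNormed.Build R[i] cL2
  cL2_ler_normD cL2_normrZ cL2_normr0_eq0.

End complex_L2.

Section scalar_functions.
Context {R : realType}.
Implicit Types (A : set R) (K phi : R -> R[i]).
Local Notation leb := (@lebesgue_measure R).

Definition Cintegrable A K : Prop :=
  leb.-integrable A (fun s => (complex.Re (K s))%:E) /\
  leb.-integrable A (fun s => (complex.Im (K s))%:E).

Definition Cintegral A K : R[i] :=
  (\int[leb]_(s in A) complex.Re (K s)) +i*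
  (\int[leb]_(s in A) complex.Im (K s)).

Definition is_kernel K : Prop :=
  (forall T : R, 0 <= T -> Cintegrable `[0, T] K) /\
  (forall phi, {within `[0, +oo[, continuous (phi : R -> R[i]^o)} ->
    (forall t, 0 <= t -> Cintegral `[0, t] (fun s => K (t - s) * phi s) = 0) ->
    forall t, 0 <= t -> phi t = 0).

Definition exp_bounded K : Prop :=
  exists M beta : R, 0 < M /\
    forall t, 0 <= t -> normc (K t) <= M * expR (beta * t).

Definition exp_bounded_kernel K : Prop := is_kernel K /\ exp_bounded K.

Definition Theta K (t : R) : R[i] := Cintegral `[0, t] K.

Definition sector (alpha : R) : set R[i] :=
  [set z | exists r theta : R,
    [/\ 0 < r, `|theta| < alpha & z = (r * cos theta) +i* (r * sin theta)]].

End scalar_functions.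

Section operators.
Context {R : realType} {E : normedModType R[i]}.

(* An unbounded linear operator B on E is given by its graph: B (x, y) means
   that x is in D(B) and that Bx = y. *)
Implicit Types (B : set (E * E)) (x y : E) (K : R -> R[i]).

Definition closed_operator B : Prop :=
  [/\ B (0, 0),
      forall (a : R[i]) (p q : E * E), B p -> B q -> B (a *: p + q),
      forall y, B (0, y) -> y = 0 &
      closed B].

Definition opp_operator B : set (E * E) := [set p | B (p.1, - p.2)].

Fixpoint pow_operator B (k : nat) : set (E * E) :=
  if k is k'.+1 then [set p | exists y, B (p.1, y) /\ pow_operator B k' (y, p.2)]
  else [set p | p.2 = p.1].

(* The Riemann integral of f over [a, b], a <= b, as the norm limit of the
   Riemann sums over tagged partitions a = p 0 <= ... <= p m = b. *)
Definition is_Riemann_integral (f : R -> E) (a b : R) (v : E) : Prop :=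
  forall eps : R, 0 < eps -> exists delta : R, 0 < delta /\
    forall (m : nat) (p xi : nat -> R),
      p 0%N = a -> p m = b ->
      (forall i, (i < m)%N ->
        [/\ p i <= xi i, xi i <= p i.+1 & p i.+1 - p i < delta]) ->
      `|\sum_(i < m) (p i.+1 - p i)%:C *: f (xi i) - v| <= eps%:C.

Definition strongly_continuous (S : R -> {linear E -> E}) : Prop :=
  (forall t, 0 <= t -> continuous (S t)) /\
  (forall x, {within `[0, +oo[, continuous (fun t => S t x)}).

Definition commutes_with (S : R -> {linear E -> E}) B : Prop :=
  forall t, 0 <= t -> forall x y, B (x, y) -> B (S t x, S t y).

Definition exp_bounded_family (S : R -> {linear E -> E}) : Prop :=
  exists M omega : R, 0 < M /\
    forall t, 0 <= t -> forall x,
      `|S t x| <= (M * expR (omega * t))%:C * `|x|.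

Definition generates_exp_bounded_convoluted_cosine K B : Prop :=
  closed_operator B /\
  exists C : R -> {linear E -> E},
    [/\ strongly_continuous C,
        exp_bounded_family C,
        commutes_with C B &
        forall x t, 0 <= t -> exists y,
          is_Riemann_integral (fun s => (t - s)%:C *: C s x) 0 t y /\
          B (y, C t x - Theta K t *: x)].

Definition is_convoluted_semigroup K B (S : R -> {linear E -> E}) : Prop :=
  [/\ strongly_continuous S,
      commutes_with S B &
      forall x t, 0 <= t -> exists y,
        is_Riemann_integral (fun s => S s x) 0 t y /\
        B (y, S t x - Theta K t *: x)].

(* Holomorphy for the operator norm of an L(E)-valued map on an open set D. *)
Definition analytic_on (D : set R[i]) (S : R[i] -> {linear E -> E}) : Prop :=
  forall z, D z -> continuous (S z) /\
    exists S' : {linear E -> E}, continuous S' /\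
      forall eps : R, 0 < eps -> \forall h \near (0 : R[i]^o)^',
        forall x, `|h^-1 *: (S (z + h) x - S z x) - S' x| <= eps%:C * `|x|.

Definition generates_exp_bounded_analytic_convoluted_semigroup
    K B (alpha : R) : Prop :=
  closed_operator B /\
  exists2 S : R -> {linear E -> E}, is_convoluted_semigroup K B S &
  exists SS : R[i] -> {linear E -> E},
    [/\ analytic_on (sector alpha) SS,
        forall t : R, 0 < t -> SS t%:C =1 S t,
        forall gamma : R, 0 < gamma < alpha -> forall x,
          SS z x @[z --> within (sector gamma) (nbhs (0 : R[i]^o))] --> (0 : E) &
        forall gamma : R, 0 < gamma < alpha ->
          exists M omega : R, [/\ 0 < M, 0 < omega &
            forall z, sector gamma z -> forall x,
              `|SS z x| <= (M * expR (omega * complex.Re z))%:C * `|x|]].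

End operators.

Section dirichlet_laplacian.
Variable R : realType.

(* Lebesgue measure on R concentrated on [0, pi]: a class in L2_0pi only depends
   on the values of its representatives on [0, pi]. *)
Definition lebesgue_0pi : {measure set (measurableTypeR R) -> \bar R} :=
  mrestr lebesgue_measure (measurable_itv `[0 : R, pi]).

Definition L2_0pi : Type := cL2 lebesgue_0pi.
HB.instance Definition _ := NormedModule.on L2_0pi.

Definition L2_repr (f : L2_0pi) : R -> R[i] := cL2_fun f.

(* u is absolutely continuous on [0, pi], with derivative v almost everywhere. *)
Definition is_primitive_0pi (u v : R -> R[i]) : Prop :=
  Cintegrable `[0, pi] v /\
  forall x, 0 <= x <= pi -> u x = u 0 + Cintegral `[0, x] v.

(* Domain H^2(0, pi) with u(0) = u(pi) = 0, where u is the representative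
   of f such that u and u' are absolutely continuous and u'' = g. *)
Definition dirichlet_laplacian : set (L2_0pi * L2_0pi) :=
  [set fg | exists u u' : R -> R[i],
    [/\ \forall x \ae lebesgue_0pi, L2_repr fg.1 x = u x,
        is_primitive_0pi u u',
        is_primitive_0pi u' (L2_repr fg.2),
        u 0 = 0 & u pi = 0]].

Definition neg_dirichlet_laplacian : set (L2_0pi * L2_0pi) :=
  opp_operator dirichlet_laplacian.

End dirichlet_laplacian.

Arguments dirichlet_laplacian R : clear implicits.
Arguments neg_dirichlet_laplacian R : clear implicits.

(* Main.v *)
From HB Require Import structures.
Require Import Defs.
From mathcomp Require Import all_boot all_order all_algebra complex.
From mathcomp Require Import all_classical all_reals all_analysis.
From mathcomp Require Import measurable_realfun ring lra zify.
Import Order.TTheory GRing.Theory Num.Theory numFieldNormedType.Exports.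
Import Normc.
Set Implicit Arguments.
Unset Strict Implicit.
Unset Printing Implicit Defensive.
Local Open Scope classical_set_scope.
Local Open Scope complex_scope.
Local Open Scope ring_scope.

(* The sines sin ((k + 1) x) diagonalise Delta^(2^n), with eigenvalues
   lam_k = (k + 1)^(2^(n + 1)), all of them fourth powers.  Let nu_j = ((j + 1) / 10)^4
   and F(l) = prod_k (1 - l / (k + 1)^4) / prod_j (1 + l / nu_j).  Then F(lam_k) = 0,
   and F(l) = sum_j r_j / (l + nu_j) with sum_j |r_j| (1 + nu_j)^2 finite.  The kernels
   sum_j r_j sin (sqrt nu_j t) / sqrt nu_j and sum_j r_j exp (- nu_j t), with Laplace
   transforms F(l^2) and F(l), do not depend on n.  On the k-th mode the convoluted
   families are multiplication by - sum_j r_j cos (sqrt nu_j t) / (lam_k + nu_j) and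
   - sum_j r_j exp (- nu_j z) / (lam_k + nu_j): the growing terms carry the factor
   F(lam_k) = 0.  These multipliers are O(1 / lam_k), uniformly in t, resp. in the
   right half-plane, so they define bounded operators and pass to the operator norm.
   If K * phi = 0, the bounded solution Z of Z' = l Z - K, whose initial value is the
   Laplace transform of K at l, gives |Z 0| |int_0^T exp (l (T - s)) phi(s) ds| <= C
   with C independent of l.  At half-integers l the factor |Z 0| decays more slowly than
   any exponential, so the moments of phi with respect to exp (T - s) are small enough
   to force phi = 0. *)

(** * A partial fraction series vanishing at the fourth powers *)

(** The eigenvalues lam_k are positive and unbounded: the k-th mode grows like exp (lam_k t), resp.
    exp (sqrt lam_k t), so there is neither a semigroup nor a cosine function to convolve. For a
    bound uniform in k, the Laplace transform of the kernel has to vanish at lam_k, resp. sqrt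
    lam_k, for all large k, although the kernel must stay injective for convolution. The Laplace
    transform of a nonzero exponentially bounded function cannot vanish at all large integers, so
    the zeros must be sparse: the zeros (k + 1)^2 of F(l^2) are, the zeros k + 1 that n = 0 would
    require of the cosine kernel are not. The denominator of F turns it into a sum of simple
    fractions, so that every convoluted function is an explicit series and no Laplace transform has
    to be inverted along a contour. The two demands on F compete: many poles make the residues
    small, but they also make F small at the half-integers. Fourth powers reconcile them: both
    products have order 1/4 in l, hence 1/2 in sqrt l, and away from the zeros F(w^2) decays more
    slowly than any exp (- e w). *)

Lemma partial_fractions (F : fieldType) (n : nat) (x : 'I_n -> F)
    (N : {poly F}) (l : F) :
  injective x -> (size N <= n)%N -> (forall i, l != x i) ->
  N.[l] / \prod_(i < n) (l - x i) =
  \sum_(i < n) N.[x i] / ((l - x i) * \prod_(j < n | j != i) (x i - x j)).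
Proof.
move=> xI sN lx.
pose c i := N.[x i] / \prod_(j < n | j != i) (x i - x j).
pose P := \sum_(i < n) c i *: \prod_(j < n | j != i) ('X - (x j)%:P).
have prodE (i : 'I_n) (y : F) :
    (\prod_(j < n | j != i) ('X - (x j)%:P)).[y] = \prod_(j < n | j != i) (y - x j).
  by rewrite horner_prod; apply: eq_bigr => j _; rewrite !hornerE.
(* Lagrange interpolation: both sides have degree below n and agree at the n points [x i]. *)
have NP : N = P.
  apply/eqP; rewrite -subr_eq0; apply/eqP.
  apply: (@roots_geq_poly_eq0 _ _ [seq x i | i <- enum 'I_n]).
  - apply/allP => _ /mapP[i _ ->]; rewrite rootE !hornerE horner_sum.
    rewrite subr_eq0 (bigD1 i)//= hornerZ prodE /c divfK; last first.
      rewrite prodf_seq_neq0.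
      by apply/allP => j _; apply/implyP => ji; rewrite subr_eq0 inj_eq// eq_sym.
    rewrite [X in _ + X]big1 ?addr0// => k; rewrite eq_sym => ik.
    by rewrite hornerZ prodE [X in _ * X](bigD1 i ik)/= subrr mul0r mulr0.
  - by rewrite map_inj_uniq// enum_uniq.
  - rewrite size_map size_enum_ord (leq_trans (size_polyD _ _))// geq_max sN.
    rewrite size_polyN (leq_trans (size_sum _ _ _))//; apply/bigmax_leqP => i _.
    rewrite (leq_trans (size_scale_leq _ _))// -big_filter size_prod_XsubC.
    rewrite size_filter -sum1_count sum1_card.
    rewrite (_ : #|_| = #|predC1 i|); last exact: eq_card.
    by rewrite cardC1 card_ord; case: n i {sN x xI lx c P prodE} => [[]|].
rewrite {1}NP horner_sum mulr_suml; apply: eq_bigr => i _.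
rewrite hornerZ prodE [X in _ / X](bigD1 i)//=.
rewrite /c; set A := \prod_(_ | _) _; set B := \prod_(_ | _) (l - _).
have B0 : B != 0.
  by rewrite prodf_seq_neq0; apply/allP => j _; apply/implyP => _; rewrite subr_eq0.
have A0 : A != 0.
  rewrite prodf_seq_neq0; apply/allP => j _; apply/implyP => ji.
  by rewrite subr_eq0 inj_eq// eq_sym.
by field; rewrite A0 B0 subr_eq0 lx.
Qed.

Lemma cvgn_le (R : realType) (u : R ^nat) (l c : R) :
  u @ \oo --> l -> (\forall n \near \oo, u n <= c) -> l <= c.
Proof.
move=> ul uc; rewrite -(cvg_lim _ ul)//; apply: limr_le => //; exact: cvgP ul.
Qed.

Lemma cvgn_ge (R : realType) (u : R ^nat) (l c : R) :
  u @ \oo --> l -> (\forall n \near \oo, c <= u n) -> c <= l.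
Proof.
move=> ul uc; rewrite -(cvg_lim _ ul)//; apply: limr_ge => //; exact: cvgP ul.
Qed.

Section residues.
Context {R : realType}.
Implicit Types (j k m M : nat) (l : R).

(* The poles are 10 times denser than the zeros: block by block this makes the
   residues decay fast enough to be summed against (1 + nu)^2. *)
Definition blk : nat := 10.
Definition nu j : R := (j.+1%:R / blk%:R) ^+ 4.
Definition numer m l : R := \prod_(k < m) (1 - l / k.+1%:R ^+ 4).
Definition denom M l : R := \prod_(i < M) (1 + l / nu i).
(** The value at [- nu j] of [denom M] deprived of its factor j; thus [res m j] is the residue of
    [numer m / denom (blk * m)] at [- nu j]. *)
Definition codenom M j : R :=
  \prod_(i < M) (if (i : nat) == j then 1 else 1 - nu j / nu i).
Definition res m j : R := nu j * numer m (- nu j) / codenom (blk * m) j.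

Lemma nu_gt0 j : 0 < nu j.
Proof. by rewrite exprn_gt0// divr_gt0. Qed.

Lemma nuV i j : nu j / nu i = (j.+1%:R / i.+1%:R) ^+ 4.
Proof.
rewrite /nu -expr_div_n; congr (_ ^+ 4); rewrite invf_div mulrA divfK//.
by rewrite pnatr_eq0.
Qed.

Lemma nu_inj : injective nu.
Proof.
move=> i j /eqP; rewrite /nu eqrXn2// ?divr_ge0//.
by rewrite (inj_eq (mulIf _)) ?invr_eq0 ?pnatr_eq0// eqr_nat eqSS => /eqP.
Qed.

Lemma codenom_neq0 M j : codenom M j != 0.
Proof.
rewrite prodf_seq_neq0; apply/allP => i _; apply/implyP => _.
case: (eqVneq (i : nat) j) => [_|ij]; first by rewrite oner_eq0.
rewrite subr_eq0 eq_sym -(inj_eq (mulIf (lt0r_neq0 (nu_gt0 i)))).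
by rewrite divfK ?lt0r_neq0 ?nu_gt0// mul1r (inj_eq nu_inj) eq_sym.
Qed.

Lemma finite_fractions m l : (0 < m)%N -> 0 <= l ->
  numer m l / denom (blk * m) l = \sum_(j < blk * m) res m j / (l + nu j).
Proof.
move=> m0 l0.
pose N : {poly R} := \prod_(k < m) (1 - (k.+1%:R ^- 4) *: 'X).
have NE x : N.[x] = numer m x.
  by rewrite horner_prod; apply: eq_bigr => k _; rewrite !hornerE mulrC.
have sN : (size N <= blk * m)%N.
  have: (size N <= m.+1)%N.
    rewrite /N; elim: (m) => [|q ih]; first by rewrite big_ord0 size_poly1.
    rewrite big_ord_recr/= (leq_trans (size_polyMleq _ _))//.
    set P := (X in (_ + size X)%N).
    have : (size P <= 2)%N.
      rewrite (leq_trans (size_polyD _ _))// geq_max size_poly1/= size_polyN.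
      by rewrite (leq_trans (size_scale_leq _ _))// size_polyX.
    move=> sP; rewrite -subn1 leq_subLR (leq_trans (leq_add ih sP))//.
    by rewrite addn2 add1n.
  by rewrite /blk; lia.
have xI : injective (fun i : 'I_(blk * m) => - nu i).
  by move=> i j /oppr_inj/nu_inj/val_inj.
have lnu i : 0 < l + nu i by rewrite ltr_wpDl// nu_gt0.
have lx (i : 'I_(blk * m)) : l != - nu i.
  by rewrite -subr_eq0 opprK gt_eqF.
have := partial_fractions xI sN lx.
rewrite NE => /(congr1 ( *%R (\prod_(i < blk * m) nu i))) H.
transitivity ((\prod_(i < blk * m) nu i) *
  (numer m l / \prod_(i < blk * m) (l - - nu i))).
  rewrite mulrCA; congr (_ * _); rewrite -!prodfV -big_split/=.
  apply: eq_bigr => i _; rewrite opprK.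
  by field; rewrite !gt_eqF ?nu_gt0.
rewrite H mulr_sumr; apply: eq_bigr => j _; rewrite NE /res.
rewrite (bigD1 j)//= opprK.
have -> : codenom (blk * m) j = \prod_(i < blk * m | i != j) (1 - nu j / nu i).
  rewrite /codenom (bigD1 j)//= eqxx mul1r; apply: eq_bigr => i ij.
  by rewrite (negbTE ij : (_ == _ :> nat) = _).
have -> : \prod_(i < blk * m | i != j) (1 - nu j / nu i) =
    (\prod_(i < blk * m | i != j) (- nu j - - nu i)) /
    \prod_(i < blk * m | i != j) nu i.
  rewrite -prodfV -big_split/=; apply: eq_bigr => i _.
  by field; rewrite gt_eqF ?nu_gt0.
set A := \prod_(i < _ | _) nu i; set B := \prod_(_ < _ | _) _.
have A0 : A != 0 by rewrite gt_eqF// prodr_gt0// => i _; exact: nu_gt0.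
have B0 : B != 0.
  rewrite prodf_seq_neq0; apply/allP => i _; apply/implyP => ij.
  by rewrite opprK addrC subr_eq0 (inj_eq nu_inj).
by field; rewrite A0 B0 gt_eqF.
Qed.

(** * Size and limits of the residues *)

Lemma fact_mul_le d a b :
  ((d + a)`! * (d + b)`! <= d`! * (d + a + b)`!)%N.
Proof.
elim: b => [|b ih]; first by rewrite !addn0 mulnC.
rewrite !addnS !factS mulnCA [leqRHS]mulnCA leq_mul// ltnS.
by rewrite addnAC leq_addr.
Qed.

(** Since 1 - x^4 = (1 - x^2) (1 + x^2), this is the part of [codenom] whose factors can be small or
    negative; it has a closed form in factorials. *)
Let sqprod M j : R :=
  \prod_(i < M) (if (i : nat) == j then 1 else 1 - (j.+1%:R / i.+1%:R) ^+ 2).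

(** Up to sign the factor of index i is (j - i) (i + j + 2) / (i + 1)^2, and these collect into
    factorials. *)
Let sqprod_lt M j : (M <= j)%N ->
  `|sqprod M j| * (M`!%:R ^+ 2 * (j - M)`!%:R * j.+1`!%:R) =
  j`!%:R * (j.+1 + M)`!%:R.
Proof.
elim: M => [|M ih] Mj.
  by rewrite /sqprod big_ord0 normr1 subn0 addn0 expr1n !mul1r.
rewrite /sqprod big_ord_recr/= ltn_eqF// normrM -/(sqprod M j).
have -> : `|1 - (j.+1%:R / M.+1%:R) ^+ 2 : R| =
    (j - M)%:R * (j.+1 + M.+1)%:R / M.+1%:R ^+ 2.
  rewrite distrC ger0_norm; last first.
    rewrite subr_ge0 exprn_ege1//.
    by rewrite ler_pdivlMr// mul1r ler_nat ltnS ltnW.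
  rewrite natrB 1?ltnW// natrD -!natr1; field.
  by rewrite natr1 pnatr_eq0.
have -> : (M.+1`! = M.+1 * M`!)%N by [].
have jM : ((j - M)`! = (j - M) * (j - M.+1)`!)%N.
  by rewrite (_ : (j - M = (j - M.+1).+1)%N)// -subSn.
have := ih (ltnW Mj); rewrite addnS [(j.+1 + M).+1`!]factS jM.
rewrite [((j - M) * _)%:R]natrM [((j.+1 + M).+1 * _)%:R]natrM.
rewrite [(M.+1 * _)%:R]natrM => H.
transitivity ((j.+1 + M).+1%:R * (`|sqprod M j| *
   (M`!%:R ^+ 2 * ((j - M)%:R * (j - M.+1)`!%:R) * j.+1`!%:R))).
  have M0 : M.+1%:R != 0 :> R by rewrite pnatr_eq0.
  move: (j.+1`!%:R) ((j.+1 + M).+1%:R) (M.+1%:R) M0 => c e f f0; by field.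
by rewrite H mulrCA.
Qed.

(** The same factorisation beyond the omitted index j, starting from the closed form at M = j; the 2
    comes from (2 j + 2)! = 2 (j + 1) (2 j + 1)!. *)
Let sqprod_ge d j :
  `|sqprod (j.+1 + d) j| * (2 * (j.+1 + d)`!%:R ^+ 2) =
  d`!%:R * (j.+1 + d + j.+1)`!%:R.
Proof.
have fE n : n.+1`!%:R = n.+1%:R * n`!%:R :> R by rewrite -natrM.
elim: d => [|d ih].
  rewrite !addn0 /sqprod big_ord_recr/= eqxx mulr1 -/(sqprod j j).
  have := @sqprod_lt j j (leqnn _).
  rewrite subnn addnS (fE (j.+1 + j)%N) (fE j) fact0 mul1r mulr1 => H.
  have j0 : j`!%:R != 0 :> R by rewrite pnatr_eq0 -lt0n fact_gt0.
  apply: (mulfI j0).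
  transitivity (2 * j.+1%:R * (`|sqprod j j| *
    (j`!%:R ^+ 2 * (j.+1%:R * j`!%:R)))); first by ring.
  rewrite H (_ : (j.+1 + j).+1 = (2 * j.+1)%N); last by lia.
  by rewrite [(2 * _)%:R]natrM; ring.
rewrite !addnS /sqprod big_ord_recr/= gtn_eqF; last by lia.
rewrite normrM -/(sqprod (j.+1 + d) j).
have -> : `|1 - (j.+1%:R / (j.+1 + d).+1%:R) ^+ 2 : R| =
    d.+1%:R * (j.+1 + d + j.+1).+1%:R / (j.+1 + d).+1%:R ^+ 2.
  rewrite ger0_norm; last first.
    rewrite subr_ge0 exprn_ile1 ?divr_ge0//.
    by rewrite ler_pdivrMr// mul1r ler_nat; lia.
  rewrite -!natr1 !natrD; field.
  by rewrite -natrD !natr1 pnatr_eq0.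
have nz : (j.+1 + d).+1%:R != 0 :> R by rewrite pnatr_eq0.
rewrite (_ : ((j.+1 + d).+1 + j).+1 = (j.+1 + d + j.+1).+1); last by lia.
rewrite (fE (j.+1 + d)%N) (fE d) (fE (j.+1 + d + j.+1)%N).
transitivity (d.+1%:R * (j.+1 + d + j.+1).+1%:R *
  (`|sqprod (j.+1 + d) j| * (2 * (j.+1 + d)`!%:R ^+ 2))); first by field.
by rewrite ih; ring.
Qed.

(** Log-convexity of the factorial, applied to the closed form; 1/2 is the limit as M tends to
    infinity. *)
Let sqprod_half M j : (j < M)%N -> 1 / 2 <= `|sqprod M j|.
Proof.
move=> jM; have -> : M = (j.+1 + (M - j.+1))%N by lia.
set d := (M - j.+1)%N; have := sqprod_ge d j.
have f0 : 0 < (2 * (j.+1 + d)`!%:R ^+ 2) :> R.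
  by rewrite mulr_gt0// exprn_gt0// ltr0n fact_gt0.
move=> H; rewrite -(ler_pM2r f0) H mul1r mulKf// expr2 -!natrM ler_nat.
by have := fact_mul_le d j.+1 j.+1; rewrite [(d + _)%N]addnC.
Qed.

(** One factor 2 of the 4 is lost in [sqprod_half]; the other is the factor 1 + 1 of index j,
    present in the full product but not in [codenom]. *)
Let codenom_ge M j : (j < M)%N ->
  (\prod_(i < M) (1 + (j.+1%:R / i.+1%:R) ^+ 2)) / 4 <= `|codenom M j|.
Proof.
move=> jM.
have -> : codenom M j = sqprod M j *
    \prod_(i < M) (if (i : nat) == j then 1 else 1 + (j.+1%:R / i.+1%:R) ^+ 2).
  rewrite -big_split/=; apply: eq_bigr => i _; case: ifP => _.
    by rewrite mulr1.
  by rewrite nuV; ring.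
rewrite normrM (bigD1 (Ordinal jM))//= [X in `|_| * `|X|](bigD1 (Ordinal jM))//=.
rewrite eqxx mul1r divff ?pnatr_eq0//.
have -> : \prod_(i < M | i != Ordinal jM)
    (if (i : nat) == j then 1 else 1 + (j.+1%:R / i.+1%:R) ^+ 2) =
    \prod_(i < M | i != Ordinal jM) (1 + (j.+1%:R / i.+1%:R) ^+ 2) :> R.
  apply: eq_bigr => i; rewrite -val_eqE/= => ij.
  by rewrite (negbTE ij : (_ == _ :> nat) = _).
set A := \prod_(_ < _ | _) _.
have A0 : 0 <= A by apply: prodr_ge0 => i _; rewrite addr_ge0// sqr_ge0.
rewrite [`|A|]ger0_norm// mulrAC ler_wpM2r//.
by rewrite (le_trans _ (sqprod_half jM))//; lra.
Qed.

(** The poles of the k-th block satisfy i + 1 <= blk (k + 1), so each of its [blk] factors is at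
    least the one at the end of the block, which sits at the k-th zero. *)
Let block_ge m j :
  \prod_(k < m) (1 + (j.+1%:R / blk%:R / k.+1%:R) ^+ 2) ^+ blk <=
  \prod_(i < blk * m) (1 + (j.+1%:R / i.+1%:R) ^+ 2) :> R.
Proof.
elim: m => [|m ih]; first by rewrite muln0 !big_ord0.
rewrite mulnS addnC big_split_ord/= big_ord_recr/= ler_pM//.
- by apply: prodr_ge0 => k _; rewrite exprn_ge0// addr_ge0// sqr_ge0.
- rewrite -[X in _ ^+ X]card_ord -prodr_const ler_prod// => i _.
  rewrite addr_ge0 ?sqr_ge0//= lerD2l lerXn2r ?nnegrE ?divr_ge0//.
  rewrite -mulrA ler_wpM2l// -invfM lef_pV2 ?posrE ?mulr_gt0 ?ltr0n//.
  rewrite -natrM ler_nat mulnS.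
  by have := ltn_ord i; lia.
Qed.

(** With t = (s / (k + 1))^2, a zero contributes 1 + t^2 <= (1 + t)^2 to the numerator and its block
    of poles at least (1 + t)^10 to the denominator. The first block, where t = s^2 and [nu j] =
    t^2, has eight factors to spare, and these absorb nu^2 (1 + nu)^2, of degree 8 in t. This is why
    [blk] is 10 = 2 + 8. *)
Lemma res_le m j : (j < blk * m)%N -> `|res m j| * (1 + nu j) ^+ 2 <= 4 / nu j.
Proof.
move=> jm; set s : R := j.+1%:R / blk%:R.
have s0 : 0 < s by rewrite divr_gt0.
have nE : nu j = s ^+ 4 by [].
pose x k := s / k.+1%:R.
have m0 : (0 < m)%N by case: (m) jm; rewrite ?muln0.
have fac0 k : 0 <= 1 - - nu j / k.+1%:R ^+ 4.
  by rewrite mulNr opprK addr_ge0// divr_ge0 ?exprn_ge0// ltW ?nu_gt0.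
have ratio_le : numer m (- nu j) <=
    (\prod_(k < m) (1 + x k ^+ 2) ^+ blk) / (1 + s ^+ 2) ^+ 8.
  rewrite ler_pdivlMr ?exprn_gt0 ?ltr_pwDl ?sqr_ge0//.
  rewrite /numer (bigD1 (Ordinal m0))//= [leRHS](bigD1 (Ordinal m0))//=.
  rewrite mulrAC ler_pM//.
  - apply: mulr_ge0; first exact: (fac0 0%N).
    by rewrite exprn_ge0// addr_ge0// sqr_ge0.
  - exact: prodr_ge0.
  - rewrite expr1n divr1 opprK nE /x divr1.
    rewrite /blk (_ : 10 = 2 + 8)%N// exprD ler_wpM2r ?exprn_ge0 ?addr_ge0 ?sqr_ge0//.
    have := sqr_ge0 s; set t := s ^+ 2; rewrite (_ : s ^+ 4 = t ^+ 2); last by rewrite /t; ring.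
    by nra.
  - apply: ler_prod => k _; rewrite fac0/=.
    rewrite mulNr opprK nE -expr_div_n -/(x k).
    have t0 := sqr_ge0 (x k); move: t0; set t := x k ^+ 2.
    rewrite (_ : x k ^+ 4 = t ^+ 2); last by rewrite /t; ring.
    move=> t0; apply: (@le_trans _ _ ((1 + t) ^+ 2)); first by nra.
    by rewrite ler_weXn2l// lerDl.
have num0 : 0 <= numer m (- nu j) by apply: prodr_ge0 => k _.
set P := \prod_(k < m) _ in ratio_le.
have P0 : 0 < P.
  by apply: prodr_gt0 => k _; rewrite exprn_gt0// ltr_pwDl// sqr_ge0.
have cd : P / 4 <= `|codenom (blk * m) j|.
  apply: le_trans (codenom_ge jm); rewrite ler_pM2r//.
  exact: block_ge.
rewrite /res [`|_|]normrM normfV (ger0_norm (mulr_ge0 (ltW (nu_gt0 j)) num0)).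
have c0 : 0 < `|codenom (blk * m) j| by rewrite normr_gt0 codenom_neq0.
rewrite mulrAC ler_pdivrMr//.
apply: (@le_trans _ _ (4 / nu j * (P / 4))); last first.
  by rewrite ler_wpM2l// divr_ge0// ltW// nu_gt0.
have t0 := sqr_ge0 s; have nu0 := nu_gt0 j.
apply: (@le_trans _ _ (nu j * (P / (1 + s ^+ 2) ^+ 8) * (1 + nu j) ^+ 2)).
  by rewrite ler_wpM2r ?sqr_ge0// ler_wpM2l// ltW.
have -> : 4 / nu j * (P / 4) = P / nu j by field; rewrite gt_eqF.
have -> : nu j * (P / (1 + s ^+ 2) ^+ 8) * (1 + nu j) ^+ 2 =
   P * (nu j * (1 + nu j) ^+ 2 / (1 + s ^+ 2) ^+ 8) by ring.
rewrite ler_pM2l// ler_pdivrMr ?exprn_gt0 ?ltr_pwDl//.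
rewrite [leRHS]mulrC ler_pdivlMr//.
have -> : nu j * (1 + nu j) ^+ 2 * nu j = ((s ^+ 2) ^+ 2 * (1 + (s ^+ 2) ^+ 2)) ^+ 2.
  by rewrite nE; ring.
have -> : (1 + s ^+ 2) ^+ 8 = ((1 + s ^+ 2) ^+ 4) ^+ 2 by rewrite -exprM.
have s0' := ltW s0; move: t0; set t := s ^+ 2 => t0.
rewrite lerXn2r ?nnegrE ?mulr_ge0 ?addr_ge0 ?exprn_ge0 ?addr_ge0//.
rewrite -subr_ge0 (_ : _ - _ = 1 + 4 * t + 5 * t ^+ 2 + 4 * t ^+ 3); last by ring.
by rewrite !addr_ge0 ?mulr_ge0 ?exprn_ge0.
Qed.

(** The new zero multiplies the numerator by 1 + nu_j / (m + 1)^4, and the new poles, all beyond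
    nu_j, multiply the denominator by factors in ]0, 1]: the residue keeps its sign and its modulus
    does not decrease. *)
Lemma res_step m j : (j < blk * m)%N ->
  exists2 c, 1 <= c & res m.+1 j = c * res m j.
Proof.
move=> jm.
pose e := \prod_(i < blk) (1 - nu j / nu (blk * m + i)).
have q01 (i : 'I_blk) : 0 < 1 - nu j / nu (blk * m + i) <= 1.
  rewrite subr_gt0 gerBl divr_ge0 ?andbT; [|exact: ltW (nu_gt0 _)..].
  rewrite nuV -[ltRHS](expr1n _ 4) ltrXn2r ?nnegrE ?divr_ge0//=.
  by rewrite ltr_pdivrMr// mul1r ltr_nat; lia.
have e01 : 0 < e <= 1.
  rewrite prodr_gt0/=; last by move=> i _; have /andP[] := q01 i.
  by apply: prodr_ile1 => i _; have /andP[/ltW -> ->] := q01 i.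
exists ((1 + nu j / m.+1%:R ^+ 4) / e).
  have /andP[e0 e1] := e01; rewrite ler_pdivlMr// mul1r (le_trans e1)// lerDl.
  by rewrite divr_ge0 ?exprn_ge0// ltW ?nu_gt0.
rewrite /res /numer big_ord_recr/= mulNr opprK /codenom mulnS addnC big_split_ord/=.
have -> : \prod_(i < blk)
    (if (blk * m + i)%N == j then 1 else 1 - nu j / nu (blk * m + i)) = e.
  by apply: eq_bigr => i _; rewrite gtn_eqF//; lia.
rewrite -/(numer m (- nu j)) -/(codenom (blk * m) j).
have /andP[/lt0r_neq0 e0 _] := e01.
have := codenom_neq0 (blk * m) j.
move: (codenom _ _) (numer _ _) (nu j / m.+1%:R ^+ 4) => c n' w c0.
by field; rewrite e0 c0.
Qed.

(* The shift by j.+1 ensures that nu j is among the poles of the finite fraction. *)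
Definition rlim j : R := limn (fun m => res (m + j.+1) j).

Let blk_lt m j : (j < blk * (m + j.+1))%N. Proof. by rewrite /blk; lia. Qed.

(** Multiplied by the sign of its first term, the sequence is nonnegative and nondecreasing by
    [res_step], and bounded by [res_le]. *)
Lemma res_cvg j : (fun m => res (m + j.+1) j) @ \oo --> rlim j.
Proof.
pose u m := res (m + j.+1) j; pose v m := Num.sg (u 0%N) * u m.
have vS m : exists2 c, 1 <= c & v m.+1 = c * v m.
  have [c c1 H] := res_step (blk_lt m j); exists c => //.
  by rewrite /v /u addSn H mulrCA.
have v0 m : 0 <= v m.
  elim: m => [|m ih]; first by rewrite /v -normrEsg.
  by have [c c1 ->] := vS m; rewrite mulr_ge0// (le_trans _ c1).
have uv : u = (fun m => Num.sg (u 0%N) * v m).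
  apply/funext => m; rewrite /v mulrA -expr2 sqr_sg.
  have [u0|_] := eqVneq (u 0%N) 0; last by rewrite mul1r.
  rewrite mul0r; elim: m => [//|m ih].
  by have [c _ H] := res_step (blk_lt m j); rewrite /u addSn H -/(u m) ih mulr0.
suff cv : cvgn v.
  apply/cvg_ex; exists (Num.sg (u 0%N) * limn v).
  change (u @ \oo --> Num.sg (u 0%N) * limn v); rewrite [X in X @ _]uv.
  by apply: cvgM; [exact: cvg_cst|exact: cv].
apply: nondecreasing_is_cvgn.
  apply/nondecreasing_seqP => m; have [c c1 ->] := vS m.
  by rewrite ler_peMl.
exists (4 / nu j) => _ [m _ <-].
apply: le_trans (res_le (blk_lt m j)).
apply: le_trans (ler_norm _) _; rewrite normrM.
apply: (@le_trans _ _ (1 * `|u m|)); last first.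
  rewrite mul1r ler_peMr// exprn_ege1// lerDl; exact: ltW (nu_gt0 _).
by rewrite ler_wpM2r// normr_sg lern1; case: (_ != 0).
Qed.

Lemma rlim_le j : `|rlim j| * (1 + nu j) ^+ 2 <= 4 / nu j.
Proof.
have : (fun m => `|res (m + j.+1) j| * (1 + nu j) ^+ 2) @ \oo -->
    `|rlim j| * (1 + nu j) ^+ 2.
  by apply: cvgM; [apply: cvg_norm; exact: res_cvg|exact: cvg_cst].
move/cvgn_le; apply; apply: nearW => m; exact: res_le.
Qed.

(* An upper bound of the sum of `|rlim j| * (1 + nu j) ^+ 2. *)
Definition wtail : R := 8 * blk%:R ^+ 4.

Let wtail_ge0 : 0 <= wtail. Proof. by rewrite mulr_ge0// exprn_ge0. Qed.

(** The weights are arbitrary, so that the same tail bound serves the limits [rlim] and, uniformly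
    in m, the finite residues [res m]. *)
Lemma wsum_le J n (u h : nat -> R) H :
  (forall j, (J <= j < n)%N -> `|u j| * (1 + nu j) ^+ 2 <= 4 / nu j) ->
  (forall j, `|h j| <= H * (1 + nu j) ^+ 2) ->
  `|\sum_(J <= j < n) u j * h j| <= H * (wtail / J.+1%:R).
Proof.
move=> uH hH.
have H0 : 0 <= H.
  have := le_trans (normr_ge0 _) (hH 0%N).
  by rewrite pmulr_lge0// exprn_gt0// ltr_pwDl// ltW// nu_gt0.
(* For a = j + 1, a^-4 <= 2 / (a (a + 1)) bounds 4 / nu_j by a telescoping difference; hence the
   constant 8 * blk^4 of [wtail]. *)
have step j : (J <= j < n)%N ->
    `|u j * h j| <= H * (wtail / j.+1%:R - wtail / j.+2%:R).
  move=> /uH uHj; rewrite normrM.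
  apply: (@le_trans _ _ (`|u j| * (H * (1 + nu j) ^+ 2))); first exact: ler_wpM2l.
  rewrite mulrCA ler_wpM2l// (le_trans uHj)//.
  rewrite /nu expr_div_n invf_div /wtail.
  have : 0 <= blk%:R ^+ 4 :> R by rewrite exprn_ge0.
  move: (blk%:R ^+ 4) => b b0.
  have -> : 8 * b / j.+1%:R - 8 * b / j.+2%:R = 4 * (b * (2 / (j.+1%:R * j.+2%:R))) :> R.
    have : 0 < j.+1%:R :> R by rewrite ltr0n.
    rewrite -[j.+2%:R]natr1; move: (j.+1%:R) => a a0.
    by field; rewrite !gt_eqF// addr_gt0.
  rewrite ler_wpM2l// ler_wpM2l// ler_pdivlMr ?mulr_gt0//.
  rewrite mulrC ler_pdivrMr ?exprn_gt0//.
  have : 1 <= j.+1%:R :> R by rewrite ler1n.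
  rewrite -[j.+2%:R]natr1; set a := j.+1%:R => a1.
  have a0 : 0 <= a by lra.
  rewrite [a ^+ 4]exprS mulrCA ler_wpM2l// (@le_trans _ _ (2 * a))//; first by lra.
  by rewrite ler_wpM2l// -[leLHS]expr1 ler_weXn2l.
have [nJ|Jn] := leqP n J.
  by rewrite big_geq// normr0 mulr_ge0// divr_ge0.
apply: (le_trans (ler_norm_sum _ _ _)).
apply: (@le_trans _ _ (\sum_(J <= j < n) H * (wtail / j.+1%:R - wtail / j.+2%:R))).
  by rewrite !big_nat; apply: ler_sum.
rewrite -mulr_sumr ler_wpM2l//.
under eq_bigr do rewrite -opprB.
rewrite sumrN (telescope_sumr (fun j => wtail / j.+1%:R)); last exact: ltnW.
by rewrite opprB gerBl divr_ge0.
Qed.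

(** The weight leaves room for two derivatives in time: two derivatives of exp (- nu_j t) cost
    nu_j^2. *)
Definition dominated (h : nat -> R) (H : R) := forall j, `|h j| <= H * (1 + nu j) ^+ 2.

(* A junk value when the series diverges; it converges for dominated h. *)
Definition Lser (h : nat -> R) : R := limn (series (fun j => rlim j * h j)).

Lemma Lser_cvg h H : dominated h H ->
  series (fun j => rlim j * h j) @ \oo --> Lser h.
Proof.
move=> hH; suff : cvgn (series (fun j => rlim j * h j)) by [].
apply: normed_cvg; apply: nondecreasing_is_cvgn.
  by apply: nondecreasing_series => n _ _ /=.
exists (H * wtail) => _ [n _ <-] /=.
have := @wsum_le 0 n (fun j => `|rlim j|) (fun j => `|h j|) H.
rewrite divr1 => /(_ _ _)/(le_trans (ler_norm _)) => le; rewrite /series/=.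
apply: le_trans (le _ _) => [|j _|j]; last by rewrite normr_id.
  by under eq_bigr do rewrite normrM.
by rewrite normr_id rlim_le.
Qed.

Lemma Lser_tail h H J : dominated h H ->
  `|Lser h - \sum_(0 <= j < J) rlim j * h j| <= H * (wtail / J.+1%:R).
Proof.
move=> hH; have c := Lser_cvg hH.
have : (fun n => `|series (fun j => rlim j * h j) n -
     \sum_(0 <= j < J) rlim j * h j|) @ \oo -->
     `|Lser h - \sum_(0 <= j < J) rlim j * h j|.
  by apply: cvg_norm; apply: cvgB; [exact: c|exact: cvg_cst].
move/cvgn_le; apply; near=> n.
have Jn : (J <= n)%N by near: n; exists J.
rewrite seriesEnat/= (big_cat_nat _ (n := J))//= addrAC subrr add0r.
by apply: wsum_le => // j _; exact: rlim_le.
Unshelve. all: by end_near. Qed.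

Lemma Lser_le h H : dominated h H -> `|Lser h| <= H * wtail.
Proof.
move=> hH; have := Lser_tail 0 hH.
by rewrite big_geq// subr0 divr1.
Qed.

Lemma eq_Lser h g : h =1 g -> Lser h = Lser g.
Proof. by move=> /funext ->. Qed.

Lemma LserD h g H G : dominated h H -> dominated g G ->
  Lser (fun j => h j + g j) = Lser h + Lser g.
Proof.
move=> /Lser_cvg ch /Lser_cvg cg; apply/cvg_lim => //.
rewrite (_ : series _ = series (fun j => rlim j * h j) +
  series (fun j => rlim j * g j)); first exact: cvgD.
by rewrite -seriesD; congr series; apply/funext => j /=; rewrite mulrDr.
Qed.

Lemma LserZ h H c : dominated h H -> Lser (fun j => c * h j) = c * Lser h.
Proof.
move=> /Lser_cvg ch; apply/cvg_lim => //.
rewrite (_ : series _ = c *: series (fun j => rlim j * h j)).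
  by apply: cvgZr; exact: ch.
by rewrite -seriesZ; congr series; apply/funext => j /=; rewrite mulrCA.
Qed.

(** Tannery's theorem: finitely many terms converge by [res_cvg], and the tails are small uniformly
    in m by [res_le]. *)
Lemma finite_residues_cvg h H : dominated h H ->
  (fun m => \sum_(0 <= j < blk * m) res m j * h j) @ \oo --> Lser h.
Proof.
move=> hH; have H0 : 0 <= H.
  have := le_trans (normr_ge0 _) (hH 0%N).
  by rewrite pmulr_lge0// exprn_gt0// ltr_pwDl// ltW// nu_gt0.
apply/cvgrPdist_le => e e0.
have [J HJ] : exists J, H * (wtail / J.+1%:R) <= e / 3.
  pose x := H * wtail * 3 / e.
  have x0 : 0 <= x by rewrite divr_ge0 ?(ltW e0)// !mulr_ge0.
  exists (Num.bound x); have := archi_boundP x0.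
  rewrite /x ltr_pdivrMr// => xb.
  rewrite mulrA ler_pdivrMr// mulrAC ler_pdivlMr// [leRHS]mulrC.
  by rewrite (le_trans (ltW xb))// ler_wpM2r ?ler_nat// ltW.
have fin : (fun m => \sum_(0 <= j < J) res m j * h j) @ \oo -->
    \sum_(0 <= j < J) rlim j * h j.
  elim: {HJ} J => [|j ih].
    by under eq_fun do rewrite big_geq//; rewrite big_geq//; exact: cvg_cst.
  under eq_fun do rewrite big_nat_recr//=; rewrite big_nat_recr//=.
  apply: cvgD; first exact: ih.
  apply: cvgM; last exact: cvg_cst.
  by rewrite -(cvg_shiftn j.+1); exact: res_cvg.
have /cvgrPdist_le/(_ (e / 3)) := fin; rewrite divr_gt0// => /(_ isT) near_e.
near=> m.
have Jm : (J <= blk * m)%N.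
  have : (J <= m)%N by near: m; exists J.
  by move=> /leq_trans; apply; rewrite /blk; lia.
rewrite (big_cat_nat _ (n := J))//=.
set A := \sum_(0 <= _ < _) _; set B := \sum_(J <= _ < _) _.
pose C := \sum_(0 <= j < J) rlim j * h j.
have hB : `|B| <= e / 3.
  apply: le_trans HJ; apply: wsum_le => // j /andP[_ jm]; exact: res_le.
have hA : `|C - A| <= e / 3 by rewrite /C /A; near: m; exact: near_e.
have hL := le_trans (Lser_tail J hH) HJ.
rewrite (_ : _ - _ = (Lser h - C) + (C - A) - B); last by ring.
rewrite (le_trans (ler_normB _ _))// (_ : e = e / 3 + e / 3 + e / 3); last by field.
by rewrite lerD// (le_trans (ler_normD _ _))// lerD.
Unshelve. all: by end_near. Qed.

(** * Zeros and lower bounds of F *)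

Definition Fres (l : R) : R := Lser (fun j => (l + nu j)^-1).

Lemma dominated_fres l : 0 < l -> dominated (fun j => (l + nu j)^-1) l^-1.
Proof.
move=> l0 j; have n0 := nu_gt0 j.
rewrite gtr0_norm ?invr_gt0 ?addr_gt0//.
apply: (@le_trans _ _ l^-1); first by rewrite lef_pV2 ?posrE ?addr_gt0// lerDl ltW.
by rewrite ler_peMr ?invr_ge0 ?(ltW l0)// exprn_ege1// lerDl ltW.
Qed.

Lemma Fres_cvg l : 0 < l ->
  (fun m => numer m l / denom (blk * m) l) @ \oo --> Fres l.
Proof.
move=> l0; have := finite_residues_cvg (dominated_fres l0).
apply: cvg_trans; apply: near_eq_cvg; near=> m.
have m0 : (0 < m)%N by near: m; exists 1%N.
by rewrite finite_fractions ?(ltW l0)// big_mkord.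
Unshelve. all: by end_near. Qed.

(** The finite fractions already vanish at this point as soon as m > k. *)
Lemma Fres_root k : Fres (k.+1%:R ^+ 4) = 0.
Proof.
have l0 : 0 < k.+1%:R ^+ 4 :> R by rewrite exprn_gt0.
have := Fres_cvg l0; set u := (X in X @ _ --> _) => uF.
suff u0 : u @ \oo --> (0 : R) by exact: (cvg_unique _ uF u0).
apply: cvg_near_cst; near=> m; have km : (k < m)%N by near: m; exists k.+1.
by rewrite /u /numer (bigD1 (Ordinal km))//= divff ?gt_eqF// subrr !mul0r.
Unshelve. all: by end_near. Qed.

(** Weierstrass' product inequality. *)
Let prod_ge_sub (x : nat -> R) L m : (forall k, (L <= k)%N -> 0 <= x k <= 1) ->
  1 - \sum_(L <= k < m) x k <= \prod_(L <= k < m) (1 - x k).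
Proof.
move=> x01; have [mL|Lm] := leqP m L; first by rewrite !big_geq// subr0.
rewrite -(subnK (ltnW Lm)) addnC; elim: (m - L)%N => [|d ih].
  by rewrite addn0 !big_geq// subr0.
rewrite addnS !big_nat_recr ?leq_addr//=.
have /andP[x0 x1] := x01 _ (leq_addr d L).
have P1 : \prod_(L <= i < L + d) (1 - x i) <= 1.
  rewrite big_nat; apply: prodr_ile1 => i /andP[Li _].
  by have := x01 _ Li; lra.
nra.
Qed.

(** Comparison with the telescoping series of L^-2 (1 / k - 1 / (k + 1)). *)
Let sum_quartic L m : (0 < L)%N ->
  \sum_(L <= k < m) k.+1%:R ^- 4 <= L%:R ^- 3 :> R.
Proof.
move=> L0; have [mL|Lm] := leqP m L; first by rewrite big_geq// invr_ge0 exprn_ge0.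
have L0' : 0 < L%:R :> R by rewrite ltr0n.
apply: (@le_trans _ _ (\sum_(L <= k < m) L%:R ^- 2 * (k%:R^-1 - k.+1%:R^-1))).
  rewrite !big_nat; apply: ler_sum => k /andP[Lk _].
  have k0 : 0 < k%:R :> R by rewrite ltr0n (leq_trans L0).
  have Lk' : L%:R <= k%:R :> R by rewrite ler_nat.
  rewrite -natr1; move: k%:R L%:R k0 Lk' L0' => a b a0 ba b0.
  have -> : a^-1 - (a + 1)^-1 = (a * (a + 1))^-1.
    by field; rewrite !gt_eqF// addr_gt0.
  rewrite -invfM lef_pV2 ?posrE ?mulr_gt0 ?exprn_gt0 ?addr_gt0//.
  rewrite (exprD _ 2 2) ler_pM ?mulr_ge0 ?exprn_ge0 ?addr_ge0 ?(ltW b0) ?(ltW a0)//.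
    by rewrite lerXn2r ?nnegrE ?addr_ge0 ?(ltW b0) ?(ltW a0)// (le_trans ba)// lerDl.
  by rewrite expr2 ler_wpM2r ?addr_ge0 ?(ltW a0)// lerDl.
rewrite -mulr_sumr; under eq_bigr do rewrite -opprB.
rewrite sumrN (telescope_sumr (fun j => j%:R^-1)); last exact: ltnW.
by rewrite opprB (_ : L%:R ^- 3 = L%:R ^- 2 * L%:R^-1) ?ler_wpM2l ?invr_ge0 ?exprn_ge0//
  ?gerBl ?invr_ge0// -invfM -exprSr.
Qed.

Let tail_half (x : R) L m : (0 < L)%N -> 0 <= x -> 2 * x <= L%:R ^+ 3 ->
  1 / 2 <= \prod_(L <= k < m) (1 - x / k.+1%:R ^+ 4) /\
  (forall k, (L <= k)%N -> 0 <= x / k.+1%:R ^+ 4 <= 1).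
Proof.
move=> L0 x0 xL.
have L0' : 0 < L%:R :> R by rewrite ltr0n.
have x01 k : (L <= k)%N -> 0 <= x / k.+1%:R ^+ 4 <= 1.
  move=> Lk; rewrite divr_ge0 ?exprn_ge0//= ler_pdivrMr ?exprn_gt0// mul1r.
  apply: (@le_trans _ _ (L%:R ^+ 3)); first by rewrite (le_trans _ xL)// ler_peMl// ler1n.
  apply: (@le_trans _ _ (k.+1%:R ^+ 3)); last by rewrite ler_weXn2l// ler1n.
  by rewrite lerXn2r ?nnegrE// ler_nat ltnW.
split => //; apply: le_trans (prod_ge_sub _ x01).
rewrite -mulr_sumr.
have : x * \sum_(L <= i < m) i.+1%:R ^- 4 <= x * L%:R ^- 3.
  by rewrite ler_wpM2l// sum_quartic.
have : x * L%:R ^- 3 <= 1 / 2.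
  by rewrite ler_pdivrMr ?exprn_gt0//; lra.
lra.
Qed.

(** L^3 is so large that the factors of index at least L contribute at least 1/2 to the numerator
    and at most 2 to the denominator. Each of the first L factors is at least 1 / (2 L^4) in the
    numerator and at most L^3 in the denominator; altogether 4 (2 L^7)^L <= 4 (L^8)^L. *)
Lemma Fres_ge l L : 1 <= l -> (forall k, 1 / 2 <= `|l - k.+1%:R ^+ 4|) ->
  (1 < L)%N -> 2 * (blk%:R ^+ 4 * l) <= L%:R ^+ 3 ->
  (4 * (L%:R ^+ 8) ^+ L)^-1 <= `|Fres l|.
Proof.
move=> l1 lk L1 lL.
have l0 : 0 < l by lra.
have L0 : (0 < L)%N by exact: ltnW.
have L2' : 2 <= L%:R :> R by rewrite ler_nat.
have b1 : 1 <= blk%:R ^+ 4 :> R by rewrite exprn_ege1// ler1n.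
(* As l / nu_i = x / (i + 1)^4, the denominator has the shape of the numerator, with x for l and
   plus signs. *)
set x := blk%:R ^+ 4 * l in lL.
have lx : l <= x by rewrite ler_peMl// ltW.
have : (fun m => `|numer m l / denom (blk * m) l|) @ \oo --> `|Fres l|.
  by apply: cvg_norm; exact: Fres_cvg.
move/cvgn_ge; apply; near=> m.
have Lm : (L <= m)%N by near: m; exists L.
have Lbm : (L <= blk * m)%N by rewrite (leq_trans Lm)// /blk; lia.
have numge : (2 * (2 * L%:R ^+ 4) ^+ L)^-1 <= `|numer m l|.
  rewrite /numer -(big_mkord xpredT (fun k => 1 - l / k.+1%:R ^+ 4)).
  rewrite (big_cat_nat _ (n := L))//= normrM invfM mulrC ler_pM//.
  - rewrite big_mkord normr_prod -exprVn -[X in _ ^+ X]card_ord -prodr_const.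
    apply: ler_prod => k _; rewrite invr_ge0 mulr_ge0 ?exprn_ge0//=.
    have k0 : 0 < k.+1%:R ^+ 4 :> R by rewrite exprn_gt0.
    have -> : 1 - l / k.+1%:R ^+ 4 = (k.+1%:R ^+ 4 - l) / k.+1%:R ^+ 4.
      by rewrite mulrBl divff// gt_eqF.
    rewrite normrM normfV (gtr0_norm k0) distrC.
    rewrite invfM ler_pM ?invr_ge0 ?exprn_ge0//; first by have := lk k; lra.
    rewrite lef_pV2 ?posrE ?exprn_gt0 ?ltr0n// lerXn2r ?nnegrE//.
    by rewrite ler_nat ltn_ord.
  - have [|h _] := @tail_half l L m L0 (ltW l0); first by lra.
    by rewrite ger0_norm; lra.
have denle : `|denom (blk * m) l| <= 2 * (L%:R ^+ 3) ^+ L.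
  have -> : denom (blk * m) l = \prod_(0 <= k < blk * m) (1 + x / k.+1%:R ^+ 4).
    rewrite big_mkord; apply: eq_bigr => i _; rewrite /nu expr_div_n invf_div.
    by rewrite /x mulrA [l * _]mulrC.
  have x0 : 0 < x by lra.
  have fge k : 0 <= x / k.+1%:R ^+ 4 by rewrite divr_ge0 ?exprn_ge0 ?(ltW x0).
  rewrite (big_cat_nat _ (n := L))//= ger0_norm; last first.
    by rewrite mulr_ge0//; apply: prodr_ge0 => k _; rewrite addr_ge0.
  rewrite mulrC ler_pM//.
  - by apply: prodr_ge0 => k _; rewrite addr_ge0.
  - by apply: prodr_ge0 => k _; rewrite addr_ge0.
  - have [h x01] := @tail_half x L (blk * m) L0 (ltW x0) lL.
    (* From (1 + y) (1 - y) <= 1, the lower bound 1/2 for the product of the 1 - y gives the upper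
       bound 2 for the product of the 1 + y. *)
    have le1 : (\prod_(L <= k < blk * m) (1 + x / k.+1%:R ^+ 4)) *
       (\prod_(L <= k < blk * m) (1 - x / k.+1%:R ^+ 4)) <= 1.
      rewrite -big_split/= big_nat; apply: prodr_ile1 => k /andP[Lk _].
      have := x01 _ Lk; move: (x / _) => y /andP[y0 y1].
      by apply/andP; split; nra.
    have : 0 <= \prod_(L <= k < blk * m) (1 + x / k.+1%:R ^+ 4).
      by apply: prodr_ge0 => k _; rewrite addr_ge0.
    nra.
  - rewrite big_mkord -[X in _ <= _ ^+ X]card_ord -prodr_const.
    apply: ler_prod => k _; rewrite addr_ge0//=.
    apply: (@le_trans _ _ (1 + x)); last by lra.
    rewrite lerD2l ler_pdivrMr ?exprn_gt0// ler_peMr ?(ltW x0)//.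
    by rewrite exprn_ege1// ler1n.
rewrite normrM normfV.
have d0 : 0 < `|denom (blk * m) l|.
  by rewrite gtr0_norm; apply: prodr_gt0 => i _; rewrite addr_gt0// divr_gt0// nu_gt0.
rewrite ler_pdivlMr//.
apply: le_trans numge.
have X0 : 0 < L%:R ^+ 3 :> R by rewrite exprn_gt0// ltr0n.
apply: (@le_trans _ _ ((4 * (L%:R ^+ 8) ^+ L)^-1 * (2 * (L%:R ^+ 3) ^+ L))).
  by rewrite ler_wpM2l// invr_ge0 mulr_ge0// !exprn_ge0.
have Lp : 0 < L%:R :> R by rewrite ltr0n.
rewrite mulrC ler_pdivrMr ?mulr_gt0 ?exprn_gt0//.
rewrite [leRHS]mulrC ler_pdivlMr ?mulr_gt0 ?exprn_gt0 ?mulr_gt0 ?exprn_gt0//.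
have -> : 2 * (L%:R ^+ 3) ^+ L * (2 * (2 * L%:R ^+ 4) ^+ L) =
   4 * (2 * L%:R ^+ 7) ^+ L :> R.
  rewrite (_ : 2 * L%:R ^+ 7 = (L%:R ^+ 3) * (2 * L%:R ^+ 4)); last by ring.
  by rewrite [in RHS]exprMn; ring.
rewrite ler_wpM2l// lerXn2r ?nnegrE ?mulr_ge0 ?exprn_ge0//.
by rewrite [_ ^+ 8]exprS ler_wpM2r ?exprn_ge0.
Unshelve. all: by end_near. Qed.

(* Fres_ge with L = 30 d^4, where d is the least integer with w <= d^6; then
   L^3 >= 2 * 10^4 * w^2 and L ln L = O(d^5) = o(w). *)
Lemma Fres_lower_bound e : 0 < e -> exists2 c, 0 < c &
  forall w, 1 <= w -> (forall k, 1 / 2 <= `|w ^+ 2 - k.+1%:R ^+ 4|) ->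
  c * expR (- (e * w)) <= `|Fres (w ^+ 2)|.
Proof.
(* a d^5 bounds 8 L ln L for L = 30 d^4, because ln L <= (ln 30 + 4) d; beyond D, a d^5 <= (e / 64)
   d^6. *)
move=> e0; pose a : R := 8 * 30 * (ln 30 + 4); pose D := 64 * a / e.
have ln30 : 0 < ln 30 :> R by rewrite ln_gt0// ltr1n.
have a0 : 0 < a by rewrite !mulr_gt0// addr_gt0.
have D0 : 0 < D by rewrite divr_gt0// mulr_gt0.
exists (4^-1 * expR (- (a * D ^+ 5))); first by rewrite mulr_gt0 ?expR_gt0.
move=> w w1 wk.
have w0 : 0 <= w by lra.
have exd : exists d, w <= d%:R ^+ 6.
  exists (Num.bound w); apply: le_trans (ltW (archi_boundP w0)) _.
  case: (Num.bound w) => [|q]; first by rewrite expr0n.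
  by rewrite -[leLHS]expr1 ler_weXn2l// ler1n.
case: (ex_minnP exd) => d wd dmin.
have d0 : (0 < d)%N by case: d wd {dmin} => [|//]; rewrite expr0n/=; lra.
(* Minimality gives (d - 1)^6 <= w, and d <= 2 (d - 1) unless d = 1. *)
have d64 : d%:R ^+ 6 <= 64 * w.
  case: d wd d0 dmin => [//|[|d]] wd _ dmin; first by rewrite expr1n; lra.
  have : d.+1%:R ^+ 6 <= w by rewrite leNgt; apply/negP => /ltW/dmin; rewrite ltnn.
  move=> dw; apply: (@le_trans _ _ (64 * d.+1%:R ^+ 6)); last by rewrite ler_wpM2l.
  rewrite (_ : 64 = 2 ^+ 6); last by ring.
  rewrite -exprMn lerXn2r ?nnegrE//.
  by rewrite -natrM ler_nat; lia.
pose L := (30 * d ^ 4)%N.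
have L1 : (1 < L)%N by rewrite (@leq_trans (30 * 1)%N)// leq_mul2l expn_gt0 d0.
have Lw : 2 * (blk%:R ^+ 4 * w ^+ 2) <= L%:R ^+ 3.
  rewrite /L natrM natrX (_ : (30%:R * d%:R ^+ 4) ^+ 3 = 27 * 10 ^+ 3 * (d%:R ^+ 6) ^+ 2);
    last by rewrite exprMn -!exprM; congr (_ * _); ring.
  have H : w ^+ 2 <= (d%:R ^+ 6) ^+ 2 by rewrite lerXn2r ?nnegrE ?exprn_ge0//; lra.
  rewrite mulrA; apply: ler_pM => //; rewrite ?mulr_ge0 ?exprn_ge0 ?sqr_ge0//.
  rewrite /blk (_ : 10%:R ^+ 4 = 10 * 10 ^+ 3); last by rewrite -exprS.
  by rewrite mulrA ler_wpM2r ?exprn_ge0//; lra.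
have w21 : 1 <= w ^+ 2 by rewrite exprn_ege1.
apply: le_trans (Fres_ge w21 wk L1 Lw).
rewrite invfM -mulrA ler_wpM2l//.
have Lp : 0 < L%:R :> R by rewrite ltr0n ltnW.
rewrite -exprM -[leRHS]lnK ?posrE ?invr_gt0 ?exprn_gt0// -expRD ler_expR.
rewrite lnV ?posrE ?exprn_gt0// lnXn// -[_ *+ (8 * L)]mulr_natl.
rewrite -opprD lerN2.
have dR : 1 <= d%:R :> R by rewrite ler1n.
have lnd : ln d%:R <= d%:R :> R.
  by rewrite ltW// ln_sublinear// ltr0n.
have lnL : ln L%:R <= (ln 30 + 4) * d%:R :> R.
  rewrite /L natrM natrX lnM ?posrE ?exprn_gt0 ?ltr0n// lnXn ?ltr0n//.
  rewrite mulrDl -[_ *+ 4]mulr_natl lerD ?ler_wpM2l//.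
  by rewrite ler_peMr// ltW.
have main : (8 * L)%:R * ln L%:R <= a * d%:R ^+ 5.
  rewrite (_ : a * d%:R ^+ 5 = (8 * L)%:R * ((ln 30 + 4) * d%:R)); last first.
    rewrite natrM {1}/L natrM natrX /a.
    by move: (ln 30 + 4) => b; ring.
  by rewrite ler_wpM2l.
apply: le_trans main _.
(* For large d the exponent a d^5 is absorbed by e w; for small d it is at most a D^5, which the
   constant c contains. *)
have [Dd|dD] := leP D d%:R.
  apply: (@le_trans _ _ (e * w)); last first.
    by rewrite lerDr mulr_ge0 ?exprn_ge0 ?ltW.
  have : a * d%:R ^+ 5 <= e / 64 * d%:R ^+ 6.
    rewrite [_ ^+ 6]exprS mulrA ler_wpM2r ?exprn_ge0//.
    by move: Dd; rewrite /D ler_pdivrMr// => h; rewrite mulrAC ler_pdivlMr// mulrC [e * _]mulrC.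
  have : e / 64 * d%:R ^+ 6 <= e / 64 * (64 * w).
    by rewrite ler_wpM2l// divr_ge0// ltW.
  lra.
apply: (@le_trans _ _ (a * D ^+ 5)).
  by rewrite ler_wpM2l ?(ltW a0)// lerXn2r ?nnegrE// ltW.
by rewrite lerDl mulr_ge0 ?ltW//; lra.
Qed.

End residues.

(** * Integrals and moments *)

Section integration.
Context {R : realType}.
Local Notation mu := (@lebesgue_measure R).
Implicit Types (D : set R) (f g psi y : R -> R).

Lemma Rintegral_dominated D (f_ : nat -> R -> R) f g : measurable D ->
  (forall n, measurable_fun D (f_ n)) -> measurable_fun D f ->
  {ae mu, forall x, D x -> f_ ^~ x @ \oo --> f x} ->
  mu.-integrable D (EFin \o g) ->
  (forall n x, D x -> `|f_ n x| <= g x) ->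
  (fun n => \int[mu]_(x in D) f_ n x) @ \oo --> \int[mu]_(x in D) f x.
Proof.
move=> mD mf_ mf f_f ig f_g.
have [ |||||fi _] := @dominated_convergence _ _ R mu D mD
  (fun n => EFin \o f_ n) (EFin \o f) (EFin \o g).
- by move=> n; apply/measurable_EFinP; exact: mf_.
- exact/measurable_EFinP.
- move: f_f; apply: filterS; first exact: (ae_filter_ringOfSetsType mu).
  by move=> x h /h; apply: cvg_EFin; exact: nearW.
- exact: ig.
- by apply/aeW => x n Dx; rewrite lee_fin f_g.
move=> h; apply: fine_cvg; rewrite fineK; first exact: h.
exact: integrable_fin_num.
Qed.

Lemma integrableMbounded D psi f (M : R) : measurable D ->
  mu.-integrable D (EFin \o psi) -> measurable_fun D f ->
  (forall x, D x -> `|f x| <= M) ->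
  mu.-integrable D (EFin \o (fun x => f x * psi x)).
Proof.
move=> mD ipsi mf fM.
apply: (@le_integrable _ _ _ mu D mD _ (EFin \o (fun x => M * psi x))).
- apply/measurable_EFinP; apply: measurable_funM => //.
  by have /measurable_int/measurable_EFinP := ipsi.
- move=> x Dx /=; rewrite lee_fin !normrM ler_wpM2r// (le_trans (fM _ Dx))//.
  exact: ler_norm.
- exact: (@integrableZl _ _ R mu D mD M _ ipsi).
Qed.

Lemma Rintegral_sum D (h : nat -> R -> R) N : measurable D ->
  (forall k, mu.-integrable D (EFin \o h k)) ->
  mu.-integrable D (EFin \o (fun x => \sum_(0 <= k < N) h k x)) /\
  \int[mu]_(x in D) (\sum_(0 <= k < N) h k x) =
  \sum_(0 <= k < N) \int[mu]_(x in D) h k x.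
Proof.
move=> mD hi; elim: N => [|N [ihi ih]].
  rewrite big_geq//; split.
    apply: eq_integrable (integrable0 mu D) => // x _ /=.
    by rewrite big_geq.
  under eq_Rintegral do rewrite big_geq//.
  by rewrite Rintegral_cst// mul0r.
split.
  apply: (@eq_integrable _ _ R mu D mD
    (EFin \o (fun x => \sum_(0 <= k < N) h k x) \+ (EFin \o h N))).
    by move=> x _ /=; rewrite big_nat_recr//= EFinD.
  exact: integrableD.
under eq_Rintegral do rewrite big_nat_recr//=.
by rewrite RintegralD// ih big_nat_recr.
Qed.

Lemma bounded_integrable_itv (a b M : R) f : measurable_fun `[a, b] f ->
  (forall x, a <= x <= b -> `|f x| <= M) -> mu.-integrable `[a, b] (EFin \o f).
Proof.
move=> mf fM; apply: measurable_bounded_integrable => //.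
- by rewrite /= lebesgue_measure_itv/=; case: ifP; rewrite ltry.
- exists M; split; first exact: num_real.
  by move=> x Mx t; rewrite /= in_itv/= => /fM/le_trans; apply; exact: ltW.
Qed.

Let exp_partial (v : R) N : 1 - series (exp_coeff (- v)) N.+1 =
  \sum_(0 <= k < N) (-1) ^+ k / k.+1`!%:R * v ^+ k.+1.
Proof.
rewrite /series/= big_nat_recl// /exp_coeff/= expr0 fact0 divr1 opprD addrA subrr add0r.
rewrite -sumrN; apply: eq_bigr => k _.
by rewrite [(- v) ^+ _]exprNn exprS mulN1r !mulNr opprK mulrAC.
Qed.

(* Mikusinski's argument: 1 - exp (- (y / y x0) ^ n) tends to the indicator of
   [0, x0[, and the exponential series expresses its integral against psi through
   the moments of psi. *)
Lemma moment_vanish (T x0 d C : R) y psi : 0 < x0 < T ->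
  (forall a b, 0 <= a -> a < b -> b <= T -> y b < y a) ->
  (forall x, 0 <= x <= T -> 0 <= y x) ->
  measurable_fun `[0, T] y ->
  mu.-integrable `[0, T] (EFin \o psi) ->
  0 <= d < y x0 ->
  (forall n, `|\int[mu]_(x in `[0, T]) (y x ^+ n.+1 * psi x)| <= C * d ^+ n.+1) ->
  \int[mu]_(x in `[0, x0]) psi x = 0.
Proof.
move=> /andP[x00 x0T] ydec y0 my ipsi /andP[d0 dc] ym.
set c := y x0 in dc; have c0 : 0 < c by exact: le_lt_trans dc.
have mD : measurable `[0, T] by exact: measurable_itv.
have C0 : 0 <= C * d by have := ym 0%N; rewrite !expr1; exact: le_trans.
have yle x : 0 <= x <= T -> 0 <= y x <= y 0.
  move=> /andP[x0' xT]; rewrite y0 ?x0'//=.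
  have [->//|xn0] := eqVneq x 0.
  by rewrite ltW// ydec// lt_neqAle eq_sym xn0.
have mpsi : measurable_fun `[0, T] psi.
  by have /measurable_int/measurable_EFinP := ipsi.
have mpow n : measurable_fun `[0, T] (fun x => (y x / c) ^+ n).
  by apply: measurable_funX; apply: measurable_funM => //; exact: measurable_cst.
have mconst k : measurable_fun `[0, T] (cst k : R -> R) by exact: measurable_cst.
pose q := d / c; have q0 : 0 <= q by rewrite divr_ge0// ltW.
have q1 : q < 1 by rewrite ltr_pdivrMr// mul1r.
pose I n := \int[mu]_(x in `[0, T]) ((1 - expR (- (y x / c) ^+ n.+1)) * psi x).
(* The term of degree k + 1 of the exponential series is a moment of order (n + 1) (k + 1), at most
   C q^((n + 1) (k + 1)) / (k + 1)! after division by the power of c. The sum of these bounds tends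
   to 0 with q^(n + 1). *)
have Ibound n : `|I n| <= C * (expR (q ^+ n.+1) - 1).
  pose v x := (y x / c) ^+ n.+1; pose V := (y 0 / c) ^+ n.+1.
  have vV x : 0 <= x <= T -> 0 <= v x <= V.
    move=> /yle/andP[yx0 yx1]; rewrite exprn_ge0 ?divr_ge0 ?(ltW c0)//=.
    rewrite lerXn2r ?nnegrE ?divr_ge0 ?(ltW c0)//; first exact: le_trans yx1.
    by rewrite ler_wpM2r// invr_ge0 ltW.
  pose h k x := (-1) ^+ k / k.+1`!%:R * v x ^+ k.+1 * psi x.
  have mv : measurable_fun `[0, T] v by exact: mpow.
  have hi k : mu.-integrable `[0, T] (EFin \o h k).
    apply: (@integrableMbounded _ _ _ (1 / k.+1`!%:R * V ^+ k.+1)) => //.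
      by apply: measurable_funM => //; exact: measurable_funX.
    move=> x; rewrite /= in_itv/= => /vV/andP[v0 v1].
    rewrite normrM ler_pM//.
      by rewrite normrM normrX normrN1 expr1n normfV ger0_norm.
    by rewrite normrX ger0_norm// lerXn2r ?nnegrE ?(le_trans v0).
  pose J N := \int[mu]_(x in `[0, T]) ((1 - series (exp_coeff (- v x)) N.+1) * psi x).
  have JE N : J N = \sum_(0 <= k < N) \int[mu]_(x in `[0, T]) h k x.
    have [_ <-] := @Rintegral_sum `[0, T] h N mD hi.
    apply: eq_Rintegral => x _; rewrite exp_partial mulr_suml.
    by apply: eq_bigr => k _.
  have hbd k : `|\int[mu]_(x in `[0, T]) h k x| <= C * exp_coeff (q ^+ n.+1) k.+1.
    pose w := (-1) ^+ k / k.+1`!%:R / c ^+ (n.+1 * k.+1) : R.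
    have -> : \int[mu]_(x in `[0, T]) h k x =
        w * \int[mu]_(x in `[0, T]) (y x ^+ (n.+1 * k.+1) * psi x).
      rewrite -RintegralZl//.
        apply: eq_Rintegral => x _; rewrite /h /w /v -exprM expr_div_n.
        by rewrite !mulrA; congr (_ * _); rewrite mulrAC.
      apply: (@integrableMbounded _ _ _ (y 0 ^+ (n.+1 * k.+1))) => //.
        exact: measurable_funX.
      move=> x; rewrite /= in_itv/= => /yle/andP[v0 v1].
      by rewrite normrX ger0_norm// lerXn2r ?nnegrE ?(le_trans v0).
    rewrite normrM /w normrM normfV (ger0_norm (exprn_ge0 _ (ltW c0))).
    rewrite normrM normrX normrN1 expr1n normfV (ger0_norm (ler0n _ _)) mul1r.
    have -> : C * exp_coeff (q ^+ n.+1) k.+1 =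
       k.+1`!%:R^-1 / c ^+ (n.+1 * k.+1) * (C * d ^+ (n.+1 * k.+1)).
      rewrite /exp_coeff/= -exprM expr_div_n; ring.
    rewrite ler_wpM2l//; first by rewrite divr_ge0// ?exprn_ge0 ?(ltW c0).
    exact: (ym (n.+1 * k.+1).-1).
  have Jbd N : `|J N| <= C * (series (exp_coeff (q ^+ n.+1)) N.+1 - 1).
    rewrite JE (le_trans (ler_norm_sum _ _ _))//.
    apply: (@le_trans _ _ (\sum_(0 <= k < N) C * exp_coeff (q ^+ n.+1) k.+1)).
      by apply: ler_sum => k _; exact: hbd.
    rewrite -mulr_sumr /series/= [X in _ * (X - 1)]big_nat_recl//.
    by rewrite /exp_coeff/= expr0 fact0 divr1 addrAC subrr add0r.
  have Jlim : J @ \oo --> I n.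
    apply: (@Rintegral_dominated _ _ _ (fun x => (1 + expR V) * `|psi x|)) => //.
    - move=> N; apply: measurable_funM => //.
      have -> : (fun x => 1 - series (exp_coeff (- v x)) N.+1) =
          (fun x => \sum_(0 <= k < N) (-1) ^+ k / k.+1`!%:R * v x ^+ k.+1).
        by apply/funext => x; rewrite exp_partial.
      apply: measurable_sum => k; apply: measurable_funM => //.
      exact: measurable_funX.
    - apply: measurable_funM => //; apply: measurable_funB => //.
      by apply: measurableT_comp => //; exact: measurableT_comp.
    - apply: aeW => x Dx; apply: cvgM; last exact: cvg_cst.
      apply: cvgB; first exact: cvg_cst.
      have := @is_cvg_series_exp_coeff R (- v x).
      by rewrite -(cvg_shiftS (series _)).
    - have := @integrableZl _ _ R mu _ mD (1 + expR V) (fun x => `|(psi x)%:E|%E).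
      apply; exact: integrable_abse.
    - move=> N x; rewrite /= in_itv/= => /vV/andP[v0 v1].
      rewrite normrM ler_wpM2r// (le_trans (ler_normB _ _))// normr1 lerD2l.
      rewrite (le_trans (ler_norm_sum _ _ _))//.
      apply: (@le_trans _ _ (series (exp_coeff (v x)) N.+1)).
        apply: ler_sum => k _.
        by rewrite /exp_coeff/= normrM normrX normrN normfV !ger0_norm.
      apply: (@le_trans _ _ (expR (v x))); last by rewrite ler_expR.
      apply: (nondecreasing_cvgn_le _ (@is_cvg_series_exp_coeff R (v x))).
      by apply: nondecreasing_series => k _ _; rewrite exp_coeff_ge0.
  have Slim : (fun N => C * (series (exp_coeff (q ^+ n.+1)) N.+1 - 1)) @ \oo -->
      C * (expR (q ^+ n.+1) - 1).
    apply: cvgM; first exact: cvg_cst.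
    apply: cvgB; last exact: cvg_cst.
    have := @is_cvg_series_exp_coeff R (q ^+ n.+1).
    by rewrite -(cvg_shiftS (series _)).
  apply: (ler_cvg_to (cvg_norm Jlim) Slim).
  by apply: nearW => N; exact: Jbd.
have geo (r : R) : 0 <= r < 1 -> (fun n => r ^+ n.+1) @ \oo --> 0.
  move=> /andP[r0 r1]; rewrite (cvg_shiftS (fun n => r ^+ n)).
  by apply: cvg_expr; rewrite ger0_norm.
have I0 : I @ \oo --> 0.
  have bl : (fun n => C * (expR (q ^+ n.+1) - 1)) @ \oo --> 0.
    rewrite [X in _ --> X](_ : 0 = C * (expR 0 - 1)); last by rewrite expR0 subrr mulr0.
    apply: cvgM; first exact: cvg_cst.
    apply: cvgB; last exact: cvg_cst.
    apply: continuous_cvg; first exact: continuous_expR.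
    by apply: geo; rewrite q0.
  apply/norm_cvg0P.
  apply: (@squeeze_cvgr _ _ _ _ (fun=> 0) (fun n => C * (expR (q ^+ n.+1) - 1))) => //.
    by apply: nearW => n; rewrite normr_ge0 Ibound.
  exact: cvg_cst.
pose chi (x : R) : R := (x <= x0)%R%:R.
have Ilim : I @ \oo --> \int[mu]_(x in `[0, T]) (chi x * psi x).
  apply: (@Rintegral_dominated _ _ _ (fun x => `|psi x|)) => //.
  - move=> n; apply: measurable_funM => //; apply: measurable_funB => //.
    by apply: measurableT_comp => //; apply: measurableT_comp => //; exact: mpow.
  - apply: measurable_funM => //.
    apply: (@measurableT_comp _ _ _ _ _ _ (fun b : bool => b%:R : R)) => //.
    exact: measurable_fun_ler.
  (* At x0 itself the limit is 1 - 1 / e, so this point is left out as a null set. *)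
  - exists [set x0]; split => //; first exact: lebesgue_measure_set1.
    move=> x /= nx; apply/eqP; apply: contrapT => /negP xx0; apply: nx => xI.
    have {}xI : 0 <= x <= T by move: xI; rewrite in_itv.
    have /andP[x1 x2] := xI.
    apply: cvgM; last exact: cvg_cst.
    have y1 : 0 <= y x / c := divr_ge0 (y0 x xI) (ltW c0).
    rewrite /chi; have [xle|xgt] := leP x x0.
      have r1 : 1 < y x / c.
        by rewrite ltr_pdivlMr// mul1r ydec ?(ltW x0T)// lt_neqAle xx0.
      have r0 : 0 < y x / c by exact: lt_trans r1.
      rewrite [X in _ --> X](_ : _ = 1 - 0 :> R); last by rewrite subr0.
      apply: cvgB; first exact: cvg_cst.
      apply: (@squeeze_cvgr _ _ _ _ (fun=> 0) (fun n => ((y x / c)^-1) ^+ n.+1)).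
      + apply: nearW => n; rewrite expR_ge0/= expRN exprVn lef_pV2 ?posrE ?expR_gt0 ?exprn_gt0//.
        by rewrite (le_trans _ (expR_ge1Dx _))// lerDr.
      + exact: cvg_cst.
      + by apply: geo; rewrite invr_ge0 y1 invf_lt1.
    apply: (@squeeze_cvgr _ _ _ _ (fun=> 0) (fun n => (y x / c) ^+ n.+1)).
    + apply: nearW => n; rewrite subr_ge0 expR_le1 oppr_le0 exprn_ge0//=.
      by rewrite lerBlDl -lerBlDr; have := expR_ge1Dx (- (y x / c) ^+ n.+1); lra.
    + exact: cvg_cst.
    + apply: geo; rewrite y1 ltr_pdivrMr// mul1r ydec ?(ltW x00)//.
  - exact: integrable_norm.
  - move=> n x; rewrite /= in_itv/= => xI; rewrite normrM ler_piMl//.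
    have p0 : 0 <= (y x / c) ^+ n.+1 by exact: exprn_ge0 (divr_ge0 (y0 x xI) (ltW c0)).
    have := expR_ge0 (- (y x / c) ^+ n.+1).
    have : expR (- (y x / c) ^+ n.+1) <= 1 by rewrite expR_le1 oppr_le0.
    by move=> ? ?; rewrite ger0_norm; lra.
rewrite -[RHS](cvg_unique _ Ilim I0)//.
rewrite (_ : \int[mu]_(x in `[0, T]) (chi x * psi x) =
   \int[mu]_(x in `[0, T]) (psi \_ `[0, x0]) x).
  rewrite -Rintegral_mkcondr; congr (Rintegral _ _ _); apply/seteqP; split => x/=; rewrite !in_itv/=.
    by move=> /andP[-> xx0]; rewrite xx0 (le_trans xx0 (ltW x0T)).
  by move=> [/andP[-> _]] /andP[_ ->].
apply: eq_Rintegral => x; rewrite inE/= in_itv/= => /andP[x1 x2].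
rewrite patchE mem_setE in_itv/= x1/= /chi.
by case: ifP; rewrite ?mul1r ?mul0r.
Qed.

(** Lebesgue differentiation: psi, extended by 0, is almost everywhere the derivative of its
    primitive, which vanishes on ]0, T[. *)
Lemma Rintegral0_ae (T : R) psi : 0 < T ->
  mu.-integrable `[0, T] (EFin \o psi) ->
  (forall x, 0 < x < T -> \int[mu]_(s in `[0, x]) psi s = 0) ->
  {ae mu, forall x, 0 <= x <= T -> psi x = 0}.
Proof.
move=> T0 ipsi psi0.
pose g := psi \_ `[0, T].
have ig : mu.-integrable setT (EFin \o g).
  by rewrite /g -restrict_EFin; apply/integrable_restrict => //; rewrite setTI.
have igD D : measurable D -> mu.-integrable D (EFin \o g).
  by move=> mD; apply: (@integrableS _ _ R mu setT).
have := FTC1Ny (fun z : R => igD _ (measurable_itv `]-oo, z])) (integrable_locally (measurable_itv _) ipsi).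
have F0 x : 0 < x < T -> \int[mu]_(t in `]-oo, x]) g t = 0.
  move=> /andP[x0 xT]; rewrite -[RHS](psi0 x) ?x0// /g -Rintegral_mkcondr.
  congr (Rintegral _ _ _); apply/seteqP; split => y/=; rewrite !in_itv/=.
    by move=> [-> /andP[-> _]].
  by move=> /andP[-> yx]; rewrite yx (le_trans yx (ltW xT)).
have aux (z : R) : {ae mu, forall x, x != z}.
  exists [set z]; split => //; first exact: lebesgue_measure_set1.
  by move=> x /= /negP; rewrite negbK => /eqP.
move=> /= h; have h0 := aux 0; have hT := aux T.
apply: (@filterS3 _ _ (ae_filter_ringOfSetsType mu) _ _ _ _ _ h h0 hT).
move=> x [_ Dx] x0 xT /andP[x0' xT'].
have xoT : x \in `]0, T[ by rewrite in_itv/= !lt_neqAle eq_sym x0 xT x0' xT'.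
have gx : g x = psi x by rewrite /g patchE mem_set//= in_itv/= x0'.
rewrite -gx -Dx derive1E.
transitivity ('D_1 (cst 0 : R -> R) (x : R)); last exact: derive_cst.
apply: near_eq_derive.
have := near_in_itvoo xoT; apply: filterS => y.
by rewrite in_itv/= => /F0.
Qed.

(** It serves twice: in the Volterra argument, and as integration by parts against the primitive of
    a merely integrable v. *)
Lemma triangle_Fubini (T M : R) (H : R * R -> R) (v : R -> R) :
  measurable_fun setT H -> (forall p, `|H p| <= M) ->
  mu.-integrable `[0, T] (EFin \o v) ->
  \int[mu]_(t in `[0, T]) \int[mu]_(s in `[0, t]) (H (t, s) * v s) =
  \int[mu]_(s in `[0, T]) ((\int[mu]_(t in `[s, T]) H (t, s)) * v s).
Proof.
move=> mH HM iv.
pose vT := v \_ `[0, T].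
have ivT : mu.-integrable setT (EFin \o vT).
  by rewrite /vT -restrict_EFin; apply/integrable_restrict => //; rewrite setTI.
have mvT : measurable_fun setT vT.
  by have /measurable_int/measurable_EFinP := ivT.
(* The integrand is extended by 0 off the triangle to apply Fubini's theorem on the whole plane; the
   side 0 <= s comes from [vT]. *)
pose tri (p : R * R) : R := ((p.2 <= p.1) && (p.1 <= T))%:R.
pose f (p : R * R) : R := tri p * H p * vT p.2.
have mtri : measurable_fun setT tri.
  apply: (@measurableT_comp _ _ _ _ _ _ (fun b : bool => b%:R : R)) => //.
  apply: measurable_and.
    exact: measurable_fun_ler measurable_snd measurable_fst.
  by apply: measurable_fun_ler => //; exact: measurable_fst.
have mf : measurable_fun setT f.
  apply: measurable_funM; first exact: measurable_funM.
  exact: measurableT_comp mvT measurable_snd.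
have tri01 p : 0 <= tri p <= 1 by rewrite /tri; case: (p.2 <= p.1 <= T); rewrite ?lexx ?ler01.
have fM t s : `|f (t, s)| <= M * `|vT s|.
  rewrite /f normrM ler_wpM2r// normrM -[leRHS]mul1r ler_pM//.
  by have /andP[h0 h1] := tri01 (t, s); rewrite ger0_norm.
have f0 t s : ~~ (0 <= t <= T) -> f (t, s) = 0.
  rewrite negb_and -!ltNge => /orP[t0|tT].
    rewrite /f /tri /vT patchE mem_setE in_itv/=.
    have [s0|] := boolP (0 <= s); last by rewrite mulr0.
    by rewrite leNgt (lt_le_trans t0 s0)/= !mul0r.
  by rewrite /f /tri/= [t <= T]leNgt tT andbF !mul0r.
have in1E t : (fun s => f (t, s)) =
    if 0 <= t <= T then (fun s => H (t, s) * v s) \_ `[0, t] else cst 0.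
  apply/funext => s; case: ifPn => [/andP[t0 tT]|/f0->//].
  rewrite /f /tri /vT !patchE !mem_setE !in_itv/= tT andbT.
  have [st|ts] := leP s t; last by rewrite andbF !mul0r.
  by rewrite (le_trans st tT) andbT mul1r; case: ifP; rewrite ?mulr0.
have in2E s : (fun t => f (t, s)) =
    if 0 <= s <= T then (fun t => H (t, s) * v s) \_ `[s, T] else cst 0.
  apply/funext => t; rewrite /f /vT patchE mem_setE in_itv/=.
  case: ifPn => sT; last by rewrite mulr0.
  rewrite /tri patchE mem_setE in_itv/=.
  by case: ifPn => _; rewrite ?mul1r ?mul0r.
have if1 t : mu.-integrable setT (fun s => (f (t, s))%:E).
  apply: (@le_integrable _ _ _ mu setT measurableT _ (EFin \o (fun s => M * vT s))).
  - by apply/measurable_EFinP; apply: measurableT_comp.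
  - move=> s _ /=; rewrite lee_fin (le_trans (fM _ _))// normrM ler_wpM2r//.
    exact: ler_norm.
  - exact: (@integrableZl _ _ R mu setT measurableT M _ ivT).
have if2 s : mu.-integrable setT (fun t => (f (t, s))%:E).
  have E : (fun t => (f (t, s))%:E) = EFin \o (fun t => f (t, s)) by [].
  rewrite E in2E; case: ifPn => sT; last first.
    by have := integrable0 mu setT.
  rewrite -restrict_EFin; apply/integrable_restrict => //; rewrite setTI.
  apply: (@bounded_integrable_itv _ _ (M * `|v s|)).
  - apply: measurable_funM; last exact: measurable_cst.
    by apply: measurable_funTS; exact: measurableT_comp mH (measurable_pair2 _).
  - by move=> t _; rewrite normrM ler_wpM2r.
have fin : (mu \x mu)%E.-integrable setT (EFin \o f).
  apply/integrable12ltyP; first exact/measurable_EFinP.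
  have iMv := @integrableZl _ _ R mu setT measurableT M _ ivT.
  pose C := (\int[mu]_y `|(M%:E * (EFin \o vT) y)|)%E.
  have Cy : (C < +oo)%E by have /integrableP[] := iMv.
  have C0 : (0 <= C)%E by exact: integral_ge0.
  apply: (@le_lt_trans _ _ (\int[mu]_x ((cst C) \_ `[0%R, T]) x)%E); last first.
    rewrite -integral_mkcond integral_cst//= lte_mul_pinfty//.
      by rewrite fin_numElt Cy andbT (lt_le_trans _ C0).
    by rewrite lebesgue_measure_itv/=; case: ifP; rewrite ltry.
  apply: ge0_le_integral => //.
  - by move=> x _; apply: integral_ge0.
  - apply: (@measurable_fun_fubini_tonelli_F _ _ _ _ R mu (abse \o (EFin \o f))).
      by apply: measurableT_comp => //; exact/measurable_EFinP.
    by move=> p; exact: abse_ge0.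
  - by apply/measurable_restrict => //; exact: measurable_cst.
  - move=> x _; rewrite patchE mem_setE in_itv/=; case: ifPn => xT.
      apply: ge0_le_integral => //.
      + apply/measurable_EFinP; apply: measurableT_comp => //.
        exact: measurableT_comp mf (measurable_pair1 x).
      + apply: measurableT_comp => //.
        by have /measurable_int := iMv.
      + by move=> y _; rewrite lee_fin (le_trans (fM _ _))// normrM ler_wpM2r// ler_norm.
    rewrite integral0_eq// => y _.
    by rewrite /= f0// normr0.
have := Fubini fin => /= FF.
transitivity (\int[mu]_t \int[mu]_s f (t, s)).
  rewrite [LHS]Rintegral_mkcond; apply: eq_Rintegral => t _.
  rewrite in1E patchE mem_setE in_itv/=; case: ifP => _.
    by rewrite -Rintegral_mkcond.
  by rewrite Rintegral_cst// mul0r.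
transitivity (\int[mu]_s \int[mu]_t f (t, s)).
  rewrite /Rintegral; congr fine; rewrite -[LHS]/(\int[mu]_x (fine _)%:E)%E.
  transitivity (\int[mu]_x \int[mu]_y (f (x, y))%:E)%E.
    by apply: eq_integral => t _; rewrite fineK//; apply: integrable_fin_num.
  rewrite FF; apply: eq_integral => s _; rewrite fineK//.
  by apply: integrable_fin_num.
rewrite [RHS]Rintegral_mkcond; apply: eq_Rintegral => s _.
rewrite in2E patchE mem_setE in_itv/=; case: ifP => sT.
  rewrite -Rintegral_mkcond RintegralZr//.
  apply: (@bounded_integrable_itv _ _ M) => [|t _]; last exact: HM.
  by apply: measurable_funTS; exact: measurableT_comp mH (measurable_pair2 _).
by rewrite Rintegral_cst// mul0r.
Qed.
End integration.

(** * Injectivity of the convolution with a kernel *)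

Section volterra.
Context {R : realType}.
Local Notation mu := (@lebesgue_measure R).

Lemma continuous_integrable_itv (f : R -> R) (a b : R) : continuous f ->
  mu.-integrable `[a, b] (EFin \o f).
Proof.
move=> cf; apply: continuous_compact_integrable; first exact: segment_compact.
exact: continuous_subspaceT.
Qed.

Lemma Rintegral_FTC2 (f F : R -> R) (a b : R) : a <= b -> continuous f ->
  continuous F -> (forall t, a < t < b -> is_derive t 1 F (f t)) ->
  \int[mu]_(x in `[a, b]) f x = F b - F a.
Proof.
rewrite le_eqVlt => /predU1P[->|ab] cf cF dF.
  by rewrite subrr set_itv1 Rintegral_set1.
rewrite /Rintegral (@continuous_FTC2 _ f F)//.
- exact: continuous_subspaceT.
- split.
  + by move=> t; rewrite in_itv/= => /dF [].
  + exact/cvg_at_right_filter/cF.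
  + exact/cvg_at_left_filter/cF.
- by move=> t; rewrite in_itv/= => /dF h; rewrite derive1E; exact: derive_val.
Qed.

(** The derivative in t of - exp (w (T - t)) Z (t - s) is exp (w (T - t)) K (t - s). Integrating
    over s <= t <= T, then against phi, and exchanging the integrals turns K * phi = 0 into: Z 0
    times the exponential moment of phi equals the integral of Z (T - s) phi s. *)
Lemma resolvent_bound (w T M : R) (K Z phi : R -> R) :
  0 < w -> continuous K -> continuous Z -> continuous phi ->
  (forall t, `|K t| <= M) -> (forall t, 0 <= t -> `|Z t| <= M) ->
  (forall t : R, 0 < t -> is_derive t 1 Z (w * Z t - K t)) ->
  (forall t, 0 <= t -> \int[mu]_(s in `[0, t]) (K (t - s) * phi s) = 0) ->
  `|Z 0| * `|\int[mu]_(s in `[0, T]) (expR (w * (T - s)) * phi s)| <=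
  M * \int[mu]_(s in `[0, T]) `|phi s|.
Proof.
move=> w0 cK cZ cphi KM ZM dZ Kphi.
(* The maximum keeps H bounded on the whole plane, as [triangle_Fubini] asks; only t >= 0
   matters. *)
pose H (p : R * R) : R := expR (w * (T - Num.max p.1 0)) * K (p.1 - p.2).
have mmax : measurable_fun setT (fun p : R * R => expR (w * (T - Num.max p.1 0))).
  apply: measurableT_comp => //; apply: measurable_funM => //.
  apply: measurable_funB => //; apply: measurable_maxr => //; exact: measurable_fst.
have mK : measurable_fun setT (fun p : R * R => K (p.1 - p.2)).
  apply: measurableT_comp; first exact: continuous_measurable_fun.
  by apply: measurable_funB; [exact: measurable_fst|exact: measurable_snd].
have mH : measurable_fun setT H by exact: measurable_funM.
have HM p : `|H p| <= expR (w * T) * M.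
  rewrite /H normrM ger0_norm ?expR_ge0// ler_pM ?expR_ge0//.
  by rewrite ler_expR ler_wpM2l ?(ltW w0)// gerBl le_max lexx orbT.
have iphi : mu.-integrable `[0, T] (EFin \o phi) by exact: continuous_integrable_itv.
have := triangle_Fubini mH HM iphi.
have -> : \int[mu]_(t in `[0, T]) \int[mu]_(s in `[0, t]) (H (t, s) * phi s) = 0.
  transitivity (\int[mu]_(t in `[0, T]) (0 : R)); last first.
    by rewrite Rintegral_cst// mul0r.
  apply: eq_Rintegral => t; rewrite inE/= in_itv/= => /andP[t0 _].
  rewrite -[RHS](mulr0 (expR (w * (T - t)))) -[in RHS](Kphi t t0) -RintegralZl//.
    by apply: eq_Rintegral => s _; rewrite /H/= max_l// mulrA.
  apply: continuous_integrable_itv => s; apply: cvgM; last exact: cphi.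
  apply: continuous_comp; last exact: cK.
  by apply: cvgB; [exact: cvg_cst|exact: cvg_id].
have cexp : continuous (fun t => expR (w * (T - t))).
  move=> t; apply: continuous_comp; last exact: continuous_expR.
  apply: cvgM; first exact: cvg_cst.
  by apply: cvgB; [exact: cvg_cst|exact: cvg_id].
have inner s : 0 <= s <= T -> \int[mu]_(t in `[s, T]) H (t, s) =
    expR (w * (T - s)) * Z 0 - Z (T - s).
  move=> /andP[s0 sT].
  pose G t := - (expR (w * (T - t)) * Z (t - s)).
  have cshift (g : R -> R) : continuous g -> continuous (fun t => g (t - s)).
    move=> cg t; apply: continuous_comp; last exact: cg.
    by apply: cvgB; [exact: cvg_id|exact: cvg_cst].
  transitivity (\int[mu]_(t in `[s, T]) (expR (w * (T - t)) * K (t - s))).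
    apply: eq_Rintegral => t; rewrite inE/= in_itv/= => /andP[st _].
    by rewrite /H/= max_l// (le_trans s0).
  transitivity (G T - G s); last first.
    by rewrite /G !subrr mulr0 expR0 mul1r opprK addrC.
  apply: Rintegral_FTC2; first exact: sT.
  - by move=> t; apply: cvgM; [exact: cexp|exact: (cshift _ cK)].
  - by move=> t; apply: cvgN; apply: cvgM; [exact: cexp|exact: (cshift _ cZ)].
  - move=> t /andP[st tT].
    have dZs : is_derive t 1 (fun t => Z (t - s)) (w * Z (t - s) - K (t - s)).
      have ts0 : 0 < t - s by rewrite subr_gt0.
      have h := dZ _ ts0.
      have := @is_derive1_comp _ Z (fun t => t - s) t _ _ h _.
      by move=> /(_ 1 _); rewrite mulr1; apply; apply: is_derive_eq; rewrite subr0.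
    have dE : is_derive t 1 (fun t => expR (w * (T - t))) (- w * expR (w * (T - t))).
      have := @is_derive1_comp _ expR (fun t => w * (T - t)) t _ _ (is_derive_expR _).
      move=> /(_ (- w) _); rewrite mulrC; apply.
      by apply: is_derive_eq; rewrite /GRing.scale/=; ring.
    by apply: is_derive_eq; rewrite /GRing.scale/=; ring.
have iE : mu.-integrable `[0, T] (EFin \o (fun s => expR (w * (T - s)) * phi s)).
  apply: continuous_integrable_itv => s.
  by apply: cvgM; [exact: cexp|exact: cphi].
have iZ : mu.-integrable `[0, T] (EFin \o (fun s => Z (T - s) * phi s)).
  apply: continuous_integrable_itv => s; apply: cvgM; last exact: cphi.
  apply: continuous_comp; last exact: cZ.
  by apply: cvgB; [exact: cvg_cst|exact: cvg_id].
have -> : \int[mu]_(s in `[0, T]) ((\int[mu]_(t in `[s, T]) H (t, s)) * phi s) =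
   Z 0 * \int[mu]_(s in `[0, T]) (expR (w * (T - s)) * phi s) -
   \int[mu]_(s in `[0, T]) (Z (T - s) * phi s).
  rewrite -RintegralZl// -RintegralB//; last exact: (@integrableZl _ _ R mu _ _ _ _ iE).
  apply: eq_Rintegral => s; rewrite inE/= in_itv/= => /inner ->; ring.
move/eqP; rewrite eq_sym subr_eq0 => /eqP E.
rewrite -normrM E (le_trans (le_normr_Rintegral _ _))//.
rewrite -RintegralZl//; last exact: integrable_norm.
apply: le_Rintegral => //.
- exact: integrable_norm.
- exact: (@integrableZl _ _ R mu _ _ _ (fun x => `|phi x|%:E) (integrable_norm iphi)).
- move=> s; rewrite /= in_itv/= => /andP[s0 sT].
  by rewrite normrM ler_wpM2r// ZM// subr_ge0.
Qed.

Lemma volterra_injective (M : R) (K phi : R -> R) (Z : nat -> R -> R) :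
  continuous K -> continuous phi -> (forall n, continuous (Z n)) ->
  (forall t, `|K t| <= M) -> (forall n t, 0 <= t -> `|Z n t| <= M) ->
  (forall n (t : R), 0 < t ->
     is_derive t 1 (Z n) ((n.+1%:R + 1 / 2) * Z n t - K t)) ->
  (forall e : R, 0 < e -> exists2 c, 0 < c &
     forall n, c * expR (- (e * (n.+1%:R + 1 / 2))) <= `|Z n 0|) ->
  (forall t, 0 <= t -> \int[mu]_(s in `[0, t]) (K (t - s) * phi s) = 0) ->
  forall t, 0 <= t -> phi t = 0.
Proof.
move=> cK cphi cZ KM ZM dZ Zlow Kphi.
pose w n : R := n.+1%:R + 1 / 2.
have w0 n : 0 < w n by rewrite addr_gt0// divr_gt0.
suff phi0 t : 0 < t -> phi t = 0.
  move=> t; rewrite le_eqVlt => /predU1P[<-|]; last exact: phi0.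
  have c0 : phi @ 0^'+ --> phi 0 by exact/cvg_at_right_filter/cphi.
  apply: (cvg_unique (@Rhausdorff R) c0).
  apply: cvg_near_cst; near=> x; apply: phi0; near: x; exact: nbhs_right_gt.
(* T > t puts t inside ]0, T[, where the primitive of psi can be differentiated. *)
move=> t0; pose T := t + 1; have T0 : 0 < T by rewrite addr_gt0.
(* psi takes the half of the half-integers, which leaves integer powers of y = exp (T - s) for
   [moment_vanish]. *)
pose psi s := expR (1 / 2 * (T - s)) * phi s.
have cpsi : continuous psi.
  move=> s; apply: cvgM; last exact: cphi.
  apply: continuous_comp; last exact: continuous_expR.
  apply: cvgM; first exact: cvg_cst.
  by apply: cvgB; [exact: cvg_cst|exact: cvg_id].
pose y s : R := expR (T - s).
have ipsi x : mu.-integrable `[0, x] (EFin \o psi) by exact: continuous_integrable_itv.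
have psiint x : 0 < x < T -> \int[mu]_(s in `[0, x]) psi s = 0.
  (* Any e in ]0, T - x[ would do: the moments grow like exp (e n), more slowly than the powers of y
     x = exp (T - x). *)
  move=> /andP[x0 xT]; pose e := (T - x) / 2.
  have e0 : 0 < e by rewrite divr_gt0// subr_gt0.
  have [c c0 cZn] := Zlow _ e0.
  pose Phi := \int[mu]_(s in `[0, T]) `|phi s|.
  apply: (@moment_vanish _ T x (expR e) (M * Phi / c * expR (e / 2)) y) => //.
  - by rewrite x0.
  - by move=> a b _ ab _; rewrite ltr_expR ltrD2l ltrN2.
  - by move=> s _; exact: expR_ge0.
  - apply: measurable_funTS; apply: measurableT_comp => //.
    exact: measurable_funB.
  - by rewrite expR_ge0 ltr_expR /e; lra.
  - move=> n.
    have -> : \int[mu]_(s in `[0, T]) (y s ^+ n.+1 * psi s) =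
        \int[mu]_(s in `[0, T]) (expR (w n * (T - s)) * phi s).
      apply: eq_Rintegral => s _; rewrite /y /psi mulrA -expRM_natl -expRD.
      by congr (expR _ * _); rewrite /w; ring.
    have := resolvent_bound T (w0 n) cK (cZ n) cphi KM (ZM n) (dZ n) Kphi.
    rewrite -/Phi => h.
    have Z0 : 0 < `|Z n 0| by rewrite (lt_le_trans _ (cZn n))// mulr_gt0// expR_gt0.
    have MP0 : 0 <= M * Phi by rewrite (le_trans _ h)// mulr_ge0.
    rewrite -(ler_pM2l Z0) (le_trans h)//.
    apply: (@le_trans _ _ (c * expR (- (e * w n)) *
      (M * Phi / c * expR (e / 2) * expR e ^+ n.+1))); last first.
      rewrite ler_wpM2r ?cZn//.
      apply: mulr_ge0; last by rewrite exprn_ge0// expR_ge0.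
      apply: mulr_ge0; last exact: expR_ge0.
      by apply: divr_ge0 => //; exact: ltW.
    have -> : c * expR (- (e * w n)) * (M * Phi / c * expR (e / 2) * expR e ^+ n.+1) =
        M * Phi * (expR (- (e * w n)) * (expR (e / 2) * expR e ^+ n.+1)).
      by field; rewrite gt_eqF.
    rewrite -expRM_natl -!expRD (_ : - _ + _ = 0) ?expR0 ?mulr1// /w.
    by rewrite -[n.+1%:R]natr1; field.
have tT : t < T by rewrite ltrDl.
have [] := continuous_FTC1_closed tT (ipsi T) t0 (cpsi t).
move=> _; rewrite derive1E.
move=> psiD; have : psi t = 0.
  rewrite -psiD; transitivity ('D_1 (cst 0 : R -> R) (t : R)); last exact: derive_cst.
  apply: near_eq_derive.
  have : t \in `]0, T[ by rewrite in_itv/= t0.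
  move/near_in_itvoo; apply: filterS => x.
  by rewrite in_itv/= => /psiint.
move=> /eqP; rewrite mulf_eq0 gt_eqF ?expR_gt0//=.
by move/eqP.
Unshelve. all: by end_near. Qed.

End volterra.

(** * The two kernels *)

Section series_calculus.
Context {R : realType}.
Local Notation nu := (@nu R).
Local Notation wtail := (@wtail R).

(** Two uses of the mean value theorem, whence B instead of B / 2; explicit in B, so that it can be
    summed over the terms of a series. *)
Lemma taylor2 (f f1 f2 : R -> R) (t h B : R) :
  (forall x, `|x - t| <= `|h| -> is_derive x 1 f (f1 x)) ->
  (forall x, `|x - t| <= `|h| -> is_derive x 1 f1 (f2 x)) ->
  (forall x, `|x - t| <= `|h| -> `|f2 x| <= B) ->
  `|f (t + h) - f t - h * f1 t| <= B * h ^+ 2.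
Proof.
move=> df df1 f2B.
have B0 : 0 <= B by rewrite (le_trans _ (f2B t _))// subrr normr0.
have mvt (g g' : R -> R) (a b : R) : (forall x, `|x - t| <= `|h| -> is_derive x 1 g (g' x)) ->
    `|a - t| <= `|h| -> `|b - t| <= `|h| ->
    exists2 c, `|c - t| <= `|h| & g b - g a = g' c * (b - a).
  move=> dg; wlog ab : a b / a <= b => [wl|] ah bh.
    have [ab|/ltW ba] := leP a b; first exact: wl.
    have [c ch E] := wl _ _ ba bh ah.
    by exists c => //; rewrite -opprB E; ring.
  have inab x : x \in `[a, b] -> `|x - t| <= `|h|.
    rewrite in_itv/= => /andP[ax xb]; rewrite ler_norml.
    by move: ah bh; rewrite !ler_norml => /andP[? ?] /andP[? ?]; apply/andP; split; lra.
  have [| |c cab E] := @MVT_segment R g g' a b ab.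
  - by move=> x xab; apply: dg; apply: inab; exact: subset_itv_oo_cc.
  - apply: derivable_within_continuous => x xab.
    by have [] := dg _ (inab _ xab).
  - by exists c => //; exact: inab.
have th : `|t - t| <= `|h| by rewrite subrr normr0.
have thh : `|t + h - t| <= `|h| by rewrite addrAC subrr add0r.
have [c ch ->] := mvt f f1 t (t + h) df th thh.
rewrite [t + h - t]addrAC subrr add0r.
have [d dh E] := mvt f1 f2 t c df1 th ch.
rewrite [h * _]mulrC -mulrBl E normrM normrM -mulrA -(real_normK (num_real h)).
rewrite expr2 ler_pM ?mulr_ge0 ?f2B// ler_wpM2r//.
Qed.

Lemma dominated_ge0 (h : nat -> R) H : dominated h H -> 0 <= H.
Proof.
move=> /(_ 0%N)/(le_trans (normr_ge0 _)).
by rewrite pmulr_lge0// exprn_gt0// ltr_pwDl// ltW// nu_gt0.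
Qed.

Lemma LserB (h g : nat -> R) H G : dominated h H -> dominated g G ->
  Lser (fun j => h j - g j) = Lser h - Lser g.
Proof.
move=> hH gG; have gN : dominated (fun j => -1 * g j) G.
  by move=> j; rewrite mulN1r normrN.
rewrite -mulN1r -(LserZ _ gG) -(LserD hH gN).
by apply: eq_Lser => j; rewrite mulN1r.
Qed.

(** The Taylor remainders of the terms, at most h^2 B (1 + nu_j)^2, sum to at most h^2 B [wtail],
    which is o(h). *)
Lemma Lser_derive (g g1 g2 : nat -> R -> R) (t e B : R) : 0 < e ->
  (forall j x, `|x - t| < e -> is_derive x 1 (g j) (g1 j x)) ->
  (forall j x, `|x - t| < e -> is_derive x 1 (g1 j) (g2 j x)) ->
  (forall x, `|x - t| < e -> dominated (g^~ x) B) ->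
  (forall x, `|x - t| < e -> dominated (g1^~ x) B) ->
  (forall x, `|x - t| < e -> dominated (g2^~ x) B) ->
  is_derive t 1 (fun x => Lser (g^~ x)) (Lser (g1^~ t)).
Proof.
move=> e0 dg dg1 gB g1B g2B.
have tt : `|t - t| < e by rewrite subrr normr0.
suff H : (fun h => h^-1 *: (Lser (g^~ (h *: (1 : R) + t)) - Lser (g^~ t))) @ 0^' -->
    Lser (g1^~ t).
  by apply: DeriveDef; [apply/cvg_ex; exists (Lser (g1^~ t))|apply/cvg_lim].
apply/cvgrPdist_le => eps eps0.
have B0 := dominated_ge0 (gB _ tt).
have w0 : 0 <= wtail by rewrite mulr_ge0// exprn_ge0.
near=> h.
have h0 : h != 0 by near: h; exact: nbhs_dnbhs_neq.
have he : `|h| < e by near: h; exact: dnbhs0_lt.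
have hle : `|h| <= eps / (B * wtail + 1).
  by near: h; apply: dnbhs0_le; rewrite divr_gt0// ltr_wpDl// mulr_ge0.
have th : `|t + h - t| < e by rewrite addrAC subrr add0r.
rewrite [h *: 1 + t]addrC [h *: 1]mulr1.
have E : Lser (fun j => g j (t + h) - g j t - h * g1 j t) =
    Lser (g^~ (t + h)) - Lser (g^~ t) - h * Lser (g1^~ t).
  have d1 : dominated (fun j => g j (t + h) - g j t) (B + B).
    by move=> j; rewrite mulrDl (le_trans (ler_normB _ _))// lerD ?gB.
  have d2 : dominated (fun j => h * g1 j t) (`|h| * B).
    by move=> j; rewrite normrM -mulrA ler_wpM2l// g1B.
  by rewrite (LserB d1 d2) (LserB (gB _ th) (gB _ tt)) (LserZ _ (g1B _ tt)).
have bd : `|Lser (g^~ (t + h)) - Lser (g^~ t) - h * Lser (g1^~ t)| <= h ^+ 2 * B * wtail.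
  rewrite -E; apply: Lser_le => j; rewrite -mulrA [leRHS]mulrC.
  apply: (@taylor2 _ (g1 j) (g2 j)) => x xh; first by apply: dg; exact: le_lt_trans he.
    by apply: dg1; exact: le_lt_trans he.
  by apply: g2B; exact: le_lt_trans he.
rewrite distrC.
rewrite (_ : _ - _ = h^-1 * (Lser (g^~ (t + h)) - Lser (g^~ t) - h * Lser (g1^~ t))); last first.
  by rewrite /GRing.scale/=; field.
rewrite normrM normfV ler_pdivrMl ?normr_gt0//.
rewrite (le_trans bd)// -(real_normK (num_real h)) expr2 -!mulrA ler_wpM2l//.
apply: (@le_trans _ _ (eps / (B * wtail + 1) * (B * wtail))).
  by rewrite ler_wpM2r// mulr_ge0.
have D0 : 0 < B * wtail + 1 by rewrite ltr_wpDl// mulr_ge0.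
rewrite mulrAC ler_pdivrMr// ler_wpM2l ?(ltW eps0)// lerDl//.
Unshelve. all: by end_near. Qed.

Lemma Lser_lipschitz (g : nat -> R -> R) (x y B G : R) :
  dominated (g^~ x) G -> dominated (g^~ y) G ->
  (forall j, `|g j x - g j y| <= B * (1 + nu j) ^+ 2) ->
  `|Lser (g^~ x) - Lser (g^~ y)| <= B * wtail.
Proof. by move=> gx gy gB; rewrite -(LserB gx gy); apply: Lser_le. Qed.

Lemma Lser_continuous (g : nat -> R -> R) (B G : R) :
  (forall x, dominated (g^~ x) G) ->
  (forall j x y, `|g j x - g j y| <= B * (1 + nu j) ^+ 2 * `|x - y|) ->
  continuous (fun x => Lser (g^~ x)).
Proof.
move=> gG gB x; apply/cvgrPdist_le => eps eps0.
have w0 : 0 <= wtail by rewrite mulr_ge0// exprn_ge0.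
have B0 : 0 <= B.
  have := le_trans (normr_ge0 _) (gB 0%N 0 1).
  rewrite sub0r normrN1 mulr1 pmulr_lge0// exprn_gt0// ltr_pwDl// ltW// nu_gt0.
  done.
near=> y.
have xy : `|x - y| <= eps / (B * wtail + 1).
  near: y; apply: cvgr_dist_le; first exact: cvg_id.
  by rewrite divr_gt0// ltr_wpDl// mulr_ge0.
apply: le_trans (Lser_lipschitz (B := B * `|x - y|) (gG x) (gG y) _) _.
  by move=> j; rewrite mulrAC.
have D0 : 0 < B * wtail + 1 by rewrite ltr_wpDl// mulr_ge0.
rewrite mulrAC (le_trans (ler_wpM2l (mulr_ge0 B0 w0) xy))//.
by rewrite mulrA ler_pdivrMr// mulrC ler_wpM2l ?(ltW eps0)// lerDl.
Unshelve. all: by end_near. Qed.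
End series_calculus.

(** * A criterion for real kernels, and the kernel of the cosine function *)

Section real_kernels.
Context {R : realType}.
Local Notation mu := (@lebesgue_measure R).

Lemma Re_realC (a : R) (z : R[i]) : complex.Re (a%:C * z) = a * complex.Re z.
Proof. by case: z => x y /=; rewrite mul0r subr0. Qed.

Lemma Im_realC (a : R) (z : R[i]) : complex.Im (a%:C * z) = a * complex.Im z.
Proof. by case: z => x y /=; rewrite mul0r addr0. Qed.

Lemma normcR (a : R) : normc a%:C = `|a|.
Proof. by rewrite /= expr0n addr0 sqrtr_sqr. Qed.

Lemma Re_le_normc (z : R[i]) : `|complex.Re z| <= normc z.
Proof.
case: z => a b /=; rewrite -sqrtr_sqr ler_sqrt ?addr_ge0 ?sqr_ge0//.
by rewrite lerDl sqr_ge0.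
Qed.

Lemma Im_le_normc (z : R[i]) : `|complex.Im z| <= normc z.
Proof.
case: z => a b /=; rewrite -sqrtr_sqr ler_sqrt ?addr_ge0 ?sqr_ge0//.
by rewrite lerDr sqr_ge0.
Qed.

Lemma normc_le (z : R[i]) : normc z <= `|complex.Re z| + `|complex.Im z|.
Proof.
have -> : z = (complex.Re z)%:C + 'i%C * (complex.Im z)%:C.
  by case: z => a b; simpc.
apply: le_trans (normc_triangle _ _) _; rewrite normcM !normcR.
rewrite /normc/= !expr0n expr1n/= add0r sqrtr1 mul1r.
by rewrite !(mul0r, mul1r, mulr0, subr0, add0r, addr0).
Qed.

(** phi is continuous on the half-line only; freezing it at t < 0 gives a function continuous on R,
    as [volterra_injective] requires. f stands for the real or the imaginary part. *)
Lemma continuous_max0 (f : R[i] -> R) (phi : R -> R[i]) :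
  (forall z w, `|f z - f w| <= normc (z - w)) ->
  {within `[0, +oo[, continuous (phi : R -> R[i]^o)} ->
  continuous (fun t : R => f (phi (Num.max t 0))).
Proof.
move=> flip /subspace_continuousP cphi t.
have maxA x : `[0, +oo[%classic (Num.max x 0 : R).
  by rewrite /= in_itv/= andbT le_max lexx orbT.
apply/cvgrPdist_lt => e e0.
have := cphi _ (maxA t) => /cvgrPdist_lt/(_ e%:C); rewrite ltcR => /(_ e0).
rewrite near_withinE => near1.
have cmax : (fun x : R => Num.max x 0) @ t --> Num.max t 0.
  by apply: (@continuous_max _ _ id (cst 0)) => //; exact: cvg_cst.
have near2 : \forall x \near t, `|phi (Num.max t 0) - phi (Num.max x 0)| < e%:C.
  by have := cmax _ near1; apply: (@filterS _ (nbhs t)) => x /= /(_ (maxA x)).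
near=> x.
have : `|phi (Num.max t 0) - phi (Num.max x 0)| < e%:C by near: x; exact: near2.
by rewrite normCE ltcR; exact: le_lt_trans.
Unshelve. all: by end_near. Qed.

(** As K is real, the real and imaginary parts of phi satisfy the convolution equation
    separately. *)
Lemma exp_bounded_kernel_of_resolvent (M : R) (K : R -> R) (Z : nat -> R -> R) :
  0 < M -> continuous K -> (forall n, continuous (Z n)) ->
  (forall t, `|K t| <= M) -> (forall n t, 0 <= t -> `|Z n t| <= M) ->
  (forall n (t : R), 0 < t ->
     is_derive t 1 (Z n) ((n.+1%:R + 1 / 2) * Z n t - K t)) ->
  (forall e : R, 0 < e -> exists2 c, 0 < c &
     forall n, c * expR (- (e * (n.+1%:R + 1 / 2))) <= `|Z n 0|) ->
  exp_bounded_kernel (fun t => (K t)%:C).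
Proof.
move=> M0 cK cZ KM ZM dZ Zlow; split; last first.
  by exists M, 0; split => // t _; rewrite normcR mul0r expR0 mulr1.
split.
  move=> T T0; split; first exact: continuous_integrable_itv.
  by apply: continuous_integrable_itv => t; exact: cvg_cst.
move=> phi cphi Kphi t t0.
have sub (f : R[i] -> R) : (forall z w, `|f z - f w| <= normc (z - w)) ->
    (forall a z, f (a%:C * z) = a * f z) ->
    (forall t, 0 <= t -> \int[mu]_(s in `[0, t]) f ((K (t - s))%:C * phi s) = 0) ->
    f (phi t) = 0.
  move=> flip fZ fint.
  have := volterra_injective cK (continuous_max0 flip cphi) cZ KM ZM dZ Zlow _ t0.
  rewrite max_l//; apply => u u0; rewrite -[RHS](fint u u0).
  apply: eq_Rintegral => s; rewrite inE/= in_itv/= => /andP[s0 _].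
  by rewrite max_l// fZ.
have ReB (z w : R[i]) : complex.Re z - complex.Re w = complex.Re (z - w).
  by case: z w => [? ?] [? ?].
have ImB (z w : R[i]) : complex.Im z - complex.Im w = complex.Im (z - w).
  by case: z w => [? ?] [? ?].
have re0 : complex.Re (phi t) = 0.
  have h u (u0 : 0 <= u) : \int[mu]_(s in `[0, u]) complex.Re ((K (u - s))%:C * phi s) = 0.
    by have [] := Kphi u u0.
  by refine (sub (@complex.Re R) _ Re_realC h) => z w; rewrite ReB Re_le_normc.
have im0 : complex.Im (phi t) = 0.
  have h u (u0 : 0 <= u) : \int[mu]_(s in `[0, u]) complex.Im ((K (u - s))%:C * phi s) = 0.
    by have [] := Kphi u u0.
  by refine (sub (@complex.Im R) _ Im_realC h) => z w; rewrite ImB Im_le_normc.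
by case: (phi t) re0 im0 => a b /= -> ->.
Qed.

Lemma Theta_realE (K F : R -> R) (t : R) : 0 <= t -> continuous K -> continuous F ->
  F 0 = 0 -> (forall x : R, 0 < x -> is_derive x 1 F (K x)) ->
  Theta (fun t => (K t)%:C) t = (F t)%:C.
Proof.
move=> t0 cK cF F0 dF; rewrite /Theta /Cintegral/=.
have dF' x : 0 < x < t -> is_derive x 1 F (K x) by move=> /andP[x0 _]; exact: dF.
have := Rintegral_FTC2 t0 cK cF dF'; rewrite F0 subr0 => ->.
by rewrite Rintegral_cst// mul0r.
Qed.

Definition om j : R := (j.+1%:R / blk%:R) ^+ 2.

Lemma nu_om j : nu j = om j ^+ 2.
Proof. by rewrite /nu /om -exprM. Qed.

Lemma om_gt0 j : 0 < om j.
Proof. by rewrite exprn_gt0// divr_gt0. Qed.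

Definition ominv : R := blk%:R ^+ 2.

Lemma ominv_ge1 : 1 <= ominv.
Proof. by rewrite exprn_ege1// ler1n. Qed.

Lemma om_inv_le j : (om j)^-1 <= ominv.
Proof.
rewrite /om -exprVn invf_div expr_div_n ler_pdivrMr ?exprn_gt0//.
by rewrite ler_peMr ?exprn_ge0// exprn_ege1// ler1n.
Qed.

Lemma om_le j : om j <= 1 + nu j.
Proof. by rewrite nu_om; have := om_gt0 j; nra. Qed.

Lemma nu1_ge1 j : 1 <= 1 + nu j :> R.
Proof. by rewrite lerDl ltW ?nu_gt0. Qed.

Lemma nu1_sqr_ge j : 1 + nu j <= (1 + nu j) ^+ 2 :> R.
Proof. by rewrite -[leLHS]expr1 ler_weXn2l// nu1_ge1. Qed.

Lemma le_dominated (h : nat -> R) (B : R) : 0 <= B ->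
  (forall j, `|h j| <= B * (1 + nu j)) -> dominated h B.
Proof. by move=> B0 hB j; rewrite (le_trans (hB j))// ler_wpM2l// nu1_sqr_ge. Qed.

Lemma le1_dominated (h : nat -> R) (B : R) : 0 <= B ->
  (forall j, `|h j| <= B) -> dominated h B.
Proof.
by move=> B0 hB; apply: le_dominated => // j; rewrite (le_trans (hB j))// ler_peMr// nu1_ge1.
Qed.

Lemma sin_norm_le1 (x : R) : `|sin x| <= 1.
Proof. by rewrite ler_norml sin_geN1 sin_le1. Qed.

Lemma cos_norm_le1 (x : R) : `|cos x| <= 1.
Proof. by rewrite ler_norml cos_geN1 cos_le1. Qed.

Definition Kcos (t : R) : R := Lser (fun j => sin (om j * t) / om j).

(** The integral of exp (- w s) [Kcos] (t + s) over s >= 0, computed term by term; at t = 0 it is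
    the Laplace transform of [Kcos]. *)
Definition Zcos (w t : R) : R :=
  Lser (fun j => (cos (om j * t) + w * (sin (om j * t) / om j)) / (w ^+ 2 + nu j)).

Lemma sin_om_le j t : `|sin (om j * t) / om j| <= ominv.
Proof.
rewrite normrM normfV (gtr0_norm (om_gt0 j)) -[leRHS]mul1r.
by rewrite ler_pM ?sin_norm_le1 ?om_inv_le ?invr_ge0 ?(ltW (om_gt0 j)).
Qed.

Let om_n0 j : om j != 0. Proof. by rewrite gt_eqF ?om_gt0. Qed.

Lemma is_derive_sinM (k t : R) :
  is_derive t 1 (fun t => sin (k * t)) (cos (k * t) * k).
Proof.
have := @is_derive1_comp _ sin (fun t => k * t) t _ _ (is_derive_sin _).
move=> /(_ k _); apply.
by apply: is_derive_eq; rewrite /GRing.scale/= mulr1.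
Qed.

Lemma is_derive_cosM (k t : R) :
  is_derive t 1 (fun t => cos (k * t)) (- sin (k * t) * k).
Proof.
have := @is_derive1_comp _ cos (fun t => k * t) t _ _ (is_derive_cos _).
move=> /(_ k _); apply.
by apply: is_derive_eq; rewrite /GRing.scale/= mulr1.
Qed.

Lemma is_derive_expNM (k t : R) :
  is_derive t 1 (fun t => expR (- (k * t))) (- (k * expR (- (k * t)))).
Proof.
have := @is_derive1_comp _ expR (fun t => - (k * t)) t _ _ (is_derive_expR _).
move=> /(_ (- k) _); rewrite mulrN mulrC; apply.
by apply: is_derive_eq; rewrite /GRing.scale/= mulr1.
Qed.

Lemma is_derive_Kcos (t : R) :
  is_derive t 1 Kcos (Lser (fun j => cos (om j * t))).
Proof.
have o1 := ominv_ge1; have o0 : 0 <= ominv by lra.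
apply: (@Lser_derive _ (fun j t => sin (om j * t) / om j)
  (fun j t => cos (om j * t)) (fun j t => - (om j * sin (om j * t))) _ 1 ominv) => //.
- move=> j x _; have := is_derive_sinM (om j) x => h.
  by apply: is_derive_eq; rewrite /GRing.scale/=; field.
- move=> j x _; have h := is_derive_cosM (om j) x.
  by apply: is_derive_eq; rewrite mulNr mulrC.
- by move=> x _; apply: le1_dominated => // j; exact: sin_om_le.
- move=> x _; apply: le1_dominated => // j.
  exact: le_trans (cos_norm_le1 _) o1.
- move=> x _; apply: le_dominated => // j; rewrite normrN normrM (gtr0_norm (om_gt0 j)).
  have := sin_norm_le1 (om j * x); have := om_le j; have := om_gt0 j.
  by have := normr_ge0 (sin (om j * x)); have := nu_gt0 (R := R) j; nra.
Qed.

Lemma Kcos_bound t : `|Kcos t| <= ominv * wtail.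
Proof.
apply: Lser_le; apply: le1_dominated => [|j]; last exact: sin_om_le.
by rewrite (le_trans _ ominv_ge1).
Qed.

Lemma derivable_continuous (f f' : R -> R) :
  (forall t : R, is_derive t 1 f (f' t)) -> continuous f.
Proof.
move=> df t; apply: differentiable_continuous; apply/derivable1_diffP.
by have [] := df t.
Qed.

Lemma continuous_Kcos : continuous Kcos.
Proof. by apply: derivable_continuous => t; exact: is_derive_Kcos. Qed.

Let wnu_ge (w : R) j : 1 <= w -> 1 <= w ^+ 2 + nu j.
Proof. by move=> w1; rewrite ler_wpDr ?(ltW (nu_gt0 _))// exprn_ege1. Qed.

Let Zcos_dominated (w t : R) : 1 <= w -> dominated
  (fun j => (cos (om j * t) + w * (sin (om j * t) / om j)) / (w ^+ 2 + nu j)) (1 + ominv).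
Proof.
move=> w1; have o1 := ominv_ge1; apply: le1_dominated => [|j]; first by lra.
have wn := wnu_ge j w1; have nj := nu_gt0 (R := R) j.
rewrite normrM normfV [`|_ + nu j|]ger0_norm; last by lra.
rewrite ler_pdivrMr; last by lra.
rewrite (le_trans (ler_normD _ _))// mulrDl mul1r lerD//.
  by rewrite (le_trans (cos_norm_le1 _)).
rewrite normrM ger0_norm; last by lra.
rewrite mulrC ler_pM//; first by lra.
  exact: sin_om_le.
by rewrite ler_wpDr ?(ltW nj)// expr2; nra.
Qed.

Lemma Zcos_bound w t : 1 <= w -> `|Zcos w t| <= (1 + ominv) * wtail.
Proof. by move=> w1; apply: Lser_le; exact: Zcos_dominated. Qed.

Lemma Zcos0 w : Zcos w 0 = Fres (w ^+ 2).
Proof.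
by apply: eq_Lser => j; rewrite mulr0 cos0 sin0 mul0r mulr0 addr0 mul1r.
Qed.

Lemma is_derive_Zcos (w t : R) : 1 <= w ->
  is_derive t 1 (Zcos w) (w * Zcos w t - Kcos t).
Proof.
move=> w1; have o1 := ominv_ge1.
pose g1 j (t : R) := (- (om j * sin (om j * t)) + w * cos (om j * t)) / (w ^+ 2 + nu j).
pose g2 j (t : R) := (- (om j * (om j * cos (om j * t))) +
  w * - (om j * sin (om j * t))) / (w ^+ 2 + nu j).
have B0 : 0 <= 1 + ominv by lra.
have -> : w * Zcos w t - Kcos t = Lser (g1^~ t).
  rewrite /Zcos /Kcos -(LserZ w (Zcos_dominated t w1)).
  rewrite -(@LserB _ _ _ (w * (1 + ominv)) ominv).
  - apply: eq_Lser => j; rewrite /g1 nu_om; field; rewrite om_n0/= -nu_om gt_eqF//.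
    by rewrite (lt_le_trans _ (wnu_ge j w1)).
  - move=> j; rewrite normrM ger0_norm; last by lra.
    by rewrite -mulrA ler_wpM2l ?Zcos_dominated//; lra.
  - by apply: le1_dominated => [|j]; [lra|exact: sin_om_le].
have wp j : 0 < w ^+ 2 + nu j by rewrite (lt_le_trans _ (wnu_ge j w1)).
apply: (@Lser_derive _ (fun j t => (cos (om j * t) + w * (sin (om j * t) / om j)) /
  (w ^+ 2 + nu j)) g1 g2 _ 1 (1 + ominv)) => //.
- move=> j x _; have := is_derive_sinM (om j) x; have := is_derive_cosM (om j) x => h1 h2.
  rewrite /g1; apply: is_derive_eq; rewrite /GRing.scale/=.
  by field; rewrite om_n0 gt_eqF.
- move=> j x _; have := is_derive_sinM (om j) x; have := is_derive_cosM (om j) x => h1 h2.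
  rewrite /g1 /g2; apply: is_derive_eq; rewrite /GRing.scale/=.
  by field; rewrite gt_eqF.
- by move=> x _; exact: Zcos_dominated.
- move=> x _; apply: le1_dominated => // j.
  rewrite /g1 normrM normfV [`|_ + nu j|]gtr0_norm// ler_pdivrMr//.
  have s1 := sin_norm_le1 (om j * x); have c1 := cos_norm_le1 (om j * x).
  move: (sin (om j * x)) (cos (om j * x)) s1 c1 => s' c' s1 c1.
  have := om_gt0 j; rewrite nu_om; move: (om j) => o o0.
  rewrite (le_trans (ler_normD _ _))// normrN !normrM (gtr0_norm o0).
  rewrite (ger0_norm (_ : 0 <= w)); last by lra.
  have := normr_ge0 s'; have := normr_ge0 c'.
  move: (`|s'|) (`|c'|) s1 c1 => s c s1 c1 c0 s0.
  have : o * s + w * c <= o + w by nra.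
  have ww : 1 * w <= w ^+ 2 by rewrite expr2 ler_wpM2r//; lra.
  have os := sqr_ge0 (o - 1 / 2).
  have : o + w <= 2 * (w ^+ 2 + o ^+ 2) by nra.
  have : 0 <= w ^+ 2 + o ^+ 2 by nra.
  nra.
- move=> x _; apply: le1_dominated => // j.
  rewrite /g2 normrM normfV [`|_ + nu j|]gtr0_norm// ler_pdivrMr//.
  have s1 := sin_norm_le1 (om j * x); have c1 := cos_norm_le1 (om j * x).
  move: (sin (om j * x)) (cos (om j * x)) s1 c1 => s' c' s1 c1.
  have := om_gt0 j; rewrite nu_om; move: (om j) => o o0.
  rewrite (le_trans (ler_normD _ _))// mulrN !normrN !normrM (gtr0_norm o0).
  rewrite (ger0_norm (_ : 0 <= w)); last by lra.
  have := normr_ge0 s'; have := normr_ge0 c'.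
  move: (`|s'|) (`|c'|) s1 c1 => s c s1 c1 c0 s0.
  have : o * (o * c) <= o * o by nra.
  have w0 : 0 <= w by lra.
  have : w * (o * s) <= w * o by rewrite ler_wpM2l// ler_piMr// ltW.
  have wo := sqr_ge0 (w - o); have o2 := sqr_ge0 o.
  have : w * o <= w ^+ 2 + o ^+ 2 by nra.
  have : 0 <= w ^+ 2 by nra.
  nra.
Qed.

Definition Thcos (t : R) : R := Lser (fun j => (1 - cos (om j * t)) / nu j).

Lemma nu_inv_le j : (nu j)^-1 <= ominv ^+ 2 :> R.
Proof.
rewrite nu_om -exprVn lerXn2r ?nnegrE ?invr_ge0 ?om_inv_le ?(ltW (om_gt0 j))//.
by rewrite (le_trans _ ominv_ge1).
Qed.

Lemma is_derive_Thcos (t : R) : is_derive t 1 Thcos (Kcos t).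
Proof.
have o1 := ominv_ge1; have o2 : 1 <= ominv ^+ 2 by rewrite exprn_ege1.
have oo : ominv <= ominv ^+ 2 by rewrite -[leLHS]expr1 ler_weXn2l.
apply: (@Lser_derive _ (fun j t => (1 - cos (om j * t)) / nu j)
  (fun j t => sin (om j * t) / om j) (fun j t => cos (om j * t)) _ 1 (2 * ominv ^+ 2)) => //.
- move=> j x _; have := is_derive_cosM (om j) x => h.
  apply: is_derive_eq; rewrite /GRing.scale/= nu_om.
  by field.
- move=> j x _; have := is_derive_sinM (om j) x => h.
  by apply: is_derive_eq; rewrite /GRing.scale/=; field.
- move=> x _; apply: le1_dominated => [|j]; first by lra.
  rewrite normrM ler_pM//.
    rewrite (le_trans (ler_normB _ _))// normr1.
    by have := cos_norm_le1 (om j * x); lra.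
  by rewrite normfV gtr0_norm ?nu_gt0 ?nu_inv_le.
- move=> x _; apply: le1_dominated => [|j]; first by lra.
  by rewrite (le_trans (sin_om_le _ _))//; lra.
- move=> x _; apply: le1_dominated => [|j]; first by lra.
  by rewrite (le_trans (cos_norm_le1 _))//; lra.
Qed.

Lemma Theta_Kcos (t : R) : 0 <= t -> Theta (fun t => (Kcos t)%:C) t = (Thcos t)%:C.
Proof.
move=> t0; apply: Theta_realE => //; first exact: continuous_Kcos.
- by apply: derivable_continuous => x; exact: is_derive_Thcos.
- rewrite /Thcos (@eq_Lser _ _ (fun j => 0 * 0)) => [|j].
    by rewrite (@LserZ _ _ 0) ?mul0r// => j; rewrite normr0 mul0r.
  by rewrite mulr0 cos0 subrr mul0r mulr0.
- by move=> x _; exact: is_derive_Thcos.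
Qed.

(** Keeps the half-integers away from the integer zeros (k + 1)^2 of F(l^2) and (k + 1)^4 of F. *)
Lemma half_int_dist (a b : nat) : 1 / 2 <= `|a%:R + 1 / 2 - b%:R : R|.
Proof.
rewrite ler_normr; have [ab|ba] := ltnP a b.
  have : a.+1%:R <= b%:R :> R by rewrite ler_nat.
  by rewrite -natr1 => h; apply/orP; right; lra.
have : b%:R <= a%:R :> R by rewrite ler_nat.
by move=> h; apply/orP; left; lra.
Qed.

Lemma exp_bounded_kernel_Kcos : exp_bounded_kernel (fun t => (Kcos t)%:C).
Proof.
have o1 := ominv_ge1.
have wt0 : 0 < wtail :> R by rewrite mulr_gt0// exprn_gt0// ltr0n.
have w1 n : 1 <= n.+1%:R + 1 / 2 :> R by rewrite ler_wpDr ?divr_ge0// ler1n.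
apply: (@exp_bounded_kernel_of_resolvent ((1 + ominv) * wtail) _
  (fun n => Zcos (n.+1%:R + 1 / 2))).
- by rewrite mulr_gt0//; lra.
- exact: continuous_Kcos.
- move=> n; apply: derivable_continuous => t; exact: (is_derive_Zcos t (w1 n)).
- by move=> t; rewrite (le_trans (Kcos_bound t))// ler_wpM2r ?(ltW wt0)//; lra.
- by move=> n t _; exact: Zcos_bound.
- by move=> n t _; exact: (is_derive_Zcos t (w1 n)).
- move=> e e0; have [c c0 ce] := Fres_lower_bound e0.
  exists c => // n; rewrite Zcos0; apply: ce => // k.
  (* In the difference of squares, one factor is at least 1/2 by [half_int_dist] and the other at
     least 1. *)
  rewrite (_ : k.+1%:R ^+ 4 = (k.+1%:R ^+ 2) ^+ 2); last by rewrite -exprM.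
  rewrite subr_sqr normrM -[leLHS]mulr1 ler_pM//.
    by rewrite -natrX half_int_dist.
  have := w1 n; set v := _ + 1 / 2 => v1.
  have kk : 0 <= k.+1%:R ^+ 2 :> R by exact: sqr_ge0.
  by rewrite ger0_norm; lra.
Qed.
End real_kernels.

(** * The kernel of the semigroup *)

Section exponential_kernel.
Context {R : realType}.
Local Notation mu := (@lebesgue_measure R).

(** Without the truncation the terms would not be bounded in j for t < 0; with it they stay in
    [0, 1] and are Lipschitz on all of R. *)
Definition expo j (t : R) : R := expR (- (nu j * Num.max t 0)).

Lemma expo_ge0 j t : 0 <= expo j t. Proof. exact: expR_ge0. Qed.

Lemma expo_le1 j t : expo j t <= 1.
Proof. by rewrite expR_le1 oppr_le0 mulr_ge0 ?(ltW (nu_gt0 _))// le_max lexx orbT. Qed.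

Lemma expo_norm_le1 j t : `|expo j t| <= 1.
Proof. by rewrite ger0_norm ?expo_le1 ?expo_ge0. Qed.

Lemma expo_lipschitz j x y : `|expo j x - expo j y| <= nu j * `|x - y|.
Proof.
have nj := nu_gt0 (R := R) j.
wlog xy : x y / x <= y => [wl|].
  by have [/wl//|/ltW/wl] := leP x y; rewrite distrC [`|y - x|]distrC.
have m : Num.max x 0 <= Num.max y 0 by rewrite ge_max le_max xy/= le_max lexx orbT.
have d : Num.max y 0 - Num.max x 0 <= y - x.
  by rewrite /Num.max; case: ltP => ?; case: ltP => ?; lra.
rewrite [`|x - y|]distrC [`|y - x|]ger0_norm ?subr_ge0//.
rewrite ger0_norm; last by rewrite subr_ge0 ler_expR lerN2 ler_wpM2l// ltW.
apply: (@le_trans _ _ (nu j * (Num.max y 0 - Num.max x 0))); last first.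
  by rewrite ler_wpM2l// ltW.
rewrite /expo; set a := Num.max x 0; set b := Num.max y 0 in m d *.
have a0 : 0 <= a by rewrite /a le_max lexx orbT.
have -> : - (nu j * b) = - (nu j * a) + - (nu j * (b - a)) by ring.
rewrite expRD -[X in X - _]mulr1 -mulrBr.
have e1 : expR (- (nu j * a)) <= 1 by rewrite expR_le1 oppr_le0 mulr_ge0// ltW.
have := expR_ge1Dx (- (nu j * (b - a))).
have := expR_ge0 (- (nu j * a)).
have : 0 <= nu j * (b - a) by rewrite mulr_ge0 ?subr_ge0// ltW.
have : expR (- (nu j * (b - a))) <= 1.
  by rewrite expR_le1 oppr_le0 mulr_ge0 ?subr_ge0// ltW.
move: (expR _) (expR _) e1 => e f; nra.
Qed.

(** Within distance t of t the truncation in [expo] is inactive and [Lser_derive] applies with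
    radius t. *)
Lemma is_derive_Lser_expo (a : nat -> R) (B t : R) : 0 < t ->
  (forall j, `|a j| <= B) ->
  is_derive t 1 (fun t => Lser (fun j => a j * expo j t))
    (Lser (fun j => - (nu j * (a j * expo j t)))).
Proof.
move=> t0 aB; have B0 : 0 <= B by rewrite (le_trans _ (aB 0%N)).
have xpos x : `|x - t| < t -> 0 < x by rewrite ltr_norml => /andP[]; lra.
have e1 j x : `|x - t| < t -> `|expR (- (nu j * x))| <= 1.
  move=> /xpos x0; rewrite ger0_norm ?expR_ge0// expR_le1 oppr_le0.
  by rewrite mulr_ge0 ?(ltW (nu_gt0 _)) ?ltW.
have bd (c : R) j x : `|x - t| < t -> 0 <= c -> c <= (1 + nu j) ^+ 2 ->
    `|c * (a j * expR (- (nu j * x)))| <= B * (1 + nu j) ^+ 2.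
  move=> xt c0 cn; rewrite normrM ger0_norm// mulrC ler_pM// normrM -[leRHS]mulr1.
  by rewrite ler_pM// e1.
have n0 j := ltW (nu_gt0 (R := R) j).
have -> : Lser (fun j => - (nu j * (a j * expo j t))) =
    Lser (fun j => - (nu j * (a j * expR (- (nu j * t))))).
  by apply: eq_Lser => j; rewrite /expo max_l// ltW.
apply: (@near_eq_is_derive _ _ _ (fun t => Lser (fun j => a j * expR (- (nu j * t))))).
  near=> x; have x0 : 0 < x by near: x; exact: lt_nbhsr.
  by apply: eq_Lser => j; rewrite /expo max_l// ltW.
apply: (@Lser_derive _ (fun j t => a j * expR (- (nu j * t)))
  (fun j t => - (nu j * (a j * expR (- (nu j * t)))))
  (fun j t => nu j ^+ 2 * (a j * expR (- (nu j * t)))) _ t B) => //.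
- move=> j x _; have h := is_derive_expNM (nu j) x.
  by apply: is_derive_eq; rewrite /GRing.scale/=; ring.
- move=> j x _; have h := is_derive_expNM (nu j) x.
  by apply: is_derive_eq; rewrite /GRing.scale/=; ring.
- move=> x xt j; have := bd 1 j x xt; rewrite mul1r; apply => //.
  by rewrite exprn_ege1// lerDl.
- move=> x xt j; rewrite normrN; apply: bd => //.
  by rewrite (le_trans _ (nu1_sqr_ge j))// lerDr.
- move=> x xt j; apply: bd => //; first exact: sqr_ge0.
  by rewrite lerXn2r ?nnegrE ?addr_ge0// lerDr.
Unshelve. all: by end_near. Qed.

Lemma dominated_expo (a : nat -> R) (B t : R) : (forall j, `|a j| <= B) ->
  dominated (fun j => a j * expo j t) B.
Proof.
move=> aB; apply: le1_dominated => [|j]; first by rewrite (le_trans _ (aB 0%N)).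
by rewrite normrM -[leRHS]mulr1 ler_pM// expo_norm_le1.
Qed.

Lemma continuous_Lser_expo (a : nat -> R) (B : R) : (forall j, `|a j| <= B) ->
  continuous (fun t => Lser (fun j => a j * expo j t)).
Proof.
move=> aB; have B0 : 0 <= B by rewrite (le_trans _ (aB 0%N)).
apply: (@Lser_continuous _ (fun j t => a j * expo j t) B B).
  by move=> x; exact: dominated_expo.
move=> j x y; rewrite -mulrBr normrM -mulrA ler_pM//.
rewrite (le_trans (expo_lipschitz j x y))// ler_wpM2r//.
by rewrite (le_trans _ (nu1_sqr_ge j))// lerDr.
Qed.

Definition Kexp (t : R) : R := Lser (fun j => 1 * expo j t).
(** For t >= 0, the integral of exp (- w s) [Kexp] (t + s) over s >= 0, computed term by term. *)
Definition Zexp (w t : R) : R := Lser (fun j => (w + nu j)^-1 * expo j t).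
Definition Thexp (t : R) : R := Lser (fun j => (nu j)^-1) - Lser (fun j => (nu j)^-1 * expo j t).

Let one_le (j : nat) : `|1 : R| <= 1. Proof. by rewrite normr1. Qed.

Lemma continuous_Kexp : continuous Kexp.
Proof. exact: (continuous_Lser_expo one_le). Qed.

Lemma Kexp_bound t : `|Kexp t| <= wtail.
Proof. by rewrite -[leRHS]mul1r; apply: Lser_le; exact: dominated_expo. Qed.

Let wnu_inv (w : R) j : 1 <= w -> `|(w + nu j)^-1| <= 1.
Proof.
move=> w1; have nj := nu_gt0 (R := R) j.
by rewrite normfV gtr0_norm ?invf_le1//; lra.
Qed.

Lemma Zexp_bound w t : 1 <= w -> `|Zexp w t| <= wtail.
Proof.
move=> w1; rewrite -[leRHS]mul1r; apply: Lser_le; apply: dominated_expo => j.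
exact: wnu_inv.
Qed.

Lemma continuous_Zexp w : 1 <= w -> continuous (Zexp w).
Proof. by move=> w1; apply: (@continuous_Lser_expo _ 1) => j; exact: wnu_inv. Qed.

(** The argument is written as a square to match [Fres_lower_bound]. *)
Lemma Zexp0 w : 0 <= w -> Zexp w 0 = Fres (Num.sqrt w ^+ 2).
Proof.
move=> w0; rewrite sqr_sqrtr//; apply: eq_Lser => j.
by rewrite /expo max_l// mulr0 oppr0 expR0 mulr1.
Qed.

Lemma is_derive_Zexp (w t : R) : 1 <= w -> 0 < t ->
  is_derive t 1 (Zexp w) (w * Zexp w t - Kexp t).
Proof.
move=> w1 t0; have := is_derive_Lser_expo t0 (fun j => wnu_inv j w1).
rewrite (_ : Lser _ = w * Zexp w t - Kexp t)//.
have dZ : dominated (fun j => (w + nu j)^-1 * expo j t) 1.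
  by apply: dominated_expo => j; exact: wnu_inv.
rewrite /Zexp /Kexp -(LserZ w dZ) -(@LserB _ _ _ w 1).
- by apply: eq_Lser => j; field; rewrite gt_eqF// ltr_wpDl ?nu_gt0//; lra.
- move=> j; rewrite normrM ger0_norm; last by lra.
  rewrite -[w in leRHS]mulr1 -mulrA ler_wpM2l ?dZ//; lra.
- exact: dominated_expo.
Qed.

Let nu_inv_norm j : `|(nu j)^-1 : R| <= ominv ^+ 2.
Proof. by rewrite normfV gtr0_norm ?nu_gt0 ?nu_inv_le. Qed.

Lemma continuous_Thexp : continuous Thexp.
Proof.
move=> t; apply: cvgB; first exact: cvg_cst.
exact: (continuous_Lser_expo nu_inv_norm).
Qed.

Lemma is_derive_Thexp (t : R) : 0 < t -> is_derive t 1 Thexp (Kexp t).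
Proof.
move=> t0; have h := is_derive_Lser_expo t0 nu_inv_norm.
rewrite /Thexp; apply: is_derive_eq.
rewrite add0r mul1r /Kexp -mulN1r -(@LserZ _ _ 1).
  apply: eq_Lser => j; rewrite mulrA divff ?gt_eqF ?nu_gt0//.
  by ring.
move=> j; rewrite normrN mulrA divff ?gt_eqF ?nu_gt0//.
exact: (@dominated_expo (fun=> 1)).
Qed.

Lemma Theta_Kexp (t : R) : 0 <= t -> Theta (fun t => (Kexp t)%:C) t = (Thexp t)%:C.
Proof.
move=> t0; apply: Theta_realE => //.
- exact: continuous_Kexp.
- exact: continuous_Thexp.
- rewrite /Thexp; apply/eqP; rewrite subr_eq0; apply/eqP; apply: eq_Lser => j.
  by rewrite /expo max_l// mulr0 oppr0 expR0 mulr1.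
- exact: is_derive_Thexp.
Qed.

Lemma exp_bounded_kernel_Kexp : exp_bounded_kernel (fun t => (Kexp t)%:C).
Proof.
have wt0 : 0 < wtail :> R by rewrite mulr_gt0// exprn_gt0// ltr0n.
have w1 n : 1 <= n.+1%:R + 1 / 2 :> R by rewrite ler_wpDr ?divr_ge0// ler1n.
apply: (@exp_bounded_kernel_of_resolvent _ wtail _
  (fun n => Zexp (n.+1%:R + 1 / 2))) => //.
- exact: continuous_Kexp.
- by move=> n; exact: continuous_Zexp.
- exact: Kexp_bound.
- by move=> n t _; exact: Zexp_bound.
- by move=> n t t0; exact: is_derive_Zexp.
- move=> e e0; have [c c0 ce] := Fres_lower_bound e0.
  exists c => // n; have := w1 n; set w := _ + _ => w1n.
  have w0 : 0 <= w by lra.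
  rewrite Zexp0//; apply: le_trans (ce (Num.sqrt w) _ _).
  (* The lower bound holds with sqrt w in the exponent, and sqrt w <= w because w >= 1. *)
  - rewrite ler_wpM2l ?(ltW c0)// ler_expR lerN2 ler_wpM2l ?(ltW e0)//.
    rewrite -{2}[w]sqr_sqrtr// expr2 ler_peMl ?sqrtr_ge0//.
    by rewrite -[leLHS]sqrtr1 ler_sqrt.
  - by rewrite -[leLHS]sqrtr1 ler_sqrt.
  - by move=> k; rewrite sqr_sqrtr// -natrX half_int_dist.
Qed.
End exponential_kernel.

(** * Multipliers of the convoluted families *)

Section Riemann_sums.
Context {R : realType}.

Lemma MVT_mid (g g' : R -> R) (a b : R) : a <= b ->
  (forall x : R, a <= x <= b -> is_derive x 1 g (g' x)) ->
  exists2 c, a <= c <= b & g b - g a = g' c * (b - a).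
Proof.
move=> ab dg; have [| |c] := @MVT_segment R g g' a b ab.
- by move=> x /subset_itv_oo_cc; rewrite in_itv/=; exact: dg.
- apply: derivable_within_continuous => x; rewrite in_itv/= => /dg [].
  by [].
- by rewrite in_itv/= => cab E; exists c.
Qed.

Lemma lipschitz_of_derive (g g' : R -> R) (a b B : R) :
  (forall x : R, a <= x <= b -> is_derive x 1 g (g' x)) ->
  (forall x, a <= x <= b -> `|g' x| <= B) ->
  forall x y, a <= x <= b -> a <= y <= b -> `|g x - g y| <= B * `|x - y|.
Proof.
move=> dg gB x y; wlog yx : x y / y <= x => [wl|] xab yab.
  have [yx|/ltW xy] := leP y x; first exact: wl.
  by rewrite distrC [`|x - y|]distrC wl.
have /andP[ax xb] := xab; have /andP[ay yb] := yab.
have [|c /andP[yc cx] ->] := @MVT_mid g g' y x yx.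
  move=> u /andP[yu ux]; apply: dg.
  by rewrite (le_trans ay yu) (le_trans ux xb).
by rewrite normrM ler_wpM2r// gB// (le_trans ay yc) (le_trans cx xb).
Qed.

Lemma partition_in (t d : R) (m : nat) (p xi : nat -> R) : p 0%N = 0 -> p m = t ->
  (forall i, (i < m)%N -> [/\ p i <= xi i, xi i <= p i.+1 & p i.+1 - p i < d]) ->
  (forall i, (i <= m)%N -> 0 <= p i <= t) /\ (forall i, (i < m)%N -> 0 <= xi i <= t).
Proof.
move=> p0 pm pxi.
have pmono i j : (i <= j <= m)%N -> p i <= p j.
  move=> /andP[]; elim: j => [|j ih]; first by rewrite leqn0 => /eqP ->.
  rewrite leq_eqVlt => /predU1P[->//|ij] jm.
  apply: (le_trans (ih ij (ltnW jm))).
  by have [h1 h2 _] := pxi _ jm; exact: le_trans h2.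
have pin i : (i <= m)%N -> 0 <= p i <= t.
  by move=> im; rewrite -p0 -pm; apply/andP; split; apply: pmono; rewrite ?im ?leqnn.
split=> // i im; have [h1 h2 _] := pxi _ im.
have /andP[i0 _] := pin _ (ltnW im); have /andP[_ it] := pin _ im.
by rewrite (le_trans i0 h1) (le_trans h2 it).
Qed.

(** The error is explicit and linear in the mesh, so that one mesh serves all the poles and all the
    modes. *)
Lemma Riemann_sum_error (g G : R -> R) (t B d : R) (m : nat) (p xi : nat -> R) :
  0 <= t -> p 0%N = 0 -> p m = t ->
  (forall i, (i < m)%N -> [/\ p i <= xi i, xi i <= p i.+1 & p i.+1 - p i < d]) ->
  (forall x : R, 0 <= x <= t -> is_derive x 1 G (g x)) ->
  (forall x y, 0 <= x <= t -> 0 <= y <= t -> `|g x - g y| <= B * `|x - y|) ->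
  0 <= B ->
  `|\sum_(i < m) (p i.+1 - p i) * g (xi i) - (G t - G 0)| <= B * d * t.
Proof.
move=> t0 p0 pm pxi dG gB B0.
have [pin _] := partition_in p0 pm pxi.
have -> : G t - G 0 = \sum_(i < m) (G (p i.+1) - G (p i)).
  by rewrite -(big_mkord xpredT (fun i => G (p i.+1) - G (p i))) telescope_sumr// pm p0.
have -> : t = \sum_(i < m) (p i.+1 - p i).
  by rewrite -(big_mkord xpredT (fun i => p i.+1 - p i)) telescope_sumr// pm p0 subr0.
rewrite -sumrB mulr_sumr (le_trans (ler_norm_sum _ _ _))//.
apply: ler_sum => i _; have [h1 h2 h3] := pxi _ (ltn_ord i).
have /andP[pi0 pit] := pin i (ltnW (ltn_ord i)).
have /andP[qi0 qit] := pin i.+1 (ltn_ord i).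
have pq := le_trans h1 h2.
have [|c /andP[c1 c2] ->] := @MVT_mid G g _ _ pq.
  by move=> x /andP[x1 x2]; apply: dG; rewrite (le_trans pi0 x1) (le_trans x2 qit).
have d0 : 0 <= p i.+1 - p i by rewrite subr_ge0.
rewrite [g c * _]mulrC -mulrBr normrM ger0_norm// mulrC ler_wpM2r//.
apply: (le_trans (gB _ _ _ _)).
- by rewrite (le_trans pi0 h1) (le_trans h2 qit).
- by rewrite (le_trans pi0 c1) (le_trans c2 qit).
rewrite ler_wpM2l// ler_norml; apply/andP; split; lra.
Qed.

Lemma Lser0 : Lser (fun _ : nat => 0 : R) = 0.
Proof.
rewrite (@eq_Lser _ _ (fun j => 0 * 0)) => [|j]; last by rewrite mulr0.
by rewrite (@LserZ _ _ 0) ?mul0r// => j; rewrite normr0 mul0r.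
Qed.

Lemma Lser_sum m (g : 'I_m -> nat -> R) (H : 'I_m -> R) :
  (forall i, dominated (g i) (H i)) ->
  dominated (fun j => \sum_(i < m) g i j) (\sum_(i < m) H i) /\
  Lser (fun j => \sum_(i < m) g i j) = \sum_(i < m) Lser (g i).
Proof.
move=> gH; split.
  move=> j; rewrite (le_trans (ler_norm_sum _ _ _))// mulr_suml.
  by apply: ler_sum => i _; exact: gH.
elim: m g H gH => [|m ih] g H gH.
  rewrite big_ord0 (@eq_Lser _ _ (fun=> 0)) ?Lser0// => j.
  by rewrite big_ord0.
rewrite (@eq_Lser _ _ (fun j => \sum_(i < m) g (widen_ord (leqnSn m) i) j + g ord_max j));
  last by move=> j; rewrite big_ord_recr.
rewrite (@LserD _ _ _ (\sum_(i < m) H (widen_ord (leqnSn m) i)) (H ord_max))//.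
  by rewrite (ih _ (fun i => H (widen_ord (leqnSn m) i)))// big_ord_recr.
move=> j; rewrite (le_trans (ler_norm_sum _ _ _))// mulr_suml.
by apply: ler_sum => i _; exact: gH.
Qed.

Lemma Lser_Riemann (g G : nat -> R -> R) (t B H d : R) (m : nat) (p xi : nat -> R) :
  0 <= t -> p 0%N = 0 -> p m = t ->
  (forall i, (i < m)%N -> [/\ p i <= xi i, xi i <= p i.+1 & p i.+1 - p i < d]) ->
  (forall j (x : R), 0 <= x <= t -> is_derive x 1 (G j) (g j x)) ->
  (forall j x y, 0 <= x <= t -> 0 <= y <= t ->
     `|g j x - g j y| <= B * (1 + nu j) ^+ 2 * `|x - y|) -> 0 <= B ->
  (forall x, 0 <= x <= t -> dominated (g^~ x) H) ->
  dominated (fun j => G j t - G j 0) H ->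
  `|\sum_(i < m) (p i.+1 - p i) * Lser (g^~ (xi i)) - Lser (fun j => G j t - G j 0)|
  <= B * d * t * wtail.
Proof.
move=> t0 p0 pm pxi dG gB B0 gH GH.
have [_ xin] := partition_in p0 pm pxi.
pose gi (i : 'I_m) j := (p i.+1 - p i) * g j (xi i).
have giH i : dominated (gi i) (`|p i.+1 - p i| * H).
  by move=> j; rewrite normrM -mulrA ler_wpM2l// gH// xin.
have [dsum sumE] := Lser_sum giH.
have -> : \sum_(i < m) (p i.+1 - p i) * Lser (g^~ (xi i)) = \sum_(i < m) Lser (gi i).
  by apply: eq_bigr => i _; rewrite (LserZ _ (gH (xi i) (xin _ (ltn_ord i)))).
rewrite -sumE -(LserB dsum GH); apply: Lser_le => j.
have := @Riemann_sum_error (g j) (G j) t (B * (1 + nu j) ^+ 2) d m p xi t0 p0 pm pxi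
  (dG j) (gB j).
rewrite mulr_ge0 ?exprn_ge0 ?addr_ge0 ?(ltW (nu_gt0 _))// => /(_ isT).
by rewrite (_ : B * (1 + nu j) ^+ 2 * d * t = B * d * t * (1 + nu j) ^+ 2)//; ring.
Qed.
End Riemann_sums.

(** * Multipliers of the convoluted cosine function *)

Section multipliers.
Context {R : realType}.
Implicit Types (lam t : R).

Let lamnu_gt0 lam j : 0 < lam -> 0 < lam + nu j.
Proof. by move=> l0; rewrite addr_gt0 ?nu_gt0. Qed.

Let nu_ge0 j : 0 <= nu j :> R. Proof. exact/ltW/nu_gt0. Qed.

Lemma div_resolvent_le lam (a c : R) j : 0 < lam -> `|a| <= c ->
  `|a / (lam + nu j)| <= lam^-1 * c.
Proof.
move=> l0 ac; have ln := lamnu_gt0 j l0.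
rewrite normrM normfV (gtr0_norm ln) mulrC ler_pM ?invr_ge0 ?(ltW ln)//.
by rewrite lef_pV2 ?posrE// lerDl.
Qed.

Lemma dominated_resolvent lam (a : nat -> R) (B : R) : 0 < lam ->
  dominated a B -> dominated (fun j => a j / (lam + nu j)) (lam^-1 * B).
Proof. by move=> l0 aB j; rewrite -mulrA; exact: div_resolvent_le. Qed.

Lemma dominatedB (f g : nat -> R) (A B : R) : dominated f A -> dominated g B ->
  dominated (fun j => f j - g j) (A + B).
Proof.
by move=> fA gB j; rewrite (le_trans (ler_normB _ _))// [leRHS]mulrDl lerD.
Qed.

(** When [Fres lam] = 0 and t >= 0, the convolution of [Kcos] with cosh (sqrt lam t): each pole
    gives (cosh (sqrt lam t) - cos (om_j t)) / (lam + nu_j). *)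
Definition Cmult lam t : R := Lser (fun j => - cos (om j * t) / (lam + nu j)).
(* The integral of (t - s) * Cmult lam s over s in [0, t] (see Cmult_Riemann). *)
Definition Cint lam t : R := Lser (fun j => (cos (om j * t) - 1) / nu j / (lam + nu j)).

Let ncos_dom t : dominated (fun j => - cos (om j * t)) 1.
Proof. by apply: le1_dominated => // j; rewrite normrN cos_norm_le1. Qed.

Lemma Cmult_bound lam t : 0 < lam -> `|Cmult lam t| <= lam^-1 * wtail.
Proof.
move=> l0; rewrite -[lam^-1]mulr1; apply: Lser_le.
by apply: dominated_resolvent => //; exact: ncos_dom.
Qed.

Let om_sqr_ge j : om j <= (1 + nu j) ^+ 2 :> R.
Proof. exact: le_trans (om_le j) (nu1_sqr_ge j). Qed.

Let cosom_lip j (x y : R) : `|cos (om j * x) - cos (om j * y)| <= om j * `|x - y|.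
Proof.
apply: (@lipschitz_of_derive _ (fun t => cos (om j * t))
  (fun t => - sin (om j * t) * om j) (Num.min x y) (Num.max x y)).
- by move=> u _; exact: is_derive_cosM.
- move=> u _; rewrite normrM normrN (ger0_norm (ltW (om_gt0 j))).
  by rewrite ler_piMl ?sin_norm_le1// ltW ?om_gt0.
- by rewrite ge_min le_max !lexx.
- by rewrite ge_min le_max !lexx !orbT.
Qed.

Lemma Cmult_lipschitz lam x y : 0 < lam ->
  `|Cmult lam x - Cmult lam y| <= lam^-1 * `|x - y| * wtail.
Proof.
move=> l0; have dc t := dominated_resolvent l0 (ncos_dom t).
apply: (Lser_lipschitz (g := fun j t => - cos (om j * t) / (lam + nu j)) (dc x) (dc y)) => j.
have -> : - cos (om j * x) / (lam + nu j) - - cos (om j * y) / (lam + nu j) =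
    - (cos (om j * x) - cos (om j * y)) / (lam + nu j) by ring.
rewrite -(mulrA lam^-1); apply: div_resolvent_le => //.
rewrite normrN (le_trans (cosom_lip j x y))// mulrC ler_wpM2l//.
Qed.

Let cos1_dom t : dominated (fun j => (cos (om j * t) - 1) / nu j) (2 * ominv ^+ 2).
Proof.
apply: le1_dominated => [|j]; first by rewrite mulr_ge0// sqr_ge0.
rewrite normrM ler_pM//; first by rewrite (le_trans (ler_normB _ _))// normr1 lerD// cos_norm_le1.
by rewrite normfV gtr0_norm ?nu_gt0 ?nu_inv_le.
Qed.

Lemma Cint_bound lam t : 0 < lam ->
  `|Cint lam t| <= lam^-1 * (2 * ominv ^+ 2) * wtail.
Proof.
move=> l0; apply: Lser_le.
by apply: dominated_resolvent => //; exact: cos1_dom.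
Qed.

(** Termwise the two sides differ by 1 / (lam + nu_j), and these terms sum to [Fres lam]. *)
Lemma Cint_eq lam t : 0 < lam -> Fres lam = 0 ->
  lam * Cint lam t = Cmult lam t - Thcos t.
Proof.
move=> l0 F0; have d1 := dominated_resolvent l0 (cos1_dom t).
have d2 := dominated_resolvent l0 (ncos_dom t).
have d3 := dominated_fres l0.
rewrite -(LserZ lam d1) /Cmult /Thcos.
have d4 : dominated (fun j => (1 - cos (om j * t)) / nu j) (2 * ominv ^+ 2).
  by move=> j; rewrite -opprB mulNr normrN; exact: cos1_dom.
rewrite -(LserB d2 d4) -[RHS]addr0 -[X in _ + X]F0.
have d5 : dominated (fun j => - cos (om j * t) / (lam + nu j) - (1 - cos (om j * t)) / nu j)
   (lam^-1 * 1 + 2 * ominv ^+ 2).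
  exact: dominatedB.
rewrite /Fres -(LserD d5 d3); apply: eq_Lser => j.
by field; rewrite !gt_eqF ?nu_gt0 ?lamnu_gt0.
Qed.

Lemma Cmult_Riemann lam t (d : R) m (p xi : nat -> R) : 0 < lam -> 0 <= t ->
  p 0%N = 0 -> p m = t ->
  (forall i, (i < m)%N -> [/\ p i <= xi i, xi i <= p i.+1 & p i.+1 - p i < d]) ->
  `|\sum_(i < m) (p i.+1 - p i) * ((t - xi i) * Cmult lam (xi i)) - Cint lam t|
    <= lam^-1 * (1 + t) * d * t * wtail.
Proof.
move=> l0 t0 p0 pm pxi.
(* The minus sign of [Cmult] goes into s - t; G is the primitive of g found by parts. *)
pose g j s := (s - t) * cos (om j * s) / (lam + nu j).
pose G j s := ((s - t) * sin (om j * s) / om j + cos (om j * s) / om j ^+ 2) / (lam + nu j).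
have o0 j : om j != 0 :> R by rewrite gt_eqF ?om_gt0.
have ln j : lam + nu j != 0 by rewrite gt_eqF ?lamnu_gt0.
have gdom s : 0 <= s <= t -> dominated (g^~ s) (lam^-1 * (1 + t)).
  move=> /andP[s0 st]; apply: dominated_resolvent => //.
  apply: le1_dominated => [|j]; first by rewrite addr_ge0.
  rewrite normrM -[leRHS]mulr1 ler_pM ?cos_norm_le1// ler_norml.
  by apply/andP; split; lra.
have GE : (fun j => G j t - G j 0) =1 (fun j => (cos (om j * t) - 1) / nu j / (lam + nu j)).
  by move=> j; rewrite /G mulr0 sin0 cos0 nu_om; field; rewrite o0 -nu_om ln.
rewrite /Cint -(eq_Lser GE).
have -> : \sum_(i < m) (p i.+1 - p i) * ((t - xi i) * Cmult lam (xi i)) =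
    \sum_(i < m) (p i.+1 - p i) * Lser (g^~ (xi i)).
  apply: eq_bigr => i _; congr (_ * _).
  rewrite -(LserZ _ (dominated_resolvent l0 (ncos_dom (xi i)))).
  by apply: eq_Lser => j; rewrite /g; ring.
have lt0 : 0 <= lam^-1 * (1 + t) by rewrite mulr_ge0 ?invr_ge0 ?addr_ge0// ltW.
apply: (@Lser_Riemann _ g G t (lam^-1 * (1 + t))
   (lam^-1 * (1 + t) + lam^-1 * (2 * ominv ^+ 2)) d m p xi) => //.
- move=> j x _; rewrite /G /g.
  have h1 := is_derive_cosM (om j) x; have h2 := is_derive_sinM (om j) x.
  apply: is_derive_eq; rewrite /GRing.scale/=.
  by field; rewrite o0 ln.
- move=> j; pose g' s := (cos (om j * s) - (s - t) * (sin (om j * s) * om j)) / (lam + nu j).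
  apply: (@lipschitz_of_derive _ (g j) g').
  + move=> x _; rewrite /g /g'; have h1 := is_derive_cosM (om j) x.
    by apply: is_derive_eq; rewrite /GRing.scale/=; field; rewrite ln.
  + move=> x /andP[x0 xt]; rewrite -mulrA; apply: div_resolvent_le => //.
    rewrite (le_trans (ler_normB _ _))// [leRHS]mulrDl lerD//.
      by rewrite mul1r (le_trans (cos_norm_le1 _))// (le_trans (nu1_ge1 j)) ?nu1_sqr_ge.
    rewrite normrM ler_pM//; first by rewrite ler_norml; apply/andP; split; lra.
    rewrite normrM (le_trans (ler_piMl _ (sin_norm_le1 _)))//.
    by rewrite (ger0_norm (ltW (om_gt0 j))).
- move=> s /gdom h j; rewrite [leRHS]mulrDl (le_trans (h j))// lerDl.
  by rewrite mulr_ge0 ?sqr_ge0// mulr_ge0 ?invr_ge0 ?(ltW l0)// mulr_ge0// sqr_ge0.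
- move=> j; have -> := GE j; have h := dominated_resolvent l0 (cos1_dom t).
  by rewrite [leRHS]mulrDl (le_trans (h j))// lerDr mulr_ge0// sqr_ge0.
Qed.

End multipliers.

(** * Multipliers of the convoluted semigroup on the right half-plane *)

Section semigroup_multipliers.
Context {R : realType}.
Implicit Types (lam t : R).

Let lamnu_gt0 lam j : 0 < lam -> 0 < lam + nu j.
Proof. by move=> l0; rewrite addr_gt0 ?nu_gt0. Qed.

Let nu_ge0 j : 0 <= nu j :> R. Proof. exact/ltW/nu_gt0. Qed.

Definition Smr lam t : R := Lser (fun j => - expo j t / (lam + nu j)).
(* The integral of Smr lam over [0, t] (see Smr_Riemann). *)
Definition Sint lam t : R := Lser (fun j => (expo j t - 1) / nu j / (lam + nu j)).

Let nexpo_dom t : dominated (fun j => - expo j t) 1.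
Proof. by apply: le1_dominated => // j; rewrite normrN expo_norm_le1. Qed.

Let nu_sqr_ge j : nu j <= (1 + nu j) ^+ 2 :> R.
Proof. by rewrite (le_trans _ (nu1_sqr_ge j))// lerDr. Qed.

Let exp1_dom t : dominated (fun j => (expo j t - 1) / nu j) (2 * ominv ^+ 2).
Proof.
apply: le1_dominated => [|j]; first by rewrite mulr_ge0// sqr_ge0.
rewrite normrM ler_pM//; first by rewrite (le_trans (ler_normB _ _))// normr1 lerD// expo_norm_le1.
by rewrite normfV gtr0_norm ?nu_gt0 ?nu_inv_le.
Qed.

Lemma Sint_bound lam t : 0 < lam ->
  `|Sint lam t| <= lam^-1 * (2 * ominv ^+ 2) * wtail.
Proof.
move=> l0; apply: Lser_le.
by apply: dominated_resolvent => //; exact: exp1_dom.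
Qed.

Lemma Sint_eq lam t : 0 < lam -> Fres lam = 0 ->
  lam * Sint lam t = Smr lam t - Thexp t.
Proof.
move=> l0 F0; have d1 := dominated_resolvent l0 (exp1_dom t).
have d2 := dominated_resolvent l0 (nexpo_dom t).
have d3 := dominated_fres l0.
rewrite -(LserZ lam d1) /Smr /Thexp.
have dn : dominated (fun j => (nu j)^-1 : R) (ominv ^+ 2).
  apply: le1_dominated => [|j]; first exact: sqr_ge0.
  by rewrite normfV gtr0_norm ?nu_gt0 ?nu_inv_le.
have de : dominated (fun j => (nu j)^-1 * expo j t) (ominv ^+ 2).
  apply: dominated_expo => j.
  by rewrite normfV gtr0_norm ?nu_gt0 ?nu_inv_le.
rewrite -(LserB dn de) -(LserB d2 (dominatedB dn de)) -[RHS]addr0 -[X in _ + X]F0.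
rewrite /Fres -(LserD (dominatedB d2 (dominatedB dn de)) d3); apply: eq_Lser => j.
by field; rewrite !gt_eqF ?nu_gt0 ?lamnu_gt0.
Qed.

Lemma Smr_lipschitz lam x y : 0 < lam ->
  `|Smr lam x - Smr lam y| <= lam^-1 * `|x - y| * wtail.
Proof.
move=> l0; have dc t := dominated_resolvent l0 (nexpo_dom t).
apply: (Lser_lipschitz (g := fun j t => - expo j t / (lam + nu j)) (dc x) (dc y)) => j.
have -> : - expo j x / (lam + nu j) - - expo j y / (lam + nu j) =
    - (expo j x - expo j y) / (lam + nu j) by ring.
rewrite -(mulrA lam^-1); apply: div_resolvent_le => //.
by rewrite normrN (le_trans (expo_lipschitz j x y))// mulrC ler_wpM2l.
Qed.

Lemma Smr_Riemann lam t (d : R) m (p xi : nat -> R) : 0 < lam -> 0 <= t ->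
  p 0%N = 0 -> p m = t ->
  (forall i, (i < m)%N -> [/\ p i <= xi i, xi i <= p i.+1 & p i.+1 - p i < d]) ->
  `|\sum_(i < m) (p i.+1 - p i) * Smr lam (xi i) - Sint lam t|
    <= lam^-1 * d * t * wtail.
Proof.
move=> l0 t0 p0 pm pxi; have [_ xin] := partition_in p0 pm pxi.
(* [expo] has a corner at 0; the plain exponential agrees with it on [0, t] and is differentiable at
   0 too. *)
pose g j s := - expR (- (nu j * s)) / (lam + nu j).
pose G j s := expR (- (nu j * s)) / nu j / (lam + nu j).
have n0 j : nu j != 0 :> R by rewrite gt_eqF ?nu_gt0.
have ln j : lam + nu j != 0 by rewrite gt_eqF ?lamnu_gt0.
have expE j (s : R) : 0 <= s -> expo j s = expR (- (nu j * s)) by move=> s0; rewrite /expo max_l.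
have GE : (fun j => G j t - G j 0) =1 (fun j => (expo j t - 1) / nu j / (lam + nu j)).
  by move=> j; rewrite /G expE// mulr0 oppr0 expR0; field; rewrite n0 ln.
have gE s : 0 <= s -> (g^~ s) =1 (fun j => - expo j s / (lam + nu j)).
  by move=> s0 j; rewrite /g expE.
rewrite /Sint -(eq_Lser GE).
have -> : \sum_(i < m) (p i.+1 - p i) * Smr lam (xi i) =
    \sum_(i < m) (p i.+1 - p i) * Lser (g^~ (xi i)).
  apply: eq_bigr => i _; congr (_ * _).
  have /andP[x0 _] := xin _ (ltn_ord i).
  by rewrite (eq_Lser (gE _ x0)).
apply: (@Lser_Riemann _ g G t lam^-1 (lam^-1 * 1 + lam^-1 * (2 * ominv ^+ 2)) d m p xi) => //.
- move=> j x _; rewrite /G /g; have h := is_derive_expNM (nu j) x.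
  apply: is_derive_eq; rewrite /GRing.scale/=.
  by field; rewrite n0 ln.
- move=> j x y /andP[x0 _] /andP[y0 _].
  rewrite (gE x x0 j) (gE y y0 j).
  have -> : - expo j x / (lam + nu j) - - expo j y / (lam + nu j) =
    - (expo j x - expo j y) / (lam + nu j) by ring.
  rewrite -(mulrA lam^-1); apply: div_resolvent_le => //.
  by rewrite normrN (le_trans (expo_lipschitz j x y))// ler_wpM2r.
- by rewrite invr_ge0 ltW.
- move=> s /andP[s0 _] j; rewrite (gE s s0 j) [leRHS]mulrDl.
  rewrite (le_trans (dominated_resolvent l0 (nexpo_dom s) j))// lerDl.
  by rewrite mulr_ge0 ?sqr_ge0// mulr_ge0 ?invr_ge0 ?(ltW l0)// mulr_ge0// sqr_ge0.
- move=> j; have -> := GE j; have h := dominated_resolvent l0 (exp1_dom t).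
  rewrite [leRHS]mulrDl (le_trans (h j))// lerDr mulr_ge0// ?sqr_ge0//.
  by rewrite mulr1 invr_ge0 ltW.
Qed.

(* Real part (al, be) = (1, 0) and imaginary part (0, -1) of exp (- nu_j z) on the
   right half-plane; this family is stable under differentiation along a line. *)
Definition expoc j (al be : R) (z : R[i]) : R :=
  expo j (complex.Re z) * (al * cos (nu j * complex.Im z) + be * sin (nu j * complex.Im z)).

Definition Smult lam (z : R[i]) : R[i] :=
  Lser (fun j => - expoc j 1 0 z / (lam + nu j)) +i*
  Lser (fun j => - expoc j 0 (-1) z / (lam + nu j)).

Definition Sder lam (z : R[i]) : R[i] :=
  Lser (fun j => nu j * expoc j 1 0 z / (lam + nu j)) +i*
  Lser (fun j => nu j * expoc j 0 (-1) z / (lam + nu j)).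

Lemma expoc_le j al be z : `|expoc j al be z| <= `|al| + `|be|.
Proof.
rewrite /expoc normrM -[leRHS]mul1r ler_pM ?expo_norm_le1//.
by rewrite (le_trans (ler_normD _ _))// !normrM lerD// ler_piMr// ?cos_norm_le1 ?sin_norm_le1.
Qed.

Lemma Smult_real lam t : Smult lam t%:C = (Smr lam t)%:C.
Proof.
rewrite /Smult /Smr; congr (_ +i* _).
  by apply: eq_Lser => j; rewrite /expoc/= mulr0 cos0 sin0 !mulr1 mulr0 addr0 mulr1.
rewrite -[RHS]Lser0; apply: eq_Lser => j.
by rewrite /expoc/= mulr0 cos0 sin0 mulr0 mul0r addr0 mulr0 oppr0 mul0r.
Qed.

Let expoc_dom (c : nat -> R) (al be : R) z : (forall j, `|c j| <= 1 + nu j) -> `|al| + `|be| <= 1 ->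
  dominated (fun j => c j * expoc j al be z) 1.
Proof.
move=> cn ab j; rewrite mul1r normrM (le_trans _ (nu1_sqr_ge j))// -[leRHS]mulr1.
by rewrite ler_pM// (le_trans (expoc_le _ _ _ _)).
Qed.

Let ab10 : `|1 : R| + `|0 : R| <= 1. Proof. by rewrite normr1 normr0 addr0. Qed.
Let ab01 : `|0 : R| + `|-1 : R| <= 1. Proof. by rewrite normrN normr1 normr0 add0r. Qed.

Let expoc_dom1 lam (al be : R) z : 0 < lam -> `|al| + `|be| <= 1 ->
  dominated (fun j => - expoc j al be z / (lam + nu j)) (lam^-1 * 1).
Proof.
move=> l0 ab; apply: dominated_resolvent => // j.
rewrite -mulN1r; apply: expoc_dom => // k.
by rewrite normrN normr1 lerDl.
Qed.

Let expoc_domn lam (al be : R) z : 0 < lam -> `|al| + `|be| <= 1 ->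
  dominated (fun j => nu j * expoc j al be z / (lam + nu j)) (lam^-1 * 1).
Proof.
move=> l0 ab; apply: dominated_resolvent => //; apply: expoc_dom => // k.
by rewrite ger0_norm// lerDr.
Qed.

Lemma Smult_bound lam z : 0 < lam -> normc (Smult lam z) <= lam^-1 * (2 * wtail).
Proof.
move=> l0; rewrite (le_trans (normc_le _))//= mulrCA mulr2n mulrDl mul1r.
by rewrite lerD// -[lam^-1]mulr1; apply: Lser_le; exact: expoc_dom1.
Qed.

Lemma Sder_bound lam z : 0 < lam -> normc (Sder lam z) <= lam^-1 * (2 * wtail).
Proof.
move=> l0; rewrite (le_trans (normc_le _))//= mulrCA mulr2n mulrDl mul1r.
by rewrite lerD// -[lam^-1]mulr1; apply: Lser_le; exact: expoc_domn.
Qed.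

(** Differentiation along z + s h, with z = x + i y and h = a + i b, multiplies the complex number
    al + i be by - n h. *)
Let is_derive_expcs (n x y a b al be t : R) :
  is_derive t 1 (fun s => expR (- (n * (x + s * a))) *
      (al * cos (n * (y + s * b)) + be * sin (n * (y + s * b))))
    (expR (- (n * (x + t * a))) *
      ((- n * (al * a - be * b)) * cos (n * (y + t * b)) +
       (- n * (al * b + be * a)) * sin (n * (y + t * b)))).
Proof.
have la (c u v : R) : is_derive t 1 (fun s : R => c * (u + s * v)) (c * v).
  by apply: is_derive_eq; rewrite /GRing.scale/=; ring.
have e := @is_derive1_comp _ expR (fun s => - (n * (x + s * a))) t _ (- (n * a))
  (is_derive_expR _).
have c := @is_derive1_comp _ cos (fun s => n * (y + s * b)) t _ _ (is_derive_cos _) (la n y b).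
have s := @is_derive1_comp _ sin (fun s => n * (y + s * b)) t _ _ (is_derive_sin _) (la n y b).
have l1 : is_derive t 1 (fun s : R => - (n * (x + s * a))) (- (n * a)).
  by apply: is_derive_eq; rewrite /GRing.scale/=; ring.
have {}e := e l1.
by apply: is_derive_eq; rewrite /GRing.scale/=; ring.
Qed.

(** [taylor2] along the segment z + s h with |s| <= 1; the condition on Re h keeps this segment in
    the closed right half-plane, where the exponential is at most 1. *)
Lemma expoc_taylor j (al be : R) (z h : R[i]) : 0 <= complex.Re z ->
  `|complex.Re h| <= complex.Re z -> `|al| + `|be| <= 1 ->
  `|expoc j al be (z + h) - expoc j al be z +
    nu j * expoc j (al * complex.Re h - be * complex.Im h) (al * complex.Im h + be * complex.Re h) z|
  <= 2 * (normc h) ^+ 2 * (1 + nu j) ^+ 2.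
Proof.
case: z h => [x y] [a b] /= x0 ax ab.
pose n : R := nu j.
pose f (al be s : R) := expR (- (n * (x + s * a))) *
      (al * cos (n * (y + s * b)) + be * sin (n * (y + s * b))).
pose al1 := - n * (al * a - be * b); pose be1 := - n * (al * b + be * a).
have xs (s : R) : `|s - 0| <= `|1| -> 0 <= x + s * a.
  rewrite subr0 normr1 => s1.
  have : `|s * a| <= x by rewrite normrM (le_trans _ ax)// ler_piMl.
  by rewrite ler_norml => /andP[]; lra.
have := @taylor2 _ (f al be) (f al1 be1) (f (- n * (al1 * a - be1 * b)) (- n * (al1 * b + be1 * a)))
  0 1 (2 * normc (a +i* b) ^+ 2 * (1 + nu j) ^+ 2).
rewrite expr1n mulr1 add0r.
have -> : f al be 1 - f al be 0 - 1 * f al1 be1 0 =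
  expoc j al be (x +i* y + (a +i* b)) - expoc j al be (x +i* y) +
    nu j * expoc j (al * a - be * b) (al * b + be * a) (x +i* y).
  have x1 : 0 <= x + a by have := xs 1; rewrite subr0 mul1r; apply.
  rewrite /f /expoc /expo /= !max_l// !mul1r !mul0r !addr0 /al1 /be1 -/n.
  ring.
apply.
- by move=> s _; exact: is_derive_expcs.
- by move=> s _; exact: is_derive_expcs.
- move=> s /xs xs0.
  have nE : 2 * normc (a +i* b) ^+ 2 = 2 * (a ^+ 2 + b ^+ 2).
    by rewrite normcEsqrt/= sqr_sqrtr// addr_ge0// sqr_ge0.
  rewrite nE.
  have e1 : `|expR (- (n * (x + s * a)))| <= 1.
    by rewrite ger0_norm ?expR_ge0// expR_le1 oppr_le0 mulr_ge0// nu_ge0.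
  rewrite /f normrM -[leRHS]mul1r ler_pM//.
  set c := cos _; set d := sin _.
  have c1 : `|c| <= 1 by exact: cos_norm_le1.
  have d1 : `|d| <= 1 by exact: sin_norm_le1.
  have -> : - n * (al1 * a - be1 * b) * c + - n * (al1 * b + be1 * a) * d =
    n ^+ 2 * (al * ((a ^+ 2 - b ^+ 2) * c + 2 * a * b * d) +
      be * ((a ^+ 2 - b ^+ 2) * d - 2 * a * b * c)).
    by rewrite /al1 /be1; ring.
  rewrite normrM mulrC ler_pM ?normr_ge0//; last first.
    rewrite ger0_norm ?sqr_ge0// lerXn2r ?nnegrE ?addr_ge0 ?nu_ge0// lerDr//.
  have S0 : 0 <= 2 * (a ^+ 2 + b ^+ 2) by rewrite mulr_ge0// addr_ge0// sqr_ge0.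
  have key u v : `|u| <= 1 -> `|v| <= 1 ->
      `|(a ^+ 2 - b ^+ 2) * u + 2 * a * b * v| <= 2 * (a ^+ 2 + b ^+ 2).
    move=> u1 v1; rewrite (le_trans (ler_normD _ _))// !normrM.
    have h1 : `|a ^+ 2 - b ^+ 2| * `|u| <= (a ^+ 2 + b ^+ 2) * 1.
      rewrite ler_pM// ler_norml; have := sqr_ge0 a; have := sqr_ge0 b.
      by move=> ? ?; apply/andP; split; lra.
    have h2 : `|2 * a * b| * `|v| <= (a ^+ 2 + b ^+ 2) * 1.
      rewrite ler_pM// ler_norml; have := sqr_ge0 (a - b); have := sqr_ge0 (a + b).
      by move=> ? ?; apply/andP; split; nra.
    rewrite !normrM in h2; lra.
  rewrite (le_trans (ler_normD _ _))// !normrM.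
  have k1 := key c d c1 d1.
  have k2 : `|(a ^+ 2 - b ^+ 2) * d - 2 * a * b * c| <= 2 * (a ^+ 2 + b ^+ 2).
    by have := key d (- c) d1; rewrite normrN mulrN => /(_ c1).
  rewrite (le_trans (lerD (ler_wpM2l (normr_ge0 al) k1) (ler_wpM2l (normr_ge0 be) k2)))//.
  by rewrite -mulrDl ler_piMl.
Qed.

Lemma Smult_derive lam z h : 0 < lam -> 0 <= complex.Re z ->
  `|complex.Re h| <= complex.Re z ->
  normc (Smult lam (z + h) - Smult lam z - h * Sder lam z) <=
    lam^-1 * (4 * (normc h) ^+ 2 * wtail).
Proof.
move=> l0 z0 hz; have w0 : 0 <= wtail :> R by rewrite mulr_ge0// exprn_ge0.
have key (al be : R) : `|al| + `|be| <= 1 ->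
   `|Lser (fun j => (- expoc j al be (z + h)) / (lam + nu j)) -
     Lser (fun j => (- expoc j al be z) / (lam + nu j)) -
     Lser (fun j => nu j * expoc j (al * complex.Re h - be * complex.Im h)
        (al * complex.Im h + be * complex.Re h) z / (lam + nu j))|
   <= lam^-1 * (2 * (normc h) ^+ 2) * wtail.
  move=> ab; have d1 := expoc_dom1 (z + h) l0 ab; have d2 := expoc_dom1 z l0 ab.
  pose c := `|al * complex.Re h - be * complex.Im h| + `|al * complex.Im h + be * complex.Re h|.
  have d3 : dominated (fun j => nu j * expoc j (al * complex.Re h - be * complex.Im h)
        (al * complex.Im h + be * complex.Re h) z / (lam + nu j)) (lam^-1 * c).
    apply: dominated_resolvent => // j; rewrite normrM mulrC ler_pM//.
      exact: expoc_le.
    by rewrite ger0_norm.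
  rewrite -(LserB d1 d2) -(LserB (dominatedB d1 d2) d3); apply: Lser_le.
  have -> : (fun j => - expoc j al be (z + h) / (lam + nu j) - - expoc j al be z / (lam + nu j) -
    nu j * expoc j (al * complex.Re h - be * complex.Im h)
      (al * complex.Im h + be * complex.Re h) z / (lam + nu j)) =
    (fun j => - (expoc j al be (z + h) - expoc j al be z +
    nu j * expoc j (al * complex.Re h - be * complex.Im h)
      (al * complex.Im h + be * complex.Re h) z) / (lam + nu j)).
    by apply/funext => j; ring.
  by apply: dominated_resolvent => // j; rewrite normrN expoc_taylor.
(* By linearity in (al, be), the two directional derivatives are the real and imaginary parts of h
   times [Sder], which is complex differentiability. *)
have expand (al be : R) :
   Lser (fun j => nu j * expoc j al be z / (lam + nu j)) =
   al * complex.Re (Sder lam z) - be * complex.Im (Sder lam z).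
  rewrite /= -(LserZ al (expoc_domn z l0 ab10)) -(LserZ be (expoc_domn z l0 ab01)).
  rewrite -(@LserB _ _ _ (`|al| * lam^-1) (`|be| * lam^-1)).
  - by apply: eq_Lser => j; rewrite /expoc; ring.
  - move=> j; rewrite normrM -[leRHS]mulrA ler_wpM2l//.
    by rewrite -[lam^-1]mulr1; apply: expoc_domn.
  - move=> j; rewrite normrM -[leRHS]mulrA ler_wpM2l//.
    by rewrite -[lam^-1]mulr1; apply: expoc_domn.
have reE (u v a b : R[i]) : complex.Re (u - v - a * b) = complex.Re u - complex.Re v -
    (complex.Re a * complex.Re b - complex.Im a * complex.Im b).
  by case: u v a b => [? ?] [? ?] [? ?] [? ?].
have imE (u v a b : R[i]) : complex.Im (u - v - a * b) = complex.Im u - complex.Im v -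
    (complex.Re a * complex.Im b + complex.Im a * complex.Re b).
  by case: u v a b => [? ?] [? ?] [? ?] [? ?].
have k1 := key _ _ ab10; have k2 := key _ _ ab01.
rewrite expand in k1; rewrite expand in k2.
rewrite (le_trans (normc_le _))//.
have -> : lam^-1 * (4 * normc h ^+ 2 * wtail) =
   lam^-1 * (2 * normc h ^+ 2) * wtail + lam^-1 * (2 * normc h ^+ 2) * wtail by ring.
apply: lerD.
  apply: le_trans k1; rewrite le_eqVlt; apply/orP; left; apply/eqP; congr `|_|.
  rewrite reE -[complex.Re (Smult lam (z + h))]/(Lser _) -[complex.Re (Smult lam z)]/(Lser _).
  ring.
apply: le_trans k2; rewrite le_eqVlt; apply/orP; left; apply/eqP; congr `|_|.
rewrite imE -[complex.Im (Smult lam (z + h))]/(Lser _) -[complex.Im (Smult lam z)]/(Lser _).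
ring.
Qed.

(** As the 1 / (lam + nu_j) sum to 0, - exp (- nu_j z) may be replaced by 1 - exp (- nu_j z), which
    is O(nu_j |z|). The 3 is 2 for the real part plus 1 for the imaginary part. *)
Lemma Smult_near0 lam z : 0 < lam -> Fres lam = 0 -> 0 <= complex.Re z ->
  normc (Smult lam z) <= lam^-1 * (3 * normc z * wtail).
Proof.
move=> l0 F0 z0.
have w0 : 0 <= wtail :> R by rewrite mulr_ge0// exprn_ge0.
have li : 0 <= lam^-1 by rewrite invr_ge0 ltW.
have e1 j : `|expo j (complex.Re z) - 1| <= nu j * normc z.
  have -> : 1 = expo j 0 :> R by rewrite /expo max_l// mulr0 oppr0 expR0.
  by rewrite (le_trans (expo_lipschitz _ _ _))// subr0 ler_wpM2l// Re_le_normc.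
have cs (c c' : R -> R) : (forall x : R, is_derive x 1 c (c' x)) -> (forall x, `|c' x| <= 1) ->
    forall j, `|c (nu j * complex.Im z) - c 0| <= nu j * normc z.
  move=> dc c1 j; set v := nu j * _.
  apply: (@le_trans _ _ (1 * `|v - 0|)).
    apply: (@lipschitz_of_derive _ c c' (Num.min v 0) (Num.max v 0)) => //;
    by rewrite ge_min le_max !lexx ?orbT.
  by rewrite mul1r subr0 normrM ger0_norm// ler_wpM2l// Im_le_normc.
have e2 j : `|cos (nu j * complex.Im z) - 1| <= nu j * normc z.
  rewrite -cos0; apply: (cs cos (fun x => - sin x)) => x.
  by rewrite normrN sin_norm_le1.
have e3 j : `|sin (nu j * complex.Im z)| <= nu j * normc z.
  have := cs sin cos _ _ j; rewrite sin0 subr0; apply => x.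
  exact: cos_norm_le1.
rewrite (le_trans (normc_le _))//=.
have -> : lam^-1 * (3 * normc z * wtail) =
   lam^-1 * (2 * normc z) * wtail + lam^-1 * (normc z) * wtail by ring.
apply: lerD; last first.
  apply: Lser_le; apply: dominated_resolvent => // j.
  rewrite normrN /expoc mul0r add0r mulN1r mulrN normrN normrM.
  rewrite (le_trans (ler_piMl _ (expo_norm_le1 _ _)))// (le_trans (e3 j))//.
  by rewrite mulrC ler_wpM2l ?normc_ge0.
have -> : Lser (fun j => - expoc j 1 0 z / (lam + nu j)) =
    Lser (fun j => (1 - expoc j 1 0 z) / (lam + nu j)).
  rewrite -[LHS]addr0 -[X in _ + X]F0 /Fres.
  rewrite -(LserD (expoc_dom1 z l0 ab10) (dominated_fres l0)).
  by apply: eq_Lser => j; ring.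
apply: Lser_le; apply: dominated_resolvent => // j.
have -> : 1 - expoc j 1 0 z = - (expo j (complex.Re z) - 1) -
    expo j (complex.Re z) * (cos (nu j * complex.Im z) - 1).
  by rewrite /expoc; ring.
apply: (@le_trans _ _ (2 * normc z * nu j)); last first.
  by rewrite ler_wpM2l// mulr_ge0// normc_ge0.
rewrite (le_trans (ler_normB _ _))// normrN normrM.
have := ler_piMl (normr_ge0 (cos (nu j * complex.Im z) - 1)) (expo_norm_le1 j (complex.Re z)).
have := e1 j; have := e2 j; lra.
Qed.
End semigroup_multipliers.

(** * Diagonal operators *)

Section diagonal_operators.
Context {R : realType} {E : normedModType R[i]}.

(* The decay k^-2 stands in for square summability. *)
Definition coefficient_system (coef : nat -> E -> R[i]) (M : R) : Prop :=
  [/\ 0 < M,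
      forall k (a : R[i]) x y, coef k (a *: x + y) = a * coef k x + coef k y,
      forall k x, (normc (coef k x))%:C <= M%:C * `|x|,
      forall x y, (forall k, coef k x = coef k y) -> x = y &
      forall (a : nat -> R[i]) (S : R),
        (forall k, normc (a k) <= S / k.+1%:R ^+ 2) ->
        exists x, (forall k, coef k x = a k) /\ `|x| <= (M * S)%:C].

Definition diagonal (coef : nat -> E -> R[i]) (m : nat -> R[i]) (T : E -> E) :=
  forall k x, coef k (T x) = m k * coef k x.

(** Norms on E take values in [R[i]]; this is the same number in R. *)
Definition rnorm (x : E) : R := complex.Re `|x|.

Lemma rnormE x : `|x| = (rnorm x)%:C.
Proof.
by have := normr_ge0 x; rewrite /rnorm; case: `|x| => a b; rewrite lecE/= => /andP[/eqP -> _].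
Qed.

Lemma rnorm_ge0 x : 0 <= rnorm x.
Proof. by have := normr_ge0 x; rewrite rnormE (lecR 0). Qed.

Lemma posC_real (e : R[i]) : 0 < e -> 0 < complex.Re e /\ e = (complex.Re e)%:C.
Proof. by case: e => a b; rewrite ltcE/= => /andP[/eqP -> ?]. Qed.

Lemma lipschitz_cvg (T : E -> E) (C : R) (x : E) : 0 <= C ->
  (forall y, `|T x - T y| <= C%:C * `|x - y|) -> T @ x --> T x.
Proof.
move=> C0 TC; apply/cvgrPdist_le => e /posC_real[e0 ->]; near=> y.
rewrite (le_trans (TC y))//.
have : `|x - y| <= (complex.Re e / (C + 1))%:C.
  near: y; apply: cvgr_dist_le; first exact: cvg_id.
  by rewrite ltcR divr_gt0// ltr_wpDl.
rewrite rnormE -rmorphM !lecR => h.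
rewrite (le_trans (ler_wpM2l C0 h))// mulrA ler_pdivrMr ?ltr_wpDl//.
by rewrite mulrC ler_wpM2l ?(ltW e0)// lerDl.
Unshelve. all: by end_near. Qed.

Lemma real_lipschitz_continuous (f : R -> E) (C : R) : 0 <= C ->
  (forall s t, `|f s - f t| <= (C * `|s - t|)%:C) -> continuous f.
Proof.
move=> C0 fC x; apply/cvgrPdist_le => e /posC_real[e0 ->]; near=> y.
rewrite (le_trans (fC x y))// lecR.
have h : `|x - y| <= complex.Re e / (C + 1).
  near: y; apply: cvgr_dist_le; first exact: cvg_id.
  by rewrite divr_gt0// ltr_wpDl.
rewrite (le_trans (ler_wpM2l C0 h))// mulrA ler_pdivrMr ?ltr_wpDl//.
by rewrite mulrC ler_wpM2l ?(ltW e0)// lerDl.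
Unshelve. all: by end_near. Qed.

Section coefficients.
Context {coef : nat -> E -> R[i]} {M : R} (cs : coefficient_system coef M).

Let M0 : 0 < M. Proof. by case: cs. Qed.
Let coefP k a x y : coef k (a *: x + y) = a * coef k x + coef k y.
Proof. by case: cs. Qed.
Let coef_bd k x : normc (coef k x) <= M * rnorm x.
Proof. by case: cs => _ _ + _ _ => /(_ k x); rewrite rnormE -rmorphM lecR. Qed.
Let coef_inj x y : (forall k, coef k x = coef k y) -> x = y.
Proof. by case: cs => _ _ _ + _; apply. Qed.

Let coef0 k : coef k 0 = 0.
Proof. by have := coefP k (-1) 0 0; rewrite scaler0 add0r mulN1r addNr. Qed.
Let coefD k x y : coef k (x + y) = coef k x + coef k y.
Proof. by have := coefP k 1 x y; rewrite scale1r mul1r. Qed.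
Let coefZ k a x : coef k (a *: x) = a * coef k x.
Proof. by have := coefP k a x 0; rewrite coef0 !addr0. Qed.
Let coefB k x y : coef k (x - y) = coef k x - coef k y.
Proof. by rewrite -scaleN1r coefD coefZ mulN1r. Qed.
Let coef_sum k m (f : 'I_m -> E) : coef k (\sum_(i < m) f i) = \sum_(i < m) coef k (f i).
Proof. by elim/big_ind2: _ => // [x a y b <- <-]. Qed.

Let MC_ge0 C x : 0 <= C -> 0 <= M ^+ 2 * C * rnorm x.
Proof. by move=> C0; rewrite mulr_ge0 ?rnorm_ge0// mulr_ge0// sqr_ge0. Qed.

(** Synthesis from the coefficients of x yields an element of controlled norm, and this element is x
    by injectivity. It takes the place of Parseval's identity. *)
Lemma norm_le_of_coef x S : (forall k, normc (coef k x) <= S / k.+1%:R ^+ 2) ->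
  rnorm x <= M * S.
Proof.
move=> xS; case: cs => _ _ _ _ /(_ (fun k => coef k x) S xS)[y [yx yS]].
by rewrite -lecR -rnormE -(coef_inj yx).
Qed.

Lemma norm_le_of_multiplier x y (m : nat -> R[i]) S : 0 <= S ->
  (forall k, coef k y = m k * coef k x) ->
  (forall k, normc (m k) <= S / k.+1%:R ^+ 2) ->
  `|y| <= (M ^+ 2 * S)%:C * `|x|.
Proof.
move=> S0 yx mS; rewrite !rnormE -rmorphM lecR.
have -> : M ^+ 2 * S * rnorm x = M * (M * S * rnorm x) by ring.
apply: norm_le_of_coef => k; rewrite yx normcM.
rewrite (le_trans (ler_pM (normc_ge0 _) (normc_ge0 _) (mS k) (coef_bd k x)))//.
by rewrite le_eqVlt; apply/orP; left; apply/eqP; ring.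
Qed.

Lemma diagonal_exists (m : nat -> R[i]) S : 0 <= S ->
  (forall k, normc (m k) <= S / k.+1%:R ^+ 2) ->
  exists T : {linear E -> E}, diagonal coef m T.
Proof.
move=> S0 mS; have ex x : exists y, forall k, coef k y = m k * coef k x.
  case: cs => _ _ _ _ /(_ (fun k => m k * coef k x) (S * (M * rnorm x)))[k|y [yx _]].
    by rewrite normcM mulrAC ler_pM ?normc_ge0.
  by exists y.
have [T Tm] := boolp.choice ex.
have Tlin : linear T.
  by move=> a x y; apply: coef_inj => k; rewrite coefP !Tm coefP; ring.
by exists (HB.pack_for {linear E -> E} T (GRing.isLinear.Build _ _ _ _ T Tlin)).
Qed.

Lemma diagonal_continuous (m : nat -> R[i]) S (T : {linear E -> E}) : 0 <= S ->
  (forall k, normc (m k) <= S / k.+1%:R ^+ 2) -> diagonal coef m T -> continuous T.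
Proof.
move=> S0 mS Tm x; apply: (@lipschitz_cvg _ (M ^+ 2 * S)).
  by rewrite mulr_ge0// sqr_ge0.
move=> y; apply: (norm_le_of_multiplier (m := m)) => // k.
by rewrite !coefB !Tm; ring.
Qed.

Section diagonal_operator.
Context {lam : nat -> R} {B : set (E * E)}.
Context (lam_ge : forall k, k.+1%:R ^+ 2 <= lam k).
Context (BP : forall x y, B (x, y) <-> forall k, (lam k)%:C * coef k x = coef k y).

Let lam_gt0 k : 0 < lam k.
Proof. by rewrite (lt_le_trans _ (lam_ge k))// exprn_gt0. Qed.

Let lamV k (C : R) : 0 <= C -> (lam k)^-1 * C <= C / k.+1%:R ^+ 2.
Proof.
by move=> C0; rewrite mulrC ler_wpM2l// lef_pV2 ?posrE ?exprn_gt0.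
Qed.

(** The coefficients are continuous, so each of the equations that define the graph is a closed
    condition. *)
Lemma closed_diagonal : closed_operator B.
Proof.
split.
- by apply/BP => k; rewrite coef0 mulr0.
- move=> a [p1 p2] [q1 q2] /BP pB /BP qB; apply/BP => k.
  by rewrite /= !coefP -pB -qB; ring.
- by move=> y /BP yB; apply: coef_inj => k; rewrite -yB !coef0 mulr0.
- move=> [x y] clB; apply/BP => k; apply/eqP; rewrite -subr_eq0.
  rewrite -normr_eq0 normCE; apply/eqP; congr (_%:C).
  apply/eqP; rewrite eq_le normc_ge0 andbT.
  apply/ler_addgt0Pr => e e0; rewrite add0r.
  pose d := e / (M * (lam k + 1)).
  have D0 : 0 < M * (lam k + 1) by rewrite mulr_gt0// ltr_wpDl// ltW.
  have d0 : 0 < d by rewrite divr_gt0.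
  have d0C : 0 < d%:C by rewrite ltcR.
  have [[u v] [/BP uv [/= xu yv]]] := clB _ (nbhsx_ballx (x, y) d%:C d0C).
  rewrite -ball_normE/= rnormE ltcR in xu.
  rewrite -ball_normE/= rnormE ltcR in yv.
  have -> : (lam k)%:C * coef k x - coef k y = (lam k)%:C * coef k (x - u) - coef k (y - v).
    by rewrite !coefB mulrBr uv; ring.
  rewrite (le_trans (normc_triangle _ _))// normcN normcM normcR gtr0_norm//.
  have := coef_bd k (x - u); have := coef_bd k (y - v) => h1 h2.
  have -> : e = lam k * (M * d) + M * d.
    have l1 : lam k + 1 != 0 by rewrite gt_eqF// ltr_wpDl// ltW.
    by rewrite /d; field; rewrite l1 gt_eqF.
  apply: lerD; first by rewrite ler_wpM2l ?(ltW (lam_gt0 k))// (le_trans h2)// ler_pM2l// ltW.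
  by rewrite (le_trans h1)// ler_pM2l// ltW.
Qed.

Lemma diagonal_commutes (m : R -> nat -> R[i]) (T : R -> {linear E -> E}) :
  (forall t, diagonal coef (m t) (T t)) -> commutes_with T B.
Proof.
by move=> Tm t _ x y /BP xy; apply/BP => k; rewrite !Tm -xy; ring.
Qed.

Lemma diagonal_strongly_continuous (C : R) (m : R -> nat -> R[i]) (T : R -> {linear E -> E}) :
  0 <= C ->
  (forall t, diagonal coef (m t) (T t)) ->
  (forall t k, normc (m t k) <= (lam k)^-1 * C) ->
  (forall s t k, normc (m s k - m t k) <= (lam k)^-1 * (`|s - t| * C)) ->
  strongly_continuous T.
Proof.
move=> C0 Tm mC mL; split.
  move=> t _; apply: (diagonal_continuous C0 _ (Tm t)) => k.
  by rewrite (le_trans (mC t k))// lamV.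
move=> x; apply: continuous_subspaceT.
apply: (@real_lipschitz_continuous _ (M ^+ 2 * C * rnorm x)).
  exact: MC_ge0.
move=> s t.
have := @norm_le_of_multiplier x (T s x - T t x) (fun k => m s k - m t k) (`|s - t| * C).
rewrite mulr_ge0// => /(_ isT _ _)/le_trans; apply.
- by move=> k; rewrite coefB !Tm mulrBl.
- by move=> k; rewrite (le_trans (mL s t k))// lamV// mulr_ge0.
- by rewrite rnormE -rmorphM lecR le_eqVlt; apply/orP; left; apply/eqP; ring.
Qed.

(** The error of a Riemann sum is itself a multiplier of order 1 / lam_k, hence small in operator
    norm. The weight w is t - s for the cosine function and 1 for the semigroup. *)
Lemma diagonal_Riemann (t C : R) (w : R -> R) (m : R -> nat -> R) (I : nat -> R)
    (T : R -> {linear E -> E}) x y : 0 <= C ->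
  (forall s, diagonal coef (fun k => (m s k)%:C) (T s)) ->
  (forall k, coef k y = (I k)%:C * coef k x) ->
  (forall (d : R) n (p xi : nat -> R), 0 < d -> p 0%N = 0 -> p n = t ->
    (forall i, (i < n)%N -> [/\ p i <= xi i, xi i <= p i.+1 & p i.+1 - p i < d]) ->
    forall k, `|\sum_(i < n) (p i.+1 - p i) * (w (xi i) * m (xi i) k) - I k|
      <= (lam k)^-1 * (C * d)) ->
  is_Riemann_integral (fun s => (w s)%:C *: T s x) 0 t y.
Proof.
move=> C0 Tm yI sumI e e0.
have D0 : 0 < M ^+ 2 * C * rnorm x + 1.
  by rewrite ltr_wpDl// MC_ge0.
exists (e / (M ^+ 2 * C * rnorm x + 1)); split; first by rewrite divr_gt0.
move=> n p xi p0 pt pxi; set d := e / _ in pxi; have d0 : 0 < d by rewrite divr_gt0.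
have sI := sumI d n p xi d0 p0 pt pxi.
have := @norm_le_of_multiplier x
  (\sum_(i < n) (p i.+1 - p i)%:C *: ((w (xi i))%:C *: T (xi i) x) - y)
  (fun k => (\sum_(i < n) (p i.+1 - p i) * (w (xi i) * m (xi i) k) - I k)%:C) (C * d).
rewrite mulr_ge0 ?(ltW d0)// => /(_ isT _ _)/le_trans; apply.
- move=> k; rewrite coefB coef_sum yI rmorphB mulrBl rmorph_sum mulr_suml.
  congr (_ - _); apply: eq_bigr => i _.
  by rewrite !coefZ Tm !rmorphM; ring.
- move=> k; by rewrite normcR (le_trans (sI k))// lamV// mulr_ge0// (ltW d0).
- rewrite rnormE -rmorphM lecR /d.
  have -> : M ^+ 2 * (C * (e / (M ^+ 2 * C * rnorm x + 1))) * rnorm x =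
     e * (M ^+ 2 * C * rnorm x) / (M ^+ 2 * C * rnorm x + 1) by ring.
  by rewrite ler_pdivrMr// ler_wpM2l ?(ltW e0)// lerDl.
Qed.

Context (lam_root : forall k, Fres (lam k) = 0).

Let w_ge0 : 0 <= wtail :> R. Proof. by rewrite mulr_ge0// exprn_ge0. Qed.

Let family_exists (X : Type) (m : X -> nat -> R[i]) C : 0 <= C ->
  (forall t k, normc (m t k) <= (lam k)^-1 * C) ->
  exists T : X -> {linear E -> E}, forall t, diagonal coef (m t) (T t).
Proof.
move=> C0 mC; suff /boolp.choice[T Tm] : forall t, exists T : {linear E -> E}, diagonal coef (m t) T.
  by exists T.
by move=> t; apply: (diagonal_exists C0) => k; rewrite (le_trans (mC t k))// lamV.
Qed.

Lemma diagonal_generates_cosine :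
  generates_exp_bounded_convoluted_cosine (fun t => (Kcos t)%:C) B.
Proof.
split; first exact: closed_diagonal.
have cb t k : normc (Cmult (lam k) t)%:C <= (lam k)^-1 * wtail.
  by rewrite normcR Cmult_bound.
have [T Tm] := family_exists w_ge0 cb.
exists T; split.
- apply: (diagonal_strongly_continuous w_ge0 Tm cb) => s t k.
  by rewrite -rmorphB normcR mulrA; exact: Cmult_lipschitz.
(* The multipliers are bounded uniformly in t, so there is no exponential growth; the + 1 makes the
   constant positive. *)
- exists (M ^+ 2 * wtail + 1), 0; split; first by rewrite ltr_wpDl// mulr_ge0// sqr_ge0.
  move=> t _ x; rewrite mul0r expR0 mulr1.
  apply: le_trans (norm_le_of_multiplier w_ge0 (Tm t ^~ x) _) _.
    by move=> k; rewrite (le_trans (cb t k))// lamV.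
  by rewrite ler_wpM2r// lecR lerDl.
- exact: diagonal_commutes Tm.
move=> x t t0.
have ib k : normc (Cint (lam k) t)%:C <= (2 * ominv ^+ 2 * wtail) / k.+1%:R ^+ 2.
  rewrite normcR (le_trans (Cint_bound t (lam_gt0 k)))// -mulrA lamV//.
  by rewrite mulr_ge0// mulr_ge0// sqr_ge0.
have i0 : 0 <= 2 * ominv ^+ 2 * wtail :> R by rewrite mulr_ge0// mulr_ge0// sqr_ge0.
(* J is the twice integrated family at time t; it maps into the domain of B by [Cint_eq]. *)
have [J Jm] := diagonal_exists i0 ib.
exists (J x); split.
  have c0 : 0 <= (1 + t) * t * wtail by rewrite mulr_ge0// mulr_ge0// addr_ge0.
  apply: (diagonal_Riemann c0 Tm (Jm ^~ x)) => d n p xi d0 p0 pn pxi k.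
  rewrite (le_trans (Cmult_Riemann (lam_gt0 k) t0 p0 pn pxi))//.
  by rewrite le_eqVlt; apply/orP; left; apply/eqP; ring.
apply/BP => k; rewrite coefB coefZ Jm Tm Theta_Kcos// -mulrBl mulrA -rmorphM.
by rewrite Cint_eq ?rmorphB.
Qed.

Lemma sector_half_pi_Re_gt0 (z : R[i]) : sector (pi / 2) z -> 0 < complex.Re z.
Proof.
move=> [r [th [r0 thp ->]]] /=; rewrite mulr_gt0// cos_gt0_pihalf//.
by move: thp; rewrite ltr_norml.
Qed.

Lemma diagonal_generates_semigroup :
  generates_exp_bounded_analytic_convoluted_semigroup
    (fun t => (Kexp t)%:C) B (pi / 2).
Proof.
split; first exact: closed_diagonal.
have w2 : 0 <= 2 * wtail :> R by rewrite mulr_ge0.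
have sb z k : normc (Smult (lam k) z) <= (lam k)^-1 * (2 * wtail) by exact: Smult_bound.
have db z k : normc (Sder (lam k) z) <= (lam k)^-1 * (2 * wtail) by exact: Sder_bound.
have [T Tm] := family_exists w2 sb.
have [D Dm] := family_exists w2 db.
have Tr t : diagonal coef (fun k => (Smr (lam k) t)%:C) (T t%:C).
  by move=> k x; rewrite Tm Smult_real.
exists (fun t => T t%:C).
  split.
  - apply: (diagonal_strongly_continuous w2 Tr) => [t k|s t k].
      by rewrite -Smult_real; exact: sb.
    rewrite -rmorphB normcR (le_trans (Smr_lipschitz s t (lam_gt0 k)))// -mulrA.
    rewrite ler_wpM2l ?invr_ge0 ?(ltW (lam_gt0 k))// ler_wpM2l//.
    by rewrite ler_peMl// ler1n.
  - exact: diagonal_commutes Tr.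
  move=> x t t0.
  have i0 : 0 <= 2 * ominv ^+ 2 * wtail :> R by rewrite mulr_ge0// mulr_ge0// sqr_ge0.
  have ib k : normc (Sint (lam k) t)%:C <= (2 * ominv ^+ 2 * wtail) / k.+1%:R ^+ 2.
    by rewrite normcR (le_trans (Sint_bound t (lam_gt0 k)))// -mulrA lamV.
  have [J Jm] := diagonal_exists i0 ib.
  exists (J x); split.
    have c0 : 0 <= t * wtail by rewrite mulr_ge0.
    have -> : (fun s => T s%:C x) = (fun s => 1%:C *: T s%:C x).
      by apply/funext => s; rewrite scale1r.
    apply: (diagonal_Riemann (w := fun=> 1) c0 Tr (Jm ^~ x)) => d n p xi d0 p0 pn pxi k.
    under eq_bigr do rewrite mul1r.
    rewrite (le_trans (Smr_Riemann (lam_gt0 k) t0 p0 pn pxi))//.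
    by rewrite le_eqVlt; apply/orP; left; apply/eqP; ring.
  apply/BP => k; rewrite coefB coefZ Jm Tr Theta_Kexp// -mulrBl mulrA -rmorphM.
  by rewrite Sint_eq ?rmorphB.
exists T; split => //.
- move=> z /sector_half_pi_Re_gt0 z0; split.
    apply: (diagonal_continuous w2 _ (Tm z)) => k.
    by rewrite (le_trans (sb z k))// lamV.
  exists (D z); split.
    apply: (diagonal_continuous w2 _ (Dm z)) => k.
    by rewrite (le_trans (db z k))// lamV.
  move=> e e0.
  have D0 : 0 < M ^+ 2 * (4 * wtail) + 1.
    by rewrite ltr_wpDl// mulr_ge0// ?sqr_ge0// mulr_ge0.
  near=> h => x.
  have hn0 : h != 0 by near: h; exact: (@nbhs_dnbhs_neq R[i]^o).
  (* This keeps z + h in the closed right half-plane, as [Smult_derive] requires. *)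
  have hz : normc h <= complex.Re z.
    rewrite -lecR -normCE; near: h; apply: (@dnbhs0_le _ R[i]^o).
    by rewrite ltcR.
  have he : normc h <= e / (M ^+ 2 * (4 * wtail) + 1).
    rewrite -lecR -normCE; near: h; apply: (@dnbhs0_le _ R[i]^o).
    by rewrite ltcR divr_gt0.
  have hb : 0 <= normc h by exact: normc_ge0.
  apply: le_trans (norm_le_of_multiplier (S := 4 * normc h * wtail)
    (m := fun k => h^-1 * (Smult (lam k) (z + h) - Smult (lam k) z) - Sder (lam k) z) _ _ _) _.
  + by rewrite !mulr_ge0.
  + by move=> k; rewrite !(coefB, coefZ) !Tm Dm; ring.
  + move=> k; rewrite (le_trans _ (lamV _ _)) ?mulr_ge0//.
    have -> : h^-1 * (Smult (lam k) (z + h) - Smult (lam k) z) - Sder (lam k) z =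
      h^-1 * (Smult (lam k) (z + h) - Smult (lam k) z - h * Sder (lam k) z).
      by field.
    have hp : 0 < normc h.
      by rewrite lt_def hb andbT; apply: contra hn0 => /eqP /eq0_normc ->.
    rewrite normcM normcV ler_pdivrMl//.
    have := Smult_derive (h := h) (lam_gt0 k) (ltW z0) (le_trans (Re_le_normc h) hz).
    move=> /le_trans; apply.
    by rewrite le_eqVlt; apply/orP; left; apply/eqP; ring.
  + rewrite ler_wpM2r// lecR.
    have -> : M ^+ 2 * (4 * normc h * wtail) = normc h * (M ^+ 2 * (4 * wtail)) by ring.
    apply: (@le_trans _ _ (normc h * (M ^+ 2 * (4 * wtail) + 1))).
      by rewrite ler_wpM2l// lerDl.
    by rewrite -ler_pdivlMr.
- move=> gamma /andP[g0 gp] x; apply/cvgrPdist_le => e /posC_real[e0 ->].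
  have D0 : 0 < M ^+ 2 * (3 * wtail) * rnorm x + 1.
    by rewrite ltr_wpDl// MC_ge0// mulr_ge0.
  rewrite near_withinE; near=> z => zs.
  have z0 : 0 < complex.Re z.
    apply: sector_half_pi_Re_gt0; case: zs => r [th [r0 thg ->]].
    by exists r, th; split=> //; exact: lt_trans gp.
  have he : normc z <= complex.Re e / (M ^+ 2 * (3 * wtail) * rnorm x + 1).
    rewrite -lecR -normCE; near: z; apply: (@nbhs0_le _ R[i]^o).
    by rewrite ltcR divr_gt0.
  rewrite sub0r normrN.
  apply: le_trans (norm_le_of_multiplier (S := 3 * normc z * wtail) _ (Tm z ^~ x) _) _.
  + by rewrite mulr_ge0// mulr_ge0// normc_ge0.
  + move=> k; rewrite (le_trans (Smult_near0 (lam_gt0 k) (lam_root k) (ltW z0)))// lamV//.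
    by rewrite mulr_ge0// mulr_ge0// normc_ge0.
  + rewrite rnormE -rmorphM lecR.
    have -> : M ^+ 2 * (3 * normc z * wtail) * rnorm x =
      normc z * (M ^+ 2 * (3 * wtail) * rnorm x) by ring.
    apply: (@le_trans _ _ (normc z * (M ^+ 2 * (3 * wtail) * rnorm x + 1))).
      by rewrite ler_wpM2l ?normc_ge0// lerDl.
    by rewrite -ler_pdivlMr.
- move=> gamma /andP[g0 gp].
  (* The family is bounded on the half-plane, but the growth rate must be positive: 1 will do, as
     exp (Re z) >= 1 there. *)
  exists (M ^+ 2 * (2 * wtail) + 1), 1; split => //.
    by rewrite ltr_wpDl// mulr_ge0// sqr_ge0.
  move=> z zs x.
  have z0 : 0 < complex.Re z.
    apply: sector_half_pi_Re_gt0; case: zs => r [th [r0 thg ->]].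
    by exists r, th; split=> //; exact: lt_trans gp.
  apply: le_trans (norm_le_of_multiplier w2 (Tm z ^~ x) _) _.
    by move=> k; rewrite (le_trans (sb z k))// lamV.
  rewrite ler_wpM2r// lecR mul1r.
  apply: (@le_trans _ _ (M ^+ 2 * (2 * wtail) + 1)); first by rewrite lerDl.
  rewrite ler_peMr//; first by rewrite addr_ge0// mulr_ge0// sqr_ge0.
  by rewrite -expR0 ler_expR ltW.
Unshelve. all: by end_near. Qed.

End diagonal_operator.
End coefficients.
End diagonal_operators.

(** * Sine coefficients on [0, pi] *)

Section sine_coefficients.
Context {R : realType}.
Local Notation mu := (@lebesgue_measure R).
Local Notation I := (`[0, pi]%classic : set R).
Implicit Types (f g h u v : R -> R).

Let pi0 : 0 < pi :> R := pi_gt0 R.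

Let mI : measurable I. Proof. exact: measurable_itv. Qed.

Let integrable_addI f g : mu.-integrable I (EFin \o f) -> mu.-integrable I (EFin \o g) ->
  mu.-integrable I (EFin \o (fun x => f x + g x)).
Proof. by move=> fi gi; exact: (@integrableD _ _ _ mu I mI _ _ fi gi). Qed.

Let integrable_subI f g : mu.-integrable I (EFin \o f) -> mu.-integrable I (EFin \o g) ->
  mu.-integrable I (EFin \o (fun x => f x - g x)).
Proof. by move=> fi gi; exact: (@integrableB _ _ _ mu I mI _ _ fi gi). Qed.

Lemma continuous_sinM (k : R) : continuous (fun t : R => sin (k * t)).
Proof. exact: (derivable_continuous (is_derive_sinM k)). Qed.

Lemma continuous_cosM (k : R) : continuous (fun t : R => cos (k * t)).
Proof. exact: (derivable_continuous (is_derive_cosM k)). Qed.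

Lemma measurable_sinM (k : R) : measurable_fun setT (fun t : R => sin (k * t)).
Proof. exact: continuous_measurable_fun (@continuous_sinM k). Qed.

Lemma measurable_cosM (k : R) : measurable_fun setT (fun t : R => cos (k * t)).
Proof. exact: continuous_measurable_fun (@continuous_cosM k). Qed.

Lemma integral_sinM (k a b : R) : k != 0 -> a <= b ->
  \int[mu]_(x in `[a, b]) sin (k * x) = (cos (k * a) - cos (k * b)) / k.
Proof.
move=> k0 ab.
have d (t : R) : is_derive t 1 (fun t => - cos (k * t) / k) (sin (k * t)).
  by have h := is_derive_cosM k t; apply: is_derive_eq; rewrite /GRing.scale/=; field.
rewrite (Rintegral_FTC2 ab (continuous_sinM (k := k)) (derivable_continuous d)) => //.
by field.
Qed.

Lemma integral_cosM (k a b : R) : k != 0 -> a <= b ->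
  \int[mu]_(x in `[a, b]) cos (k * x) = (sin (k * b) - sin (k * a)) / k.
Proof.
move=> k0 ab.
have d (t : R) : is_derive t 1 (fun t => sin (k * t) / k) (cos (k * t)).
  by have h := is_derive_sinM k t; apply: is_derive_eq; rewrite /GRing.scale/=; field.
rewrite (Rintegral_FTC2 ab (continuous_cosM (k := k)) (derivable_continuous d)) => //.
by field.
Qed.

Lemma sin_nat_pi n : sin (n%:R * pi) = 0 :> R.
Proof.
elim: n => [|n ih]; first by rewrite mul0r sin0.
by rewrite -natr1 mulrDl mul1r sinDpi ih oppr0.
Qed.

(** The unnormalised sine coefficient; not the cardinal sine. *)
Definition sinc k g : R := \int[mu]_(x in I) (g x * sin (k.+1%:R * x)).

Lemma integrable_sinM (k : R) g : mu.-integrable I (EFin \o g) ->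
  mu.-integrable I (EFin \o (fun x => g x * sin (k * x))).
Proof.
move=> ig; rewrite (_ : (fun x => _) = (fun x => sin (k * x) * g x)).
  apply: (@integrableMbounded _ _ _ _ 1) => // [|x _]; last exact: sin_norm_le1.
  by apply: measurable_funTS; exact: measurable_sinM.
by apply/funext => x; rewrite mulrC.
Qed.

Lemma integrable_cosM (k : R) g : mu.-integrable I (EFin \o g) ->
  mu.-integrable I (EFin \o (fun x => g x * cos (k * x))).
Proof.
move=> ig; rewrite (_ : (fun x => _) = (fun x => cos (k * x) * g x)).
  apply: (@integrableMbounded _ _ _ _ 1) => // [|x _]; last exact: cos_norm_le1.
  by apply: measurable_funTS; exact: measurable_cosM.
by apply/funext => x; rewrite mulrC.
Qed.

(** Two scalar multiples, because each part of a complex multiple a z + z' involves both parts of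
    z. *)
Lemma sinc_linear k (b c : R) f g h : mu.-integrable I (EFin \o f) ->
  mu.-integrable I (EFin \o g) -> mu.-integrable I (EFin \o h) ->
  mu.-integrable I (EFin \o (fun x => b * f x + c * g x + h x)) /\
  sinc k (fun x => b * f x + c * g x + h x) = b * sinc k f + c * sinc k g + sinc k h.
Proof.
move=> fi gi hi.
have iZ (a : R) u : mu.-integrable I (EFin \o u) ->
    mu.-integrable I (EFin \o (fun x => a * u x)).
  by move=> ui; exact: (@integrableZl _ _ R mu I mI a _ ui).
split; first by apply: integrable_addI => //; apply: integrable_addI; exact: iZ.
have [fs gs hs] := And3 (integrable_sinM k.+1%:R fi) (integrable_sinM k.+1%:R gi)
  (integrable_sinM k.+1%:R hi).
have [fz gz] := conj (iZ b _ fs) (iZ c _ gs).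
rewrite /sinc.
transitivity (\int[mu]_(x in I) (b * (f x * sin (k.+1%:R * x)) +
   c * (g x * sin (k.+1%:R * x)) + h x * sin (k.+1%:R * x))).
  by apply: eq_Rintegral => x _; ring.
rewrite RintegralD//; last exact: integrable_addI.
by rewrite RintegralD// !RintegralZl.
Qed.

(* sin (k x) (1 + cos x) is a combination of sines, so all moments of h(x) sin x with
   respect to the decreasing function 1 + cos x vanish. *)
Lemma sine_complete h : mu.-integrable I (EFin \o h) ->
  (forall k, sinc k h = 0) -> {ae mu, forall x, I x -> h x = 0}.
Proof.
move=> ih h0; pose y (x : R) := 1 + cos x.
have cy : continuous y.
  by move=> x; apply: cvgD; [exact: cvg_cst|exact: continuous_cos].
have my n : measurable_fun I (fun x => y x ^+ n).
  by apply: measurable_funX; apply: measurable_funTS; exact: continuous_measurable_fun.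
have yb x : `|y x| <= 2.
  by rewrite (le_trans (ler_normD _ _))// normr1 lerD// cos_norm_le1.
have iyn n g : mu.-integrable I (EFin \o g) ->
    mu.-integrable I (EFin \o (fun x => y x ^+ n * g x)).
  move=> ig; apply: (@integrableMbounded _ _ _ _ (2 ^+ n)) => // x _.
  by rewrite normrX lerXn2r ?nnegrE.
have mom n : forall k : nat, \int[mu]_(x in I) (y x ^+ n * (h x * sin (k%:R * x))) = 0.
  elim: n => [|n ihn] k.
    under eq_Rintegral do rewrite expr0 mul1r.
    case: k => [|k]; last exact: h0.
    under eq_Rintegral do rewrite mul0r sin0 mulr0.
    by rewrite Rintegral_cst// mul0r.
  case: k => [|k].
    under eq_Rintegral do rewrite mul0r sin0 !mulr0.
    by rewrite Rintegral_cst// mul0r.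
  (* 2 cos x sin ((k + 1) x) = sin ((k + 2) x) + sin (k x); both frequencies change, so the
     induction covers all k at once, 0 included. *)
  have E x : y x ^+ n.+1 * (h x * sin (k.+1%:R * x)) =
      y x ^+ n * (h x * sin (k.+1%:R * x)) +
      (2^-1 * (y x ^+ n * (h x * sin (k.+2%:R * x))) +
       2^-1 * (y x ^+ n * (h x * sin (k%:R * x)))).
    have -> : k.+2%:R * x = k.+1%:R * x + x by rewrite -natr1 mulrDl mul1r.
    have -> : k%:R * x = k.+1%:R * x - x by rewrite -natr1; ring.
    by rewrite sinB sinD exprS /y; field.
  have ii m := iyn n _ (integrable_sinM m ih).
  have iZ m : mu.-integrable I (EFin \o (fun x => 2^-1 * (y x ^+ n * (h x * sin (m * x))))).
    exact: (@integrableZl _ _ R mu I mI 2^-1 _ (ii m)).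
  under eq_Rintegral do rewrite E.
  rewrite RintegralD//; last exact: integrable_addI.
  by rewrite RintegralD// !RintegralZl// !ihn !mulr0 !addr0.
have i1 := integrable_sinM 1 ih.
have z x0 : 0 < x0 < pi -> \int[mu]_(s in `[0, x0]) (h s * sin (1 * s)) = 0.
  move=> x0I; have /andP[x00 x0p] := x0I.
  have cosdec a b : 0 <= a -> a < b -> b <= pi -> y b < y a.
    move=> a0 ab bp; rewrite ltrD2l ltr_cos// in_itv/=.
      by rewrite a0 (le_trans (ltW ab) bp).
    by rewrite bp (le_trans a0 (ltW ab)).
  have ypi : y pi = 0 by rewrite /y cospi subrr.
  (* All the moments are 0, so d = C = 0; this requires y x0 > 0, true since y decreases strictly to
     y pi = 0. *)
  apply: (@moment_vanish _ pi x0 0 0 y) => //.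
  - by move=> x _; rewrite /y; have := cos_norm_le1 x; rewrite ler_norml => /andP[]; lra.
  - by apply: measurable_funTS; exact: continuous_measurable_fun.
  - by rewrite lexx/= -ypi; apply: cosdec => //; exact: ltW.
  - move=> n; rewrite mul0r; have := mom n.+1 1%N.
    by move=> ->; rewrite normr0.
have := Rintegral0_ae pi0 i1 z.
have aux (c : R) : {ae mu, forall x, x != c}.
  exists [set c]; split => //; first exact: lebesgue_measure_set1.
  by move=> x /= /negP; rewrite negbK => /eqP.
move=> h1; have a0 := aux 0; have ap := aux pi.
apply: (@filterS3 _ _ (ae_filter_ringOfSetsType mu) _ _ _ _ _ h1 a0 ap).
move=> x hx x0 xp; rewrite /= in_itv/= => xI; have := hx xI.
move/eqP; rewrite mulf_eq0 mul1r => /orP[/eqP//|/eqP s0].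
have /andP[x1 x2] := xI; have : 0 < sin x.
  by apply: sin_gt0_pi; rewrite !lt_neqAle eq_sym x0 xp x1 x2.
by rewrite s0 ltxx.
Qed.

Let integrable_sub v x : mu.-integrable I (EFin \o v) -> I x ->
  mu.-integrable `[0, x] (EFin \o v).
Proof.
move=> iv; rewrite /= in_itv/= => /andP[x0 xp].
apply: (@integrableS _ _ R mu I) => // y /=; rewrite !in_itv/= => /andP[-> yx].
exact: le_trans xp.
Qed.

(** Integration by parts in the form of [triangle_Fubini], since v is only integrable. *)
Lemma integral_primitive_sinM (k : R) v : k != 0 -> mu.-integrable I (EFin \o v) ->
  \int[mu]_(x in I) ((\int[mu]_(s in `[0, x]) v s) * sin (k * x)) =
  ((\int[mu]_(x in I) (v x * cos (k * x))) - cos (k * pi) * \int[mu]_(x in I) v x) / k.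
Proof.
move=> k0 iv.
transitivity (\int[mu]_(x in I) \int[mu]_(s in `[0, x]) (sin (k * x) * v s)).
  apply: eq_Rintegral => x /set_mem xI; rewrite mulrC RintegralZl//.
  exact: integrable_sub.
rewrite (@triangle_Fubini _ pi 1 (fun p => sin (k * p.1)))//; first last.
- by move=> p; exact: sin_norm_le1.
- apply: (@measurableT_comp _ _ _ _ _ _ (fun t : R => sin (k * t))) => //.
  exact: measurable_sinM.
have -> : \int[mu]_(s in I) (\int[mu]_(t in `[s, pi]) sin (k * t) * v s) =
    \int[mu]_(s in I) ((v s * cos (k * s) - cos (k * pi) * v s) / k).
  apply: eq_Rintegral => s; rewrite inE/= in_itv/= => /andP[s0 sp].
  by rewrite integral_sinM//; field.
have ic := integrable_cosM k iv.
have iz : mu.-integrable I (EFin \o (fun x => cos (k * pi) * v x)).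
  exact: (@integrableZl _ _ R mu I mI _ _ iv).
rewrite RintegralZr//; last exact: integrable_subI.
by rewrite RintegralB// RintegralZl.
Qed.

Lemma integral_primitive_cosM (k : R) v : k != 0 -> mu.-integrable I (EFin \o v) ->
  \int[mu]_(x in I) ((\int[mu]_(s in `[0, x]) v s) * cos (k * x)) =
  (sin (k * pi) * (\int[mu]_(x in I) v x) - \int[mu]_(x in I) (v x * sin (k * x))) / k.
Proof.
move=> k0 iv.
transitivity (\int[mu]_(x in I) \int[mu]_(s in `[0, x]) (cos (k * x) * v s)).
  apply: eq_Rintegral => x /set_mem xI; rewrite mulrC RintegralZl//.
  exact: integrable_sub.
rewrite (@triangle_Fubini _ pi 1 (fun p => cos (k * p.1)))//; first last.
- by move=> p; exact: cos_norm_le1.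
- apply: (@measurableT_comp _ _ _ _ _ _ (fun t : R => cos (k * t))) => //.
  exact: measurable_cosM.
have -> : \int[mu]_(s in I) (\int[mu]_(t in `[s, pi]) cos (k * t) * v s) =
    \int[mu]_(s in I) ((sin (k * pi) * v s - v s * sin (k * s)) / k).
  apply: eq_Rintegral => s; rewrite inE/= in_itv/= => /andP[s0 sp].
  by rewrite integral_cosM//; field.
have ic := integrable_sinM k iv.
have iz : mu.-integrable I (EFin \o (fun x => sin (k * pi) * v x)).
  exact: (@integrableZl _ _ R mu I mI _ _ iv).
rewrite RintegralZr//; last exact: integrable_subI.
by rewrite RintegralB// RintegralZl.
Qed.

(** Two integrations by parts. The boundary terms vanish because v has integral u pi - u 0 = 0, and
    because sin ((k + 1) x) is 0 at both ends. *)
Lemma sinc_second_primitive u v g k : mu.-integrable I (EFin \o v) ->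
  mu.-integrable I (EFin \o g) ->
  (forall x, 0 <= x <= pi -> u x = u 0 + \int[mu]_(s in `[0, x]) v s) ->
  (forall x, 0 <= x <= pi -> v x = v 0 + \int[mu]_(s in `[0, x]) g s) ->
  u 0 = 0 -> u pi = 0 -> k.+1%:R ^+ 2 * sinc k u = - sinc k g.
Proof.
move=> iv ig uE vE u0 up; set K : R := k.+1%:R.
have K0 : K != 0 by rewrite pnatr_eq0.
have v0 : \int[mu]_(x in I) v x = 0.
  by have := uE pi; rewrite u0 up add0r lexx ltW// => /(_ isT) <-.
have -> : sinc k u = \int[mu]_(x in I) ((\int[mu]_(s in `[0, x]) v s) * sin (K * x)).
  apply: eq_Rintegral => x; rewrite inE/= in_itv/= => /uE ->.
  by rewrite u0 add0r.
rewrite integral_primitive_sinM// v0 mulr0 subr0.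
have ic : mu.-integrable I (EFin \o (fun x => v 0 * cos (K * x))).
  apply: (@integrable_cosM K (fun=> v 0)).
  by apply: (@continuous_integrable_itv _ (cst (v 0))) => x; exact: cvg_cst.
have icK : mu.-integrable I (EFin \o (fun x => cos (K * x))).
  exact/continuous_integrable_itv/continuous_cosM.
have ip : mu.-integrable I (EFin \o (fun x => (\int[mu]_(s in `[0, x]) g s) * cos (K * x))).
  apply: (@eq_integrable _ _ _ mu I mI (EFin \o (fun x => v x * cos (K * x) - v 0 * cos (K * x)))).
    move=> x; rewrite inE/= in_itv/= => /vE ->; congr (_%:E).
    by ring.
  by apply: integrable_subI => //; exact: integrable_cosM.
have -> : \int[mu]_(x in I) (v x * cos (K * x)) =
    \int[mu]_(x in I) (v 0 * cos (K * x) + (\int[mu]_(s in `[0, x]) g s) * cos (K * x)).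
  by apply: eq_Rintegral => x; rewrite inE/= in_itv/= => /vE ->; ring.
rewrite RintegralD// RintegralZl// integral_primitive_cosM//.
rewrite integral_cosM ?(ltW pi0)// mulr0 sin0 sin_nat_pi subr0 !mul0r mulr0 add0r sub0r.
by rewrite -/(sinc k g); field.
Qed.

Lemma integrable_primitive u v : mu.-integrable I (EFin \o v) ->
  (forall x, 0 <= x <= pi -> u x = u 0 + \int[mu]_(s in `[0, x]) v s) ->
  mu.-integrable I (EFin \o u).
Proof.
move=> iv uE; pose P x := \int[mu]_(s in `[0, x]) v s.
have iP : mu.-integrable I (EFin \o P).
  apply: continuous_compact_integrable; first exact: segment_compact.
  exact: (parameterized_integral_continuous (ltW pi0) iv).
have ic : mu.-integrable I (EFin \o (fun=> u 0)).
  by apply: (@continuous_integrable_itv _ (cst (u 0))) => x; exact: cvg_cst.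
apply: (@eq_integrable _ _ _ mu I mI (EFin \o (fun x => u 0 + P x))).
  by move=> x; rewrite inE/= in_itv/= => /uE ->.
exact: integrable_addI.
Qed.

Lemma exists_second_primitive g : mu.-integrable I (EFin \o g) ->
  exists u v : R -> R, [/\ mu.-integrable I (EFin \o v),
    forall x, 0 <= x <= pi -> u x = u 0 + \int[mu]_(s in `[0, x]) v s,
    forall x, 0 <= x <= pi -> v x = v 0 + \int[mu]_(s in `[0, x]) g s,
    u 0 = 0 & u pi = 0].
Proof.
move=> ig; pose P x := \int[mu]_(s in `[0, x]) g s.
have at0 f : \int[mu]_(s in `[0, 0]) f s = 0 by rewrite set_itv1 Rintegral_set1.
(* c is the initial slope v 0 for which u pi = 0. *)
pose c := - (\int[mu]_(x in I) P x) / pi.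
have iP : mu.-integrable I (EFin \o P).
  by apply: (integrable_primitive ig) => x _; rewrite /P at0 add0r.
have ic : mu.-integrable I (EFin \o (fun=> c)).
  by apply: (@continuous_integrable_itv _ (cst c)) => x; exact: cvg_cst.
exists (fun x => \int[mu]_(s in `[0, x]) (c + P s)), (fun x => c + P x); split.
- exact: (@integrableD _ _ _ mu I mI _ _ ic iP).
- by move=> x _; rewrite at0 add0r.
- by move=> x _; rewrite {2}/P at0 addr0.
- by rewrite at0.
- rewrite RintegralD// Rintegral_cst//= lebesgue_measure_itv/= lte_fin pi0.
  by rewrite oppr0 adde0/= /c divfK ?gt_eqF// addNr.
Qed.

Lemma sine_orthogonal j k :
  \int[mu]_(x in I) (sin (j.+1%:R * x) * sin (k.+1%:R * x)) =
  if j == k then pi / 2 else 0.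
Proof.
have E x : sin (j.+1%:R * x) * sin (k.+1%:R * x) =
    2^-1 * cos ((j%:R - k%:R) * x) - 2^-1 * cos ((j + k).+2%:R * x) :> R.
  have -> : (j%:R - k%:R) * x = j.+1%:R * x - k.+1%:R * x by rewrite -!natr1; ring.
  have -> : (j + k).+2%:R * x = j.+1%:R * x + k.+1%:R * x.
    by rewrite -mulrDl -natrD addSn addnS.
  by rewrite cosB cosD; field.
have ic (m : R) : mu.-integrable I (EFin \o (fun x => cos (m * x))).
  exact/continuous_integrable_itv/continuous_cosM.
have icZ (m : R) : mu.-integrable I (EFin \o (fun x => 2^-1 * cos (m * x))).
  exact: (@integrableZl _ _ R mu I mI 2^-1 _ (ic m)).
under eq_Rintegral do rewrite E.
rewrite RintegralB// !RintegralZl//.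
have -> : \int[mu]_(x in I) cos ((j + k).+2%:R * x) = 0.
  have n0 : (j + k).+2%:R != 0 :> R by rewrite pnatr_eq0.
  by rewrite (integral_cosM n0 (ltW pi0)) sin_nat_pi mulr0 sin0 subrr mul0r.
rewrite mulr0 subr0.
case: eqP => [<-|jk].
  under eq_Rintegral do rewrite subrr mul0r cos0.
  rewrite Rintegral_cst//= lebesgue_measure_itv/= lte_fin pi0 oppr0 adde0/= mul1r.
  by rewrite mulrC.
have jk0 : j%:R - k%:R != 0 :> R by rewrite subr_eq0 eqr_nat; exact/eqP.
rewrite integral_cosM ?(ltW pi0)// mulr0 sin0 subr0 mulrBl sinB !sin_nat_pi.
by rewrite mul0r mulr0 subrr mul0r mulr0.
Qed.

Let sum_inv_sqr n : \sum_(0 <= k < n) (k.+1%:R ^+ 2)^-1 <= 2 :> R.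
Proof.
case: n => [|n]; first by rewrite big_geq.
(* The correction 1 / (n + 1) dominates the remainder of the series and carries the induction. *)
suff : \sum_(0 <= k < n.+1) (k.+1%:R ^+ 2)^-1 <= 2 - n.+1%:R^-1 :> R.
  by move/le_trans; apply; rewrite gerBl.
elim: n => [|n ih]; first by rewrite big_nat1 expr1n invr1; lra.
rewrite big_nat_recr//=; apply: (le_trans (lerD ih (lexx _))).
have n1 : 0 < n.+1%:R :> R by rewrite ltr0n.
rewrite -[n.+2%:R]natr1; move: n1; set x : R := n.+1%:R => x1.
have y1 : 0 < x + 1 by rewrite addr_gt0.
rewrite -subr_ge0 (_ : _ - _ = (x * (x + 1) ^+ 2)^-1).
  by rewrite invr_ge0 mulr_ge0 ?sqr_ge0// ltW.
by field; rewrite !gt_eqF.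
Qed.

(** The sine series converges absolutely with partial sums bounded by 2 S, so its coefficients are
    computed by dominated convergence and orthogonality. *)
Lemma sine_synthesis (a : nat -> R) (S : R) :
  (forall k, `|a k| <= S / k.+1%:R ^+ 2) ->
  exists F : R -> R, [/\ measurable_fun setT F,
    forall x, `|F x| <= 2 * S & forall k, sinc k F = a k].
Proof.
move=> aS; have S0 : 0 <= S.
  by have := le_trans (normr_ge0 _) (aS 0%N); rewrite expr1n divr1.
have p2 : 2 / pi <= 1 :> R by rewrite ler_pdivrMr// mul1r pi_ge2.
have p20 : 0 <= 2 / pi :> R by rewrite divr_ge0// ltW.
(* pi / 2 is the integral of sin ((k + 1) x)^2 over [0, pi]. *)
pose b k := 2 / pi * a k.
have bS k : `|b k| <= S / k.+1%:R ^+ 2.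
  by rewrite normrM ger0_norm// (le_trans (ler_piMl _ p2)).
pose f (x : R) k := b k * sin (k.+1%:R * x).
have sumS x n : \sum_(0 <= k < n) `|f x k| <= 2 * S.
  apply: (@le_trans _ _ (\sum_(0 <= k < n) S * (k.+1%:R ^+ 2)^-1)).
    apply: ler_sum => k _; rewrite normrM.
    by rewrite (le_trans (ler_piMr _ (sin_norm_le1 _))).
  by rewrite -mulr_sumr mulrC ler_wpM2r.
have cf x : cvgn (series (f x)).
  apply: normed_cvg; apply: nondecreasing_is_cvgn.
    by apply: nondecreasing_series => n _ _ /=.
  by exists (2 * S) => _ [n _ <-]; exact: sumS.
pose F x := limn (series (f x)).
have sn x n : `|series (f x) n| <= 2 * S.
  by rewrite (le_trans (ler_norm_sum _ _ _)).
have mf n : measurable_fun setT (fun x => series (f x) n).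
  by apply: measurable_sum => k; apply: measurable_funM => //;
    exact: measurable_sinM.
have mF : measurable_fun setT F.
  by apply: (measurable_fun_cvg mf) => x _; exact: cf.
exists F; split => //.
  move=> x; have h : (fun n => `|series (f x) n|) @ \oo --> `|F x|.
    by apply: cvg_norm; exact: cf.
  by apply: (cvgn_le h); exact: nearW.
move=> k.
have i2 : mu.-integrable I (EFin \o (fun=> 2 * S)).
  by apply: (@continuous_integrable_itv _ (cst (2 * S))) => x; exact: cvg_cst.
have ms : measurable_fun setT (fun x : R => sin (k.+1%:R * x)).
  exact: measurable_sinM.
have := @Rintegral_dominated _ I (fun n x => series (f x) n * sin (k.+1%:R * x))
  (fun x => F x * sin (k.+1%:R * x)) (fun=> 2 * S) mI _ _ _ i2 _.
move=> dom; have {}dom : (fun n => \int[mu]_(x in I) (series (f x) n * sin (k.+1%:R * x)))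
    @ \oo --> sinc k F.
  apply: dom.
  - by move=> n; apply/measurable_funTS/measurable_funM.
  - by apply: measurable_funTS; apply: measurable_funM.
  - by apply: aeW => x _; apply: cvgM; [exact: cf|exact: cvg_cst].
  - move=> n x _; rewrite normrM -[leRHS]mulr1 ler_pM ?sin_norm_le1//.
apply: (cvg_unique _ dom) => //.
apply: cvg_near_cst; near=> n.
have kn : (k < n)%N by near: n; exists k.+1.
have ij j : mu.-integrable I (EFin \o (fun x => f x j * sin (k.+1%:R * x))).
  apply: integrable_sinM; apply: continuous_integrable_itv.
  by move=> x; apply: cvgM; [exact: cvg_cst|exact: continuous_sinM].
have [_ E] := @Rintegral_sum _ I (fun j x => f x j * sin (k.+1%:R * x)) n mI ij.
rewrite (_ : (fun x => series (f x) n * sin (k.+1%:R * x)) =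
   (fun x => \sum_(0 <= j < n) f x j * sin (k.+1%:R * x))); last first.
  by apply/funext => x; rewrite /series/= mulr_suml.
rewrite E big_mkord (bigD1 (Ordinal kn))//= big1 => [|j jk].
  rewrite addr0 /f; under eq_Rintegral do rewrite -mulrA.
  rewrite RintegralZl//; last first.
    by apply: integrable_sinM; exact/continuous_integrable_itv/continuous_sinM.
  have cancel (p y : R) : p != 0 -> 2 / p * y * (p / 2) = y by move=> p0; field.
  by rewrite sine_orthogonal eqxx /b cancel// gt_eqF.
rewrite /f; under eq_Rintegral do rewrite -mulrA.
rewrite RintegralZl//; last first.
  by apply: integrable_sinM; exact/continuous_integrable_itv/continuous_sinM.
rewrite sine_orthogonal ifF ?mulr0//; apply/negbTE.
by apply: contra jk => /eqP jk; apply/eqP/val_inj.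
Unshelve. all: by end_near. Qed.

Lemma sinc_inj f g : mu.-integrable I (EFin \o f) -> mu.-integrable I (EFin \o g) ->
  (forall k, sinc k f = sinc k g) -> {ae mu, forall t, I t -> f t = g t}.
Proof.
move=> fi gi fg; have := sine_complete (integrable_subI fi gi).
have h k : sinc k (fun t => f t - g t) = 0.
  rewrite /sinc; under eq_Rintegral do rewrite mulrBl.
  rewrite RintegralB//; try exact: integrable_sinM.
  by rewrite -!/(sinc _ _) fg subrr.
move=> /(_ h); apply: filterS; first exact: (ae_filter_ringOfSetsType mu).
by move=> t ht tI; apply/eqP; rewrite -subr_eq0; apply/eqP; exact: ht.
Qed.
End sine_coefficients.

(** * Sine coefficients of the classes in L^2 *)

Section L2_coefficients.
Context {R : realType}.
Local Notation mu := (@lebesgue_measure R).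
Local Notation I := (`[0, pi]%classic : set R).
Local Notation L := (lebesgue_0pi R).

Let pi0 : 0 < pi :> R := pi_gt0 R.

Let mI : measurable I. Proof. exact: measurable_itv. Qed.

Let LE (A : set R) : L A = mu (A `&` I). Proof. by []. Qed.

Lemma ae_0piP (P : R -> Prop) :
  (\forall x \ae L, P x) <-> {ae mu, forall x, I x -> P x}.
Proof.
split.
  move=> [N [mN N0 PN]]; exists (N `&` I); split; first exact: measurableI.
    exact: N0.
  by move=> x /= /not_implyP[xI nP]; split => //; exact: PN.
move=> [N [mN N0 PN]]; exists (N `|` ~` I); split.
- by apply: measurableU => //; exact: measurableC.
- apply/eqP; rewrite eq_le measure_ge0 andbT.
  have h : (mu (N `&` I) <= mu N)%E.
    by apply: le_measure; rewrite ?inE//; exact: measurableI.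
  rewrite N0 in h; apply: le_trans h.
  have -> : L (N `|` ~` I) = mu (N `&` I) by rewrite LE setIUl setICl setU0.
  exact: lexx.
- move=> x /= nP; have [xI|] := pselect (I x); last by right.
  by left; apply: PN => /= /(_ xI).
Qed.

Lemma integral_0pi (f : R -> \bar R) : measurable_fun setT f -> (forall x, 0 <= f x)%E ->
  (\int[L]_x f x = \int[mu]_(x in I) f x)%E.
Proof.
move=> mf f0.
transitivity (\int[L]_(x in I) f x)%E; last first.
  apply: eq_measure_integral => A mA AI; rewrite LE.
  by congr (mu _); apply: setIidl.
have mC : measurable (~` I) by exact: measurableC.
have LC : L (~` I) = 0%E by rewrite LE setICl measure0.
rewrite (@ge0_negligible_integral _ _ R L setT (~` I) f mC measurableT mf (fun x _ => f0 x)).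
  by rewrite setTD setCK.
exact: LC.
Qed.

Lemma L2norm_integral (f : cLfunType2 L) :
  ((L2norm f ^+ 2)%:E = \int[mu]_(x in I) ((normc (f x)) ^+ 2)%:E)%E.
Proof.
have [fr fi _] := cLfunType2P f.
have mn := measurable_normc fr fi.
have E : (\int[mu]_(x in I) ((normc (f x)) ^+ 2)%:E = \int[L]_x (`|(normc (f x))%:E| `^ 2))%E.
  rewrite -integral_0pi.
  - by apply: eq_integral => x _ /=; rewrite ger0_norm ?normc_ge0// powR_mulrn ?normc_ge0.
  - by apply/measurable_EFinP; exact: measurable_funX.
  - by move=> x; rewrite lee_fin sqr_ge0.
have := L2norm_fin f; rewrite unlock /Lnorm -E.
have : (0 <= \int[mu]_(x in I) ((normc (f x)) ^+ 2)%:E)%E.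
  by apply: integral_ge0 => x _; rewrite lee_fin sqr_ge0.
case: (\int[mu]_(x in I) _)%E => [r||]//= r0; last by rewrite invr_eq0 pnatr_eq0.
case; rewrite powR12_sqrt// => ->.
by rewrite sqr_sqrtr.
Qed.

Let integrable_cst (c : R) : mu.-integrable I (EFin \o (fun=> c)).
Proof. by apply: (@continuous_integrable_itv _ (cst c)) => x; exact: cvg_cst. Qed.

Let int_cst (c : R) : \int[mu]_(x in I) c = c * pi.
Proof. by rewrite Rintegral_cst//= lebesgue_measure_itv/= lte_fin pi0 oppr0 adde0. Qed.

Lemma integrable_normc2 (f : cLfunType2 L) :
  mu.-integrable I (EFin \o (fun x => (normc (f x)) ^+ 2)) /\
  \int[mu]_(x in I) (normc (f x)) ^+ 2 = L2norm f ^+ 2.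
Proof.
have [fr fi _] := cLfunType2P f.
have mn := measurable_normc fr fi; have E := L2norm_integral f.
split; last by rewrite /Rintegral -E.
apply/integrableP; split.
  by apply/measurable_EFinP; apply: measurable_funTS; exact: measurable_funX.
rewrite (eq_integral (fun x => ((normc (f x)) ^+ 2)%:E)).
  by rewrite -E ltry.
by move=> x _ /=; rewrite ger0_norm// sqr_ge0.
Qed.

(** From |g| <= (1 + |f|^2) / 2; the bound is not homogeneous, which a rescaling repairs later. *)
Lemma integrable_of_le_normc (f : cLfunType2 L) (g : R -> R) : measurable_fun setT g ->
  (forall x, `|g x| <= normc (f x)) ->
  mu.-integrable I (EFin \o g) /\
  \int[mu]_(x in I) `|g x| <= (pi + L2norm f ^+ 2) / 2.
Proof.
move=> mg gf; have [i2 E] := integrable_normc2 f.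
have ih : mu.-integrable I (EFin \o (fun x => 2^-1 * (1 + normc (f x) ^+ 2))).
  by apply: (@integrableZl _ _ R mu I mI 2^-1 _ (integrableD _ (integrable_cst 1) i2)).
have le x : `|g x| <= 2^-1 * (1 + normc (f x) ^+ 2).
  apply: le_trans (gf x) _; rewrite mulrC ler_pdivlMr//.
  by have := sqr_ge0 (1 - normc (f x)); lra.
have ig : mu.-integrable I (EFin \o g).
  apply: (@le_integrable _ _ _ mu I mI _ _ _ _ ih).
    by apply/measurable_EFinP; exact: measurable_funTS.
  move=> x _ /=; rewrite lee_fin (le_trans (le x))// ler_norm//.
split => //; apply: (@le_trans _ _ (\int[mu]_(x in I) (2^-1 * (1 + normc (f x) ^+ 2)))).
  exact: (@le_Rintegral _ _ R mu I (fun x => `|g x|) (fun x => 2^-1 * (1 + normc (f x) ^+ 2))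
    mI (integrable_norm ig) ih (fun x _ => le x)).
rewrite RintegralZl//; last exact: (integrableD _ (integrable_cst 1) i2).
by rewrite RintegralD// E int_cst mul1r mulrC.
Qed.

Lemma integrable_L2_repr (x : L2_0pi R) :
  mu.-integrable I (EFin \o (fun t => complex.Re (L2_repr x t))) /\
  mu.-integrable I (EFin \o (fun t => complex.Im (L2_repr x t))).
Proof.
have [fr fi _] := cLfunType2P (repr (x : cL2 L)).
by split; [have [] := integrable_of_le_normc fr (fun t => Re_le_normc _)
          |have [] := integrable_of_le_normc fi (fun t => Im_le_normc _)].
Qed.

Lemma sinc_ae k (f g : R -> R) : mu.-integrable I (EFin \o f) ->
  mu.-integrable I (EFin \o g) -> {ae mu, forall x, I x -> f x = g x} ->
  sinc k f = sinc k g.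
Proof.
move=> fi gi fg; rewrite /sinc /Rintegral; congr fine.
apply: ae_eq_integral => //.
- by have /measurable_int := integrable_sinM k.+1%:R fi.
- by have /measurable_int := integrable_sinM k.+1%:R gi.
- move: fg; apply: filterS; first exact: (ae_filter_ringOfSetsType mu).
  by move=> x h xI /=; rewrite h.
Qed.

Definition L2coef k (x : L2_0pi R) : R[i] :=
  sinc k (fun t => complex.Re (L2_repr x t)) +i* sinc k (fun t => complex.Im (L2_repr x t)).

Lemma L2_repr_pi (f : cLfunType2 L) :
  {ae mu, forall t, I t -> L2_repr (\pi_(cL2 L)%qT f) t = f t}.
Proof. by apply/ae_0piP; exact: cL2_reprE. Qed.

Lemma L2_repr_linear (a : R[i]) (x y : L2_0pi R) :
  {ae mu, forall t, I t -> L2_repr (a *: x + y) t = a * L2_repr x t + L2_repr y t}.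
Proof.
have -> : a *: x + y = \pi_(cL2 L)%qT (a *: repr (x : cL2 L) + repr (y : cL2 L)).
  by rewrite pi_addr -cL2_pi_scale !reprK.
exact: L2_repr_pi.
Qed.

Lemma L2coef_linear k (a : R[i]) (x y : L2_0pi R) :
  L2coef k (a *: x + y) = a * L2coef k x + L2coef k y.
Proof.
have [xr xi] := integrable_L2_repr x; have [yr yi] := integrable_L2_repr y.
have [zr zi] := integrable_L2_repr (a *: x + y).
have reE (b c d : R[i]) : complex.Re (b * c + d) =
  complex.Re b * complex.Re c - complex.Im b * complex.Im c + complex.Re d.
  by case: b c d => [? ?] [? ?] [? ?].
have imE (b c d : R[i]) : complex.Im (b * c + d) =
  complex.Re b * complex.Im c + complex.Im b * complex.Re c + complex.Im d.
  by case: b c d => [? ?] [? ?] [? ?].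
have [ir Er] := sinc_linear k (complex.Re a) (- complex.Im a) xr xi yr.
have [ii Ei] := sinc_linear k (complex.Re a) (complex.Im a) xi xr yi.
have h := L2_repr_linear a x y.
apply/eqP; rewrite eq_complex reE imE /=; apply/andP; split; apply/eqP.
  rewrite -mulNr -Er; apply: sinc_ae => //.
  move: h; apply: filterS; first exact: (ae_filter_ringOfSetsType mu).
  by move=> t h tI; rewrite h// reE mulNr.
rewrite -Ei; apply: sinc_ae => //.
move: h; apply: filterS; first exact: (ae_filter_ringOfSetsType mu).
by move=> t h tI; rewrite h// imE.
Qed.

Lemma L2coef_inj (x y : L2_0pi R) : (forall k, L2coef k x = L2coef k y) -> x = y.
Proof.
move=> xy.
have [xr xi] := integrable_L2_repr x; have [yr yi] := integrable_L2_repr y.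
have h1 : {ae mu, forall t, I t -> complex.Re (L2_repr x t) = complex.Re (L2_repr y t)}.
  by apply: sinc_inj => // k; have [] := xy k.
have h2 : {ae mu, forall t, I t -> complex.Im (L2_repr x t) = complex.Im (L2_repr y t)}.
  by apply: sinc_inj => // k; have [] := xy k.
rewrite -[x](@reprK _ _ (x : cL2 L)) -[y](@reprK _ _ (y : cL2 L)).
apply/eqP/cL2_eqP/ae_0piP.
apply: (@filterS2 _ _ (ae_filter_ringOfSetsType mu) _ _ _ _ h1 h2) => t e1 e2 tI.
by apply/eqP; rewrite eq_complex; apply/andP; split; apply/eqP; [exact: e1|exact: e2].
Qed.

Lemma L2coef_le (x : L2_0pi R) k : normc (L2coef k x) <= pi + L2norm (repr (x : cL2 L)) ^+ 2.
Proof.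
have [fr fi _] := cLfunType2P (repr (x : cL2 L)).
have [ir br] := integrable_of_le_normc fr (fun t => Re_le_normc _).
have [ii bi] := integrable_of_le_normc fi (fun t => Im_le_normc _).
have key (g : R -> R) : mu.-integrable I (EFin \o g) -> `|sinc k g| <= \int[mu]_(x in I) `|g x|.
  move=> ig; have igs := integrable_sinM k.+1%:R ig.
  rewrite (le_trans (@le_normr_Rintegral _ _ R mu I (fun t => g t * sin (k.+1%:R * t)) mI igs))//.
  apply: (@le_Rintegral _ _ R mu I (fun t => `|g t * sin (k.+1%:R * t)|) (fun t => `|g t|)
    mI (integrable_norm igs) (integrable_norm ig)) => t _ /=.
  by rewrite normrM ler_piMr// sin_norm_le1.
rewrite (le_trans (normc_le _))//=.
have := le_trans (key _ ir) br; have := le_trans (key _ ii) bi; lra.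
Qed.

(** 4 pi covers both bounds: a class of norm 1 has coefficients at most pi + 1, and the synthesised
    function, at most 2 S for each of its two parts, has squared norm at most (4 S)^2 pi. *)
Lemma coefficient_system_L2 : coefficient_system L2coef (4 * pi).
Proof.
have M0 : 0 < 4 * pi :> R by rewrite mulr_gt0.
split => //.
- exact: L2coef_linear.
- move=> k x; rewrite rnormE -rmorphM lecR.
  have coef0 : L2coef k 0 = 0.
    by have := L2coef_linear k (-1) 0 0; rewrite scaler0 add0r mulN1r addNr.
  have coefZ a y : L2coef k (a *: y) = a * L2coef k y.
    by have := L2coef_linear k a y 0; rewrite coef0 !addr0.
  have [x0|x0] := eqVneq (rnorm x) 0.
    have -> : x = 0 by apply/eqP; rewrite -normr_eq0 rnormE x0.
    by rewrite coef0 normc0 mulr_ge0// ?rnorm_ge0// ltW.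
  have r0 : 0 < rnorm x by rewrite lt_def x0 rnorm_ge0.
  (* Applied to a class of norm 1, the inhomogeneous bound of [L2coef_le] becomes linear in the norm
     of x. *)
  have := L2coef_le ((rnorm x)^-1%:C *: x) k.
  have -> : L2norm (repr ((rnorm x)^-1%:C *: x : cL2 L)) = 1.
    have : `|(rnorm x)^-1%:C *: x| = 1.
      rewrite normrZ rnormE normCE normcR gtr0_norm ?invr_gt0//.
      by rewrite -rmorphM/= mulVf.
    by case.
  rewrite coefZ normcM normcR gtr0_norm ?invr_gt0// expr1n ler_pdivrMl//.
  move/le_trans; apply; rewrite mulrC ler_wpM2r ?rnorm_ge0//.
  have := pi_ge2 R; lra.
- exact: L2coef_inj.
- move=> a S aS.
  have S0 : 0 <= S.
    by have := le_trans (normc_ge0 _) (aS 0%N); rewrite expr1n divr1.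
  have [Fr [mr br cr]] := sine_synthesis (fun k => le_trans (Re_le_normc _) (aS k)).
  have [Fi [mi bi ci]] := sine_synthesis (fun k => le_trans (Im_le_normc _) (aS k)).
  pose F t : R[i] := Fr t +i* Fi t.
  have FS t : normc (F t) <= 4 * S.
    by rewrite (le_trans (normc_le _))//=; have := br t; have := bi t; lra.
  have mF := @measurable_normc _ _ _ F mr mi.
  have F2 : (\int[L]_x (`|(normc (F x))%:E| `^ 2) <= ((4 * S) ^+ 2 * pi)%:E)%E.
    have -> : (\int[L]_x (`|(normc (F x))%:E| `^ 2) =
        \int[mu]_(x in I) ((normc (F x)) ^+ 2)%:E)%E.
      rewrite -integral_0pi.
      - by apply: eq_integral => x _ /=; rewrite ger0_norm ?normc_ge0// powR_mulrn ?normc_ge0.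
      - by apply/measurable_EFinP; exact: measurable_funX.
      - by move=> x; rewrite lee_fin sqr_ge0.
    rewrite -(int_cst ((4 * S) ^+ 2)) /Rintegral fineK; last first.
      by apply: integrable_fin_num => //; exact: integrable_cst.
    apply: ge0_le_integral => //.
    + by move=> x _; rewrite lee_fin sqr_ge0.
    + by apply/measurable_EFinP; apply: measurable_funTS; exact: measurable_funX.
    + by move=> x _; rewrite lee_fin lerXn2r// nnegrE ?normc_ge0// mulr_ge0.
  have sF : square_integrable L F.
    split => //; rewrite /finite_norm unlock /Lnorm; apply: poweR_lty.
    by apply: (le_lt_trans F2); rewrite ltry.
  pose f : cLfunType2 L := CLfun2 (introT (cLfun2P _ _) sF).
  exists (\pi_(cL2 L)%qT f : L2_0pi R); split.
    have h := L2_repr_pi f.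
    have [xr xi] := integrable_L2_repr (\pi_(cL2 L)%qT f : L2_0pi R).
    have [ir _] := @integrable_of_le_normc f Fr mr (fun t => Re_le_normc (F t)).
    have [ii _] := @integrable_of_le_normc f Fi mi (fun t => Im_le_normc (F t)).
    move=> k; apply/eqP; rewrite eq_complex /=; apply/andP; split; apply/eqP.
      rewrite -cr; apply: sinc_ae => //.
      move: h; apply: filterS; first exact: (ae_filter_ringOfSetsType mu).
      by move=> t h tI; rewrite h.
    rewrite -ci; apply: sinc_ae => //.
    move: h; apply: filterS; first exact: (ae_filter_ringOfSetsType mu).
    by move=> t h tI; rewrite h.
  have -> : `|\pi_(cL2 L)%qT f : L2_0pi R| = (L2norm f)%:C by exact: cL2_pi_norm.
  rewrite lecR -ler_sqr ?nnegrE; first last.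
  + by rewrite mulr_ge0// ltW.
  + by rewrite fine_ge0// Lnorm_ge0.
  have := L2norm_integral f.
  have -> : (\int[mu]_(x in I) ((normc (f x)) ^+ 2)%:E)%E =
      (\int[L]_x (`|(normc (F x))%:E| `^ 2))%E.
    rewrite -integral_0pi.
    - by apply: eq_integral => x _ /=; rewrite ger0_norm ?normc_ge0// powR_mulrn ?normc_ge0.
    - by apply/measurable_EFinP; exact: measurable_funX.
    - by move=> x; rewrite lee_fin sqr_ge0.
  move=> E; move: F2; rewrite -E lee_fin => /le_trans; apply.
  have -> : (4 * pi * S) ^+ 2 = (4 * S) ^+ 2 * pi * pi :> R by ring.
  by rewrite ler_peMr ?mulr_ge0 ?sqr_ge0 ?(ltW pi0)//; have := pi_ge2 R; lra.
Qed.

End L2_coefficients.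

(** * The Dirichlet Laplacian and its powers in sine coefficients *)

Section dirichlet_spectrum.
Context {R : realType}.
Local Notation mu := (@lebesgue_measure R).
Local Notation I := (`[0, pi]%classic : set R).
Local Notation L := (lebesgue_0pi R).
Implicit Types f g : L2_0pi R.

Let is_primitive_ReIm (u v : R -> R[i]) : is_primitive_0pi u v <->
  [/\ mu.-integrable I (EFin \o (fun t => complex.Re (v t))),
      mu.-integrable I (EFin \o (fun t => complex.Im (v t))),
      forall x, 0 <= x <= pi -> complex.Re (u x) =
        complex.Re (u 0) + \int[mu]_(s in `[0, x]) complex.Re (v s) &
      forall x, 0 <= x <= pi -> complex.Im (u x) =
        complex.Im (u 0) + \int[mu]_(s in `[0, x]) complex.Im (v s)].
Proof.
split=> [[[ir ii] uv]|[ir ii ur ui]].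
  split=> // x /uv ->; rewrite /Cintegral; first by case: (u 0).
  by case: (u 0).
split=> // x x0; apply/eqP; rewrite eq_complex; apply/andP.
by rewrite /Cintegral; split; apply/eqP; [rewrite ur//|rewrite ui//]; case: (u 0).
Qed.

Let L2coefN k g : L2coef k (- g) = - L2coef k g.
Proof.
have c0 : L2coef k (0 : L2_0pi R) = 0.
  by have := L2coef_linear k (-1) 0 (0 : L2_0pi R); rewrite scaler0 add0r mulN1r addNr.
by have := L2coef_linear k (-1) g 0; rewrite c0 scaleN1r !addr0 mulN1r.
Qed.

(** Conversely, the second primitive of - g that vanishes at 0 and pi has the sine coefficients of
    f, hence is the required representative of f. *)
Lemma neg_dirichlet_laplacianP f g : neg_dirichlet_laplacian R (f, g) <->
  forall k, (k.+1%:R ^+ 2)%:C * L2coef k f = L2coef k g.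
Proof.
have [fr fi] := integrable_L2_repr f.
have [gr gi] := integrable_L2_repr (- g).
split.
  move=> [u [u' [/= /ae_0piP fu /is_primitive_ReIm[ur ui uE uF] /is_primitive_ReIm[_ _ vE vF] u0 up]]] k.
  have jr := integrable_primitive ur uE; have ji := integrable_primitive ui uF.
  have er := sinc_second_primitive k ur gr uE vE (congr1 (@complex.Re R) u0) (congr1 (@complex.Re R) up).
  have ei := sinc_second_primitive k ui gi uF vF (congr1 (@complex.Im R) u0) (congr1 (@complex.Im R) up).
  rewrite -[L2coef k g]opprK -L2coefN.
  apply/eqP; rewrite eq_complex Re_realC Im_realC /L2coef /=; apply/andP; split; apply/eqP.
    rewrite -er; congr (_ * _); apply: sinc_ae => //.
    move: fu; apply: filterS; first exact: (ae_filter_ringOfSetsType mu).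
    by move=> t h tI; rewrite h.
  rewrite -ei; congr (_ * _); apply: sinc_ae => //.
  move: fu; apply: filterS; first exact: (ae_filter_ringOfSetsType mu).
  by move=> t h tI; rewrite h.
move=> fg.
have [ur [vr [ivr urE vrE ur0 urp]]] := exists_second_primitive gr.
have [ui [vi [ivi uiE viE ui0 uip]]] := exists_second_primitive gi.
have K0 k : k.+1%:R ^+ 2 != 0 :> R by rewrite expf_neq0// pnatr_eq0.
have er k : sinc k (fun t => complex.Re (L2_repr f t)) = sinc k ur.
  apply: (mulfI (K0 k)); rewrite (sinc_second_primitive k ivr gr urE vrE ur0 urp).
  have := congr1 (@complex.Re R) (fg k); rewrite -[L2coef k g]opprK -L2coefN.
  by rewrite Re_realC.
have ei k : sinc k (fun t => complex.Im (L2_repr f t)) = sinc k ui.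
  apply: (mulfI (K0 k)); rewrite (sinc_second_primitive k ivi gi uiE viE ui0 uip).
  have := congr1 (@complex.Im R) (fg k); rewrite -[L2coef k g]opprK -L2coefN.
  by rewrite Im_realC.
have hr := sinc_inj fr (integrable_primitive ivr urE) er.
have hi := sinc_inj fi (integrable_primitive ivi uiE) ei.
exists (fun t => ur t +i* ui t), (fun t => vr t +i* vi t); split.
- apply/ae_0piP; apply: (@filterS2 _ _ (ae_filter_ringOfSetsType mu) _ _ _ _ hr hi) => t e1 e2 tI.
  by apply/eqP; rewrite eq_complex; apply/andP; split; apply/eqP; [exact: e1|exact: e2].
- exact/is_primitive_ReIm.
- exact/is_primitive_ReIm.
- by rewrite ur0 ui0.
- by rewrite urp uip.
Qed.

Lemma pow_neg_dirichlet_laplacianP m f g : pow_operator (neg_dirichlet_laplacian R) m (f, g) <->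
  forall k, ((k.+1%:R ^+ 2) ^+ m)%:C * L2coef k f = L2coef k g.
Proof.
have [M0 _ bd inj syn] := coefficient_system_L2 (R := R).
elim: m f g => [|m ih] f g /=.
  split=> [-> k|fg]; first by rewrite expr0 mul1r.
  by apply: inj => k; rewrite -fg expr0 mul1r.
split=> [[w [/neg_dirichlet_laplacianP fw /ih wg]] k|fg].
  by rewrite -wg -fw exprS mulrA [_ ^+ 2 * _]mulrC rmorphM.
case: m ih fg => [|m] ih fg.
  exists g; split=> //; apply/neg_dirichlet_laplacianP => k.
  by rewrite -fg expr1.
(* The exponent is now at least 2, so (k + 1)^4 times the coefficient of f is at most that of g in
   modulus: this is the decay that synthesis needs. Exponent 1 had to be treated apart, with g
   itself as intermediate element. *)
have [|w [wE _]] := syn (fun k => (k.+1%:R ^+ 2)%:C * L2coef k f) (4 * pi * rnorm g).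
  move=> k; rewrite ler_pdivlMr ?exprn_gt0//.
  have := bd k g; rewrite rnormE -rmorphM lecR -fg; apply: le_trans.
  rewrite !normcM !normcR !ger0_norm ?exprn_ge0 ?sqr_ge0//.
  rewrite mulrAC ler_wpM2r ?normc_ge0//.
  by rewrite -[leLHS]expr2 ler_weXn2l// exprn_ege1// ler1n.
exists w; split; first by apply/neg_dirichlet_laplacianP => k; rewrite wE.
by apply/ih => k; rewrite wE mulrA -rmorphM -exprSr fg.
Qed.

End dirichlet_spectrum.

Theorem mainTheorem10 (R : realType) (n : nat) (hn : (1 <= n)%N) :
  exists Kn KnS : R -> R[i],
    [/\ exp_bounded_kernel Kn,
        exp_bounded_kernel KnS,
        generates_exp_bounded_convoluted_cosine Kn
          (pow_operator (neg_dirichlet_laplacian R) (2 ^ n)) &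
        generates_exp_bounded_analytic_convoluted_semigroup KnS
          (pow_operator (neg_dirichlet_laplacian R) (2 ^ n)) (pi / 2)].
Proof.
exists (fun t => (Kcos t)%:C), (fun t => (Kexp t)%:C).
pose lam k : R := (k.+1%:R ^+ 2) ^+ (2 ^ n).
have lam_ge k : k.+1%:R ^+ 2 <= lam k.
  by rewrite /lam ler_eXnr ?expn_gt0// exprn_ege1// ler1n.
have lam_root k : Fres (lam k) = 0.
  (* After this shift, lam_k is the fourth power of (k + 1)^(2^n); its predecessor is the index of
     the root in [Fres_root]. *)
  case: n hn @lam {lam_ge} => // n _ /=.
  have k0 : (0 < k.+1 ^ (2 ^ n))%N by rewrite expn_gt0.
  rewrite -exprM (_ : 2 * 2 ^ n.+1 = 2 ^ n * 4)%N; last by rewrite expnS; lia.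
  by rewrite exprM -natrX -(prednK k0) Fres_root.
have BP := @pow_neg_dirichlet_laplacianP R (2 ^ n).
split.
- exact: exp_bounded_kernel_Kcos.
- exact: exp_bounded_kernel_Kexp.
- exact: (diagonal_generates_cosine coefficient_system_L2 lam_ge BP lam_root).
- exact: (diagonal_generates_semigroup coefficient_system_L2 lam_ge BP lam_root).
Qed.
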